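(* Let $F:\mathbb{C}\to\mathbb{C}$ be an entire function, $F\not\equiv 0$, and let $M\subset\mathbb{C}$ be a domain that is flow-invariant with respect to $F$. Let $\Gamma\subset\partial M\setminus F^{-1}(\{0\})$ be an arbitrary orbit of $\dot x=F(x)$. Let $x,y\in\Gamma$ with $\tau(x,y)>0$ and let $\varepsilon>0$. Then there exists $\delta\in(0,\varepsilon]$ such that the following two properties are satisfied: (i) $\mathcal{B}_\delta(x)\cap\mathcal{B}_\delta(y)=\emptyset$. (ii) For all orbits $\Lambda\subset M$ satisfying $\mathcal{B}_\delta(x)\cap\Lambda\neq\emptyset$ and $\mathcal{B}_\delta(y)\cap\Lambda\neq\emptyset$, and for all $x'\in\mathcal{B}_\delta(x)\cap\Lambda$ and $y'\in\mathcal{B}_\delta(y)\cap\Lambda$, $$|\tau(x',y')-\tau(x,y)|<\varepsilon$$ and $$|\Phi(t,x)-\Phi(t,x')|<\varepsilon\quad\text{for all }t\in[0,\tau(x,y)].$$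
   Context: Setting: for an entire function $F$, consider the planar ODE $\dot x=F(x)$, $x\in\mathbb{C}$, with real time $t$. For $x_0\in\mathbb{C}$ let $I(x_0)\subset\mathbb{R}$ be the maximal interval of existence of the solution $\Phi(\cdot,x_0)$ with $\Phi(0,x_0)=x_0$; the orbit through $x_0$ is $\Gamma(x_0)=\Phi(I(x_0),x_0)$. A domain is an open connected set. A set $M$ is flow-invariant if $\Gamma(x)\subset M$ for all $x\in M$; the boundary of a flow-invariant set is again flow-invariant. $\mathcal{B}_\delta(x)$ is the open disc of radius $\delta$ around $x$. An inequality involving $\Phi(t,x')$ includes the assertion that $t\in I(x')$. Transit time between two points: for a non-equilibrium orbit $\Gamma$ and $a,b\in\Gamma$, $$\tau(a,b):=\int_{\Gamma(a,b)}\frac{1}{F(z)}\,\mathrm{d}z,$$ where $\Gamma(a,b)$ is the piece of $\Gamma$ from $a$ to $b$ parametrized via $\dot x=F(x)$. Thus, if $a=\Phi(t_1,x_0)$ and $b=\Phi(t_2,x_0)$, then $\tau(a,b)=t_2-t_1$ (which may be negative). If the orbit is periodic with period $T$, $\Gamma(a,b)$ is the arc traversed from $a$ to $b$ forward in time less than one full period, so $\tau(a,b)\in[0,T)$. *)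

(* Defs.v *)
From Stdlib Require Import Reals ClassicalEpsilon.
From Coquelicot Require Export Coquelicot.

Open Scope R_scope.

Definition entire (F : C -> C) : Prop :=
  forall z : C, ex_derive (K := C_AbsRing) (V := C_NormedModule) F z.

(* The Euclidean disc; Coquelicot's [ball] on [C] is the square of the
   product uniform structure. *)
Definition Cdisc (c : C) (r : R) (z : C) : Prop := Cmod (z - c)%C < r.

Definition connected (M : C -> Prop) : Prop :=
  forall U V : C -> Prop,
    open U -> open V ->
    (forall z, M z -> U z \/ V z) ->
    (exists z, M z /\ U z) -> (exists z, M z /\ V z) ->
    exists z, M z /\ U z /\ V z.

Definition is_domain (M : C -> Prop) : Prop := open M /\ connected M.

Definition boundary (M : C -> Prop) (z : C) : Prop :=
  forall U : C -> Prop, locally z U ->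
    (exists w, U w /\ M w) /\ (exists w, U w /\ ~ M w).

Definition is_solution (F : C -> C) (J : R -> Prop) (x0 : C) (phi : R -> C)
  : Prop :=
  phi 0 = x0 /\
  forall t : R, J t ->
    is_derive (K := R_AbsRing) (V := C_R_NormedModule) phi t (F (phi t)).

(* I(x0): the union of all open intervals around 0 carrying a solution with
   initial value x0. *)
Definition max_interval (F : C -> C) (x0 : C) (t : R) : Prop :=
  exists (a b : R) (phi : R -> C),
    a < 0 < b /\ a < t < b /\ is_solution F (fun s => a < s < b) x0 phi.

(* Phi(t, x0); meaningful only for t in [max_interval F x0]. *)
Definition flow (F : C -> C) (t : R) (x0 : C) : C :=
  epsilon (inhabits (fun _ : R => x0))
          (is_solution F (max_interval F x0) x0) t.

Definition orbit (F : C -> C) (x0 z : C) : Prop :=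
  exists t : R, max_interval F x0 t /\ z = flow F t x0.

Definition is_orbit (F : C -> C) (G : C -> Prop) : Prop :=
  exists x0 : C, forall z : C, G z <-> orbit F x0 z.

Definition flow_invariant (F : C -> C) (M : C -> Prop) : Prop :=
  forall x : C, M x -> forall z : C, orbit F x z -> M z.

Definition is_period (F : C -> C) (a : C) (T : R) : Prop :=
  0 < T /\ max_interval F a T /\ flow F T a = a.

Definition minimal_period (F : C -> C) (a : C) (T : R) : Prop :=
  is_period F a T /\ forall T' : R, is_period F a T' -> T <= T'.

(* [is_arc F a b s]: the path r |-> Phi(r, a), with r running from 0 to s
   (backwards if s < 0), parametrizes the piece of the orbit from a to b. *)
Definition is_arc (F : C -> C) (a b : C) (s : R) : Prop :=
  max_interval F a s /\ flow F s a = b /\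
  forall T : R, minimal_period F a T -> 0 <= s < T.

Definition arc_end (F : C -> C) (a b : C) : R :=
  epsilon (inhabits 0) (is_arc F a b).

Definition path_derive (gamma : R -> C) (s : R) : C :=
  (Derive (fun r => Re (gamma r)) s, Derive (fun r => Im (gamma r)) s).

Definition path_integral (f : C -> C) (gamma : R -> C) (a b : R) : C :=
  let g (s : R) : C := (f (gamma s) * path_derive gamma s)%C in
  (RInt (fun s => Re (g s)) a b, RInt (fun s => Im (g s)) a b).

(* tau(a, b), for a and b on a common non-equilibrium orbit. The integral is
   real, since its integrand is identically 1 along the orbit; [Re] only
   adjusts the type. *)
Definition transit_time (F : C -> C) (a b : C) : R :=
  Re (path_integral (fun z => (/ F z)%C) (fun s => flow F s a)
        0 (arc_end F a b)).

(* Main.v *)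
(* Around a point where F does not vanish, a primitive of 1/F straightens the
   flow: in such charts the time-t map is locally a translation, even in complex
   time. So it is enough to exclude that orbits near y come back at a slightly
   different height v of a transversal section.

   A first return from height v to v + s closes, with the piece of the section
   between them, a curve J which the orbit cannot cross again: its winding
   number differs on the two sides of J. Hence later returns are at distance
   more than |s| from v. Moreover the return persists, by analytic continuation
   and with the same shift s, for all nearby heights above v or for all those
   below v: at the first height where it fails the orbit blows up without
   meeting J, so the winding number vanishes on that side, and this cannot
   happen on both sides. If arbitrarily small shifts occurred near y, one fixed
   point of the section would have arbitrarily small nonzero shifts among its
   returns, against the first bound. *)
Require Import Defs.
From Stdlib Require Import Reals.
From Coquelicot Require Import Coquelicot.
From Stdlib Require Import Lra Classical ClassicalEpsilon.
Open Scope R_scope.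

(** * Differentiation and induction over the reals *)

(** Nothing bounds the time an orbit takes between the two discs: continuous dependence controls it
    only up to about tau(x, y), and it could come back to y much later at another height, with
    another transit time. Once the heights agree, the transit time is explicit: tau(x, y) corrected
    by the real parts of the chart coordinates of x' and y'. The shift is preserved because two
    charts with the same centre coincide near 0. A time map taking one chart centre to another
    therefore acts there as the identity, and this propagates along the section as long as the
    orbits live. The winding number is handled as a Cauchy integral over J: its derivative depends
    on endpoints only and so vanishes for a loop, it tends to 0 at infinity, and it jumps where J is
    crossed. A solution that ends in finite time is unbounded, so it enters the region where the
    integral is small. Periodic orbits need care, since there tau is confined to one period: orbits
    near x must have no period up to tau(x, y) plus a margin. *)

Lemma Cmod_minus_sym (a b : C) : Cmod (a - b) = Cmod (b - a).
Proof. rewrite <- Cmod_opp; f_equal; ring. Qed.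

Lemma Cmod_triangle_minus (a b c : C) :
  Cmod (a - c) <= Cmod (a - b) + Cmod (b - c).
Proof. replace (a - c)%C with ((a - b) + (b - c))%C by ring; apply Cmod_triangle. Qed.

Lemma Cmod_triangle_inv (a b : C) : Cmod a - Cmod b <= Cmod (a - b).
Proof.
  pose proof (Cmod_triangle (a - b) b) as H.
  replace (a - b + b)%C with a in H by ring; lra.
Qed.

Lemma Cmod_eq_minus (a b : C) : Cmod (a - b) = 0 -> a = b.
Proof.
  intros H; apply Cmod_eq_0 in H.
  replace a with (a - b + b)%C by ring; rewrite H; ring.
Qed.

Lemma Cmod_minus_pos (a b : C) : a <> b -> 0 < Cmod (a - b).
Proof.
  intros H; destruct (Rle_lt_or_eq_dec _ _ (Cmod_ge_0 (a - b))) as [h|h]; auto.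
  exfalso; apply H, Cmod_eq_minus; auto.
Qed.

Lemma Rabs_Re_le (z : C) : Rabs (Re z) <= Cmod z.
Proof.
  eapply Rle_trans; [|apply Rmax_Cmod]; apply Rmax_l.
Qed.

Lemma Rabs_Im_le (z : C) : Rabs (Im z) <= Cmod z.
Proof.
  eapply Rle_trans; [|apply Rmax_Cmod]; apply Rmax_r.
Qed.

Lemma Cmod_le_Re_Im (z : C) : Cmod z <= Rabs (Re z) + Rabs (Im z).
Proof.
  destruct z as [a b]; unfold Cmod, Re, Im; simpl fst; simpl snd.
  pose proof (Rabs_pos a); pose proof (Rabs_pos b).
  rewrite <- (sqrt_Rsqr (Rabs a + Rabs b)) by lra.
  apply sqrt_le_1_alt; unfold Rsqr.
  rewrite <- (pow2_abs a), <- (pow2_abs b); nra.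
Qed.

Lemma Cmod_imag (r : R) : Cmod (Ci * RtoC r) = Rabs r.
Proof. rewrite Cmod_mult, Cmod_Ci, Cmod_R; ring. Qed.

Lemma Cmod_sqr (z : C) : (Cmod z)^2 = (Re z)^2 + (Im z)^2.
Proof. unfold Cmod, Re, Im; rewrite pow2_sqrt; [reflexivity|nra]. Qed.

Lemma lt_Rmin (x a b : R) : x < Rmin a b -> x < a /\ x < b.
Proof. pose proof (Rmin_l a b); pose proof (Rmin_r a b); lra. Qed.

Lemma le_Rmin (x a b : R) : x <= Rmin a b -> x <= a /\ x <= b.
Proof. pose proof (Rmin_l a b); pose proof (Rmin_r a b); lra. Qed.

Lemma Cmod_minus_diag (z : C) : Cmod (z - z) = 0.
Proof. replace (z - z)%C with (RtoC 0) by ring; apply Cmod_0. Qed.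

Lemma le_of_forall_eps (a : R) : (forall k, 0 < k -> a <= k) -> a <= 0.
Proof. intros H; destruct (Rle_dec a 0); auto; specialize (H (a/2)); lra. Qed.

(** * Real induction and compactness of rectangles *)

Lemma real_induction (P : R -> Prop) (a b : R) :
  a <= b -> P a ->
  (forall t, a <= t < b -> (forall s, a <= s <= t -> P s) ->
     exists d, 0 < d /\ forall s, t < s < t + d -> s <= b -> P s) ->
  (forall t, a < t <= b -> (forall s, a <= s < t -> P s) -> P t) ->
  forall t, a <= t <= b -> P t.
Proof.
  intros Hab Pa Hop Hcl.
  set (E := fun t => a <= t <= b /\ forall s, a <= s <= t -> P s).
  assert (Ea : E a).
  { split; [lra|]; intros s Hs; replace s with a by lra; auto. }
  destruct (completeness E) as [m [Hm1 Hm2]].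
  { exists b; intros t [Ht _]; lra. }
  { exists a; auto. }
  assert (Ham : a <= m) by (apply Hm1; auto).
  assert (Hmb : m <= b) by (apply Hm2; intros t [Ht _]; lra).
  assert (Hlt : forall s, a <= s < m -> P s).
  { intros s Hs; apply NNPP; intros Hn.
    assert (m <= s); [|lra].
    apply Hm2; intros t [Ht1 Ht2]; destruct (Rle_dec t s); auto.
    exfalso; apply Hn, Ht2; lra. }
  assert (HPm : P m).
  { destruct (Req_dec a m) as [<-|]; auto; apply Hcl; auto; lra. }
  assert (Hle : forall s, a <= s <= m -> P s).
  { intros s Hs; destruct (Req_dec s m) as [->|]; auto; apply Hlt; lra. }
  destruct (Req_dec m b) as [<-|Hne]; auto.
  destruct (Hop m) as [d [Hd1 Hd2]]; auto; [lra|].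
  set (t' := Rmin b (m + d/2)).
  assert (Ht' : m < t' <= b /\ t' < m + d).
  { unfold t', Rmin; destruct (Rle_dec b (m + d/2)); lra. }
  assert (t' <= m); [|lra].
  apply Hm1; split; [lra|]; intros s Hs.
  destruct (Rle_dec s m); [apply Hle; lra|apply Hd2; lra].
Qed.

(** Crossing times and periods are real numbers, but they keep a minimal distance from each other,
    so a descent by steps of at least [d] terminates. *)
Lemma gap_induction (P : R -> Prop) (d : R) : 0 < d ->
  (forall t, 0 < t -> (forall s, 0 < s <= t - d -> P s) -> P t) -> forall t, 0 < t -> P t.
Proof.
  intros Hd Hstep t Ht.
  assert (Hind : forall n t, 0 < t < INR n * d -> P t).
  { induction n as [|n IH]; intros u Hu; [simpl in Hu; lra|].
    rewrite S_INR in Hu; apply Hstep; [lra|]; intros s Hs; apply IH; lra. }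
  destruct (INR_unbounded (t / d)) as [n Hn]; apply Rlt_div_l in Hn; [|lra].
  apply (Hind n); lra.
Qed.

(* A two-dimensional Cousin lemma: repeated bisection of both sides. *)
Lemma quadrisection (P : R -> R -> R -> R -> Prop) :
  (forall a b c d, a <= b -> c <= d ->
     P a ((a+b)/2) c ((c+d)/2) -> P ((a+b)/2) b c ((c+d)/2) ->
     P a ((a+b)/2) ((c+d)/2) d -> P ((a+b)/2) b ((c+d)/2) d -> P a b c d) ->
  forall a0 b0 c0 d0, a0 <= b0 -> c0 <= d0 ->
  (forall x y, a0 <= x <= b0 -> c0 <= y <= d0 -> exists e, 0 < e /\
     forall a b c d, a0 <= a <= x -> x <= b <= b0 -> c0 <= c <= y -> y <= d <= d0 ->
       b - a < e -> d - c < e -> P a b c d) ->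
  P a0 b0 c0 d0.
Proof.
  intros Hsub a0 b0 c0 d0 Hab Hcd Hloc.
  apply NNPP; intros Hn.
  set (bad := fun r : (R * R) * (R * R) =>
     fst (fst r) <= snd (fst r) /\ fst (snd r) <= snd (snd r) /\
     ~ P (fst (fst r)) (snd (fst r)) (fst (snd r)) (snd (snd r))).
  set (half := fun r r' : (R * R) * (R * R) =>
     fst (fst r) <= fst (fst r') /\ snd (fst r') <= snd (fst r) /\
     fst (snd r) <= fst (snd r') /\ snd (snd r') <= snd (snd r) /\
     snd (fst r') - fst (fst r') = (snd (fst r) - fst (fst r)) / 2 /\
     snd (snd r') - fst (snd r') = (snd (snd r) - fst (snd r)) / 2).
  assert (Hstep : forall r, exists r', bad r -> bad r' /\ half r r').
  { intros r; destruct (classic (bad r)) as [Hb|Hb]; [|exists r; tauto].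
    destruct r as [[a b] [c d]]; unfold bad, half in *; simpl in *.
    destruct Hb as (h1 & h2 & h3).
    apply NNPP; intros Hno.
    assert (Hall : forall a' b' c' d', a <= a' <= b' -> b' <= b -> c <= c' <= d' -> d' <= d ->
       b' - a' = (b - a)/2 -> d' - c' = (d - c)/2 -> P a' b' c' d').
    { intros a' b' c' d' k1 k2 k3 k4 k5 k6; apply NNPP; intros HP.
      apply Hno; exists ((a', b'), (c', d')); simpl; intros _; repeat split; auto; lra. }
    apply h3, Hsub; auto; apply Hall; lra. }
  set (next := fun r => epsilon (inhabits r) (fun r' => bad r -> bad r' /\ half r r')).
  assert (Hnext : forall r, bad r -> bad (next r) /\ half r (next r)).
  { intros r; apply (epsilon_spec (inhabits r) (fun r' => bad r -> bad r' /\ half r r')), Hstep. }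
  (* Bad rectangles are nested by halving; their lower left corners increase to a point common to
     all of them, where [Hloc] applies. *)
  set (u := fix u (n : nat) := match n with O => ((a0, b0), (c0, d0)) | S n => next (u n) end).
  assert (Hbad : forall n, bad (u n)).
  { induction n; [unfold bad; simpl; auto|]; simpl; apply Hnext; auto. }
  assert (Hhalf : forall n, half (u n) (u (S n))).
  { intros n; simpl; apply Hnext; auto. }
  assert (Hmono : forall n k,
     fst (fst (u n)) <= fst (fst (u (n + k)%nat)) /\ snd (fst (u (n + k)%nat)) <= snd (fst (u n)) /\
     fst (snd (u n)) <= fst (snd (u (n + k)%nat)) /\ snd (snd (u (n + k)%nat)) <= snd (snd (u n))).
  { intros n; induction k; [rewrite Nat.add_0_r; lra|].
    rewrite Nat.add_succ_r; pose proof (Hhalf (n + k)%nat) as (k1 & k2 & k3 & k4 & _); lra. }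
  assert (Hlr : forall n k, fst (fst (u n)) <= snd (fst (u k)) /\ fst (snd (u n)) <= snd (snd (u k))).
  { intros n k.
    pose proof (Hmono n k) as (k1 & _ & k2 & _); pose proof (Hmono k n) as (_ & k3 & _ & k4).
    rewrite Nat.add_comm in k3, k4; destruct (Hbad (n + k)%nat) as (k5 & k6 & _); lra. }
  assert (Hlen : forall n, snd (fst (u n)) - fst (fst (u n)) = (b0 - a0) * (/2)^n /\
                           snd (snd (u n)) - fst (snd (u n)) = (d0 - c0) * (/2)^n).
  { induction n; [simpl; lra|].
    pose proof (Hhalf n) as (_ & _ & _ & _ & k1 & k2); rewrite <- tech_pow_Rmult; lra. }
  destruct (completeness (fun t => exists n, t = fst (fst (u n)))) as [x [Hx1 Hx2]].
  { exists b0; intros t [n ->]; apply (Hlr n O). }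
  { exists a0; exists O; reflexivity. }
  destruct (completeness (fun t => exists n, t = fst (snd (u n)))) as [y [Hy1 Hy2]].
  { exists d0; intros t [n ->]; apply (Hlr n O). }
  { exists c0; exists O; reflexivity. }
  assert (Hx : forall n, fst (fst (u n)) <= x <= snd (fst (u n))).
  { intros n; split; [apply Hx1; exists n; auto|apply Hx2; intros t [k ->]; apply Hlr]. }
  assert (Hy : forall n, fst (snd (u n)) <= y <= snd (snd (u n))).
  { intros n; split; [apply Hy1; exists n; auto|apply Hy2; intros t [k ->]; apply Hlr]. }
  destruct (Hloc x y (Hx O) (Hy O)) as [e [He1 He2]].
  (* The denominator exceeds both side lengths, so both sides of the n-th rectangle are below [e];
     the 1 covers degenerate rectangles. *)
  destruct (pow_lt_1_zero (/2)) with (y := e / (1 + (b0 - a0) + (d0 - c0))) as [n Hn'].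
  { rewrite Rabs_pos_eq; lra. }
  { apply Rdiv_lt_0_compat; lra. }
  specialize (Hn' n (Nat.le_refl n)).
  assert (Hp : 0 < (/2)^n) by (apply pow_lt; lra).
  rewrite Rabs_pos_eq in Hn' by lra.
  apply Rlt_div_r in Hn'; [|lra].
  destruct (Hlen n) as [l1 l2]; destruct (Hmono O n) as (m1 & m2 & m3 & m4).
  change (0 + n)%nat with n in *; simpl (u O) in *; simpl in m1, m2, m3, m4.
  pose proof (Hx n); pose proof (Hy n).
  destruct (Hbad n) as (_ & _ & Hb); apply Hb, He2; try lra; nra.
Qed.

Definition inrect (a b c d : R) (z : C) : Prop := a <= Re z <= b /\ c <= Im z <= d.

(** Monotonicity in [e] lets the four thresholds of a subdivision combine into their minimum. In
    [newton_solve] the threshold is a lower bound of a modulus, in [escape] a margin of time. *)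
Lemma rectangle_compactness (A : R -> C -> Prop) (a0 b0 c0 d0 : R) : a0 <= b0 -> c0 <= d0 ->
  (forall e e' z, 0 < e' <= e -> A e z -> A e' z) ->
  (forall q, inrect a0 b0 c0 d0 q -> exists e d, 0 < e /\ 0 < d /\
     forall z, Cmod (z - q) < d -> A e z) ->
  exists e, 0 < e /\ forall z, inrect a0 b0 c0 d0 z -> A e z.
Proof.
  intros Hab Hcd Hmono Hloc.
  apply (quadrisection (fun a b c d => exists e, 0 < e /\ forall z, inrect a b c d z -> A e z)); auto.
  - intros a b c d _ _ [k1 [K1 Q1]] [k2 [K2 Q2]] [k3 [K3 Q3]] [k4 [K4 Q4]].
    set (k := Rmin (Rmin k1 k2) (Rmin k3 k4)).
    assert (Hk : 0 < k) by (repeat apply Rmin_pos; auto).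
    destruct (le_Rmin k _ _ (Rle_refl k)) as [k12 k34].
    apply le_Rmin in k12; apply le_Rmin in k34.
    exists k; split; auto; intros v [V1 V2].
    destruct (Rle_dec (Re v) ((a + b)/2)); destruct (Rle_dec (Im v) ((c + d)/2)).
    + apply (Hmono k1); [lra|apply Q1; split; lra].
    + apply (Hmono k3); [lra|apply Q3; split; lra].
    + apply (Hmono k2); [lra|apply Q2; split; lra].
    + apply (Hmono k4); [lra|apply Q4; split; lra].
  - intros x y Hx Hy.
    destruct (Hloc (RtoC x + Ci * RtoC y)%C) as (e & d & He & Hd & H).
    { unfold inrect, Re, Im; simpl; lra. }
    exists (d / 2); split; [lra|]; intros a b c d' A1 A2 A3 A4 A5 A6.
    exists e; split; auto; intros z [V1 V2]; apply H.
    eapply Rle_lt_trans; [apply Cmod_le_Re_Im|].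
    replace (Re (z - (RtoC x + Ci * RtoC y))) with (Re z - x) by (unfold Re; simpl; ring).
    replace (Im (z - (RtoC x + Ci * RtoC y))) with (Im z - y) by (unfold Im; simpl; ring).
    assert (Rabs (Re z - x) < d / 2 /\ Rabs (Im z - y) < d / 2)
      by (split; apply Rabs_def1; lra); lra.
Qed.

Lemma inrect_Cmod (B : R) (z q : C) : Cmod (z - q) <= B ->
  inrect (Re q - B) (Re q + B) (Im q - B) (Im q + B) z.
Proof.
  intros H.
  pose proof (Rle_trans _ _ _ (Rabs_Re_le (z - q)) H) as b1.
  pose proof (Rle_trans _ _ _ (Rabs_Im_le (z - q)) H) as b2.
  apply Rabs_le_between in b1; apply Rabs_le_between in b2.
  change (Re (z - q)) with (Re z - Re q) in b1; change (Im (z - q)) with (Im z - Im q) in b2.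
  split; lra.
Qed.

Lemma Cmod_inrect (B : R) (z q : C) :
  inrect (Re q - B) (Re q + B) (Im q - B) (Im q + B) z -> Cmod (z - q) <= 2 * B.
Proof.
  intros [h1 h2]; eapply Rle_trans; [apply Cmod_le_Re_Im|].
  change (Re (z - q)) with (Re z - Re q); change (Im (z - q)) with (Im z - Im q).
  assert (Rabs (Re z - Re q) <= B /\ Rabs (Im z - Im q) <= B) by (split; apply Rabs_le; lra); lra.
Qed.

(** * Derivatives and integrals in explicit epsilon-delta form *)

Definition cder (f : R -> C) (t : R) (l : C) : Prop :=
  forall k, 0 < k -> exists d, 0 < d /\ forall s, Rabs (s - t) < d ->
    Cmod (f s - f t - RtoC (s - t) * l) <= k * Rabs (s - t).

(** Strict differentiability: both points vary. The jump estimate compares two points near [a],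
    neither of which is [a], and the strict form also passes to the inverse function. *)
Definition sder (f : C -> C) (a : C) (l : C) : Prop :=
  forall k, 0 < k -> exists d, 0 < d /\ forall z w, Cmod (z - a) < d -> Cmod (w - a) < d ->
    Cmod (f w - f z - l * (w - z)) <= k * Cmod (w - z).

Definition ccont (f : C -> C) (a : C) : Prop :=
  forall k, 0 < k -> exists d, 0 < d /\ forall z, Cmod (z - a) < d -> Cmod (f z - f a) < k.

Definition rcont (f : R -> C) (a : R) : Prop :=
  forall k, 0 < k -> exists d, 0 < d /\ forall z, Rabs (z - a) < d -> Cmod (f z - f a) < k.

Lemma C_R_norm (z : C) : norm (V := C_R_NormedModule) z = Cmod z.
Proof.
  destruct z as [a b].
  change (sqrt (Rabs a ^ 2 + Rabs b ^ 2) = sqrt (a ^ 2 + b ^ 2)).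
  rewrite !pow2_abs; reflexivity.
Qed.

Lemma is_derive_cder (f : R -> C) (t : R) (l : C) :
  is_derive (K := R_AbsRing) (V := C_R_NormedModule) f t l <-> cder f t l.
Proof.
  split.
  - intros [_ H] k Hk.
    specialize (H t (fun P H => H) (mkposreal k Hk)).
    destruct H as [d H]; exists d; split; [apply cond_pos|]; intros s Hs.
    specialize (H s Hs); rewrite C_R_norm in H; simpl in H.
    eapply Rle_trans; [|exact H]; apply Req_le; f_equal.
    apply injective_projections; unfold minus, plus, opp, scal; simpl;
      unfold minus, plus, opp, scal, mult; simpl; unfold mult; simpl; ring.
  - intros H; split; [apply is_linear_scal_l|].
    intros y Hy e.
    apply (is_filter_lim_locally_unique (K := R_AbsRing) (V := R_NormedModule)) in Hy; subst y.
    destruct (H e (cond_pos e)) as [d [Hd H']].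
    exists (mkposreal d Hd); intros s Hs; specialize (H' s Hs).
    rewrite C_R_norm; eapply Rle_trans; [|exact H']; apply Req_le; f_equal.
    apply injective_projections; unfold minus, plus, opp, scal; simpl;
      unfold minus, plus, opp, scal, mult; simpl; unfold mult; simpl; ring.
Qed.

Definition CI (f : R -> C) (a b : R) : C := RInt (V := C_R_CompleteNormedModule) f a b.

Definition rcont_on (f : R -> C) (a b : R) : Prop :=
  forall t, Rmin a b <= t <= Rmax a b -> rcont f t.

Lemma rcont_continuous (f : R -> C) (t : R) :
  rcont f t -> continuous (U := C_R_NormedModule) f t.
Proof.
  intros H; apply filterlim_locally; intros e.
  destruct (H (e / 1) ltac:(rewrite Rdiv_1_r; apply cond_pos)) as [d [Hd H']].
  exists (mkposreal d Hd); intros s Hs; specialize (H' s Hs); rewrite Rdiv_1_r in H'.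
  apply (norm_compat1 (V := C_R_NormedModule)).
  rewrite C_R_norm; exact H'.
Qed.

Lemma rcont_on_ex_RInt (f : R -> C) (a b : R) :
  rcont_on f a b -> ex_RInt (V := C_R_CompleteNormedModule) f a b.
Proof.
  intros H; apply (ex_RInt_continuous (V := C_R_CompleteNormedModule)).
  intros t Ht; apply rcont_continuous, H, Ht.
Qed.

Lemma rcont_on_swap (f : R -> C) (a b : R) : rcont_on f a b -> rcont_on f b a.
Proof. unfold rcont_on; rewrite Rmin_comm, Rmax_comm; auto. Qed.

Lemma rcont_on_sub (f : R -> C) (a b c d : R) :
  rcont_on f a b -> Rmin a b <= c <= Rmax a b -> Rmin a b <= d <= Rmax a b ->
  rcont_on f c d.
Proof.
  intros H Hc Hd t Ht; apply H; split.
  - eapply Rle_trans; [|apply Ht]; apply Rmin_glb; tauto.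
  - eapply Rle_trans; [apply Ht|]; apply Rmax_lub; tauto.
Qed.

Lemma CI_swap (f : R -> C) (a b : R) : rcont_on f a b -> CI f b a = (- CI f a b)%C.
Proof.
  intros H; symmetry.
  apply (opp_RInt_swap (V := C_R_CompleteNormedModule)), rcont_on_ex_RInt, H.
Qed.

Lemma CI_Chasles (f : R -> C) (a b c : R) :
  rcont_on f a b -> rcont_on f b c -> (CI f a b + CI f b c)%C = CI f a c.
Proof.
  intros H1 H2.
  apply (RInt_Chasles (V := C_R_CompleteNormedModule)); apply rcont_on_ex_RInt; auto.
Qed.

Lemma CI_minus (f g : R -> C) (a b : R) : rcont_on f a b -> rcont_on g a b ->
  CI (fun t => f t - g t)%C a b = (CI f a b - CI g a b)%C.
Proof.
  intros H1 H2.
  apply (RInt_minus (V := C_R_CompleteNormedModule)); apply rcont_on_ex_RInt; auto.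
Qed.

Lemma CI_const (c : C) (a b : R) : CI (fun _ => c) a b = (RtoC (b - a) * c)%C.
Proof.
  unfold CI; rewrite (RInt_const (V := C_R_CompleteNormedModule)).
  apply (scal_R_Cmult (b - a) c).
Qed.

Lemma CI_bound_le (f : R -> C) (a b M : R) : a <= b -> rcont_on f a b ->
  (forall t, a <= t <= b -> Cmod (f t) <= M) -> Cmod (CI f a b) <= M * (b - a).
Proof.
  intros Hab Hc HM; rewrite <- C_R_norm, Rmult_comm.
  apply (norm_RInt_le_const (V := C_R_CompleteNormedModule) f a b); auto.
  - intros t Ht; rewrite C_R_norm; auto.
  - apply (RInt_correct (V := C_R_CompleteNormedModule)), rcont_on_ex_RInt, Hc.
Qed.

Lemma CI_bound (f : R -> C) (a b M : R) : rcont_on f a b ->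
  (forall t, Rmin a b <= t <= Rmax a b -> Cmod (f t) <= M) ->
  Cmod (CI f a b) <= M * Rabs (b - a).
Proof.
  intros Hc HM; destruct (Rle_dec a b) as [h|h].
  - rewrite Rabs_pos_eq by lra; apply CI_bound_le; auto.
    rewrite Rmin_left, Rmax_right in HM; auto.
  - rewrite CI_swap by (apply rcont_on_swap; auto).
    rewrite Cmod_opp, Rabs_minus_sym, Rabs_pos_eq by lra; apply CI_bound_le; [lra| |].
    + apply rcont_on_swap; auto.
    + rewrite Rmin_right, Rmax_left in HM by lra; auto.
Qed.

Lemma CI_primitive (f g : R -> C) (a b : R) : rcont_on g a b ->
  (forall t, Rmin a b <= t <= Rmax a b -> cder f t (g t)) ->
  CI g a b = (f b - f a)%C.
Proof.
  intros Hc Hd.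
  apply (is_RInt_unique (V := C_R_CompleteNormedModule)).
  apply (is_RInt_derive (V := C_R_CompleteNormedModule) f g).
  - intros t Ht; apply is_derive_cder; auto.
  - intros t Ht; apply rcont_continuous; auto.
Qed.

Lemma CI_Im_ge (f : R -> C) (a b m : R) : a <= b -> rcont_on f a b ->
  (forall t, a <= t <= b -> m <= Im (f t)) -> m * (b - a) <= Im (CI f a b).
Proof.
  intros Hab Hc Hm.
  pose proof (RInt_correct (V := C_R_CompleteNormedModule) f a b (rcont_on_ex_RInt f a b Hc)) as H.
  pose proof (is_RInt_fct_extend_snd (U := R_NormedModule) (V := R_NormedModule) f a b _ H) as H2.
  pose proof (is_RInt_const (V := R_NormedModule) a b m) as H3.
  replace (m * (b - a)) with (scal (V := R_NormedModule) (b - a) m)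
    by (unfold scal; simpl; unfold mult; simpl; ring).
  exact (is_RInt_le _ _ _ _ _ _ Hab H3 H2 (fun t Ht => Hm t (conj (Rlt_le _ _ (proj1 Ht)) (Rlt_le _ _ (proj2 Ht))))).
Qed.

Lemma rcont_const (c : C) (t : R) : rcont (fun _ => c) t.
Proof.
  intros k Hk; exists 1; split; [lra|]; intros s _.
  rewrite Cmod_minus_diag; auto.
Qed.

(* Common form of derivatives in R and in C: q is the distance to the base
   point and p the linear part of the increment. *)
Definition first_order {T : Type} (q : T -> R) (u p : T -> C) : Prop :=
  forall k, 0 < k -> exists d, 0 < d /\ forall s, q s < d -> Cmod (u s - p s) <= k * q s.

Lemma first_order_Lipschitz {T : Type} (q : T -> R) (u p : T -> C) (m : R) :
  first_order q u p -> (forall s, Cmod (p s) <= m * q s) ->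
  exists d, 0 < d /\ forall s, q s < d -> Cmod (u s) <= (m + 1) * q s.
Proof.
  intros H Hm; destruct (H 1 Rlt_0_1) as [d [Hd H']]; exists d; split; auto.
  intros s Hs; specialize (H' s Hs); specialize (Hm s).
  pose proof (Cmod_triangle_inv (u s) (p s)); lra.
Qed.

(** The error is that of [g] at [f s] plus [l] times that of [f]; each receives half of [k]. Near
    the base point [f] has Lipschitz constant m + 1, and the added ones keep the divisors
    positive. *)
Lemma first_order_chain {T : Type} (q : T -> R) (f p : T -> C) (g : C -> C) (z l : C) (m : R) :
  (forall s, 0 <= q s) -> 0 <= m ->
  first_order q (fun s => f s - z)%C p -> (forall s, Cmod (p s) <= m * q s) -> sder g z l ->
  first_order q (fun s => g (f s) - g z)%C (fun s => l * p s)%C.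
Proof.
  intros Hq Hm0 Hf Hm Hg k Hk; pose proof (Cmod_ge_0 l).
  destruct (Hg (k / (2 * (m + 1)))) as [d1 [Hd1 H1]]; [apply Rdiv_lt_0_compat; lra|].
  destruct (first_order_Lipschitz _ _ _ m Hf Hm) as [d2 [Hd2 H2]].
  destruct (Hf (k / (2 * (Cmod l + 1)))) as [d3 [Hd3 H3]]; [apply Rdiv_lt_0_compat; lra|].
  exists (Rmin (Rmin d2 d3) (d1 / (m + 1))); split.
  { apply Rmin_pos; [apply Rmin_pos; auto|apply Rdiv_lt_0_compat; lra]. }
  intros s Hs; destruct (lt_Rmin _ _ _ Hs) as [s12 s3].
  destruct (lt_Rmin _ _ _ s12) as [s1 s2]; apply Rlt_div_r in s3; [|lra].
  specialize (H2 s s1); specialize (H3 s s2); specialize (Hq s).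
  specialize (H1 z (f s) ltac:(rewrite Cmod_minus_diag; auto) ltac:(lra)).
  replace (g (f s) - g z - l * p s)%C
    with ((g (f s) - g z - l * (f s - z)) + l * (f s - z - p s))%C by ring.
  eapply Rle_trans; [apply Cmod_triangle|]; rewrite Cmod_mult.
  assert (B1 : k / (2 * (m + 1)) * Cmod (f s - z) <= k / 2 * q s).
  { apply Rle_trans with (k / (2 * (m + 1)) * ((m + 1) * q s)).
    - apply Rmult_le_compat_l; auto; apply Rlt_le, Rdiv_lt_0_compat; lra.
    - apply Req_le; field; lra. }
  assert (B2 : Cmod l * Cmod (f s - z - p s) <= k / 2 * q s).
  { apply Rle_trans with ((Cmod l + 1) * (k / (2 * (Cmod l + 1)) * q s)).
    - apply Rmult_le_compat; auto; try lra; apply Cmod_ge_0.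
    - apply Req_le; field; lra. }
  lra.
Qed.

Lemma cder_exact (f : R -> C) (t : R) (l : C) :
  (forall s, f s = f t + RtoC (s - t) * l)%C -> cder f t l.
Proof.
  intros E k Hk; exists 1; split; [lra|]; intros s _; rewrite (E s).
  replace (f t + RtoC (s - t) * l - f t - RtoC (s - t) * l)%C with (RtoC 0) by ring.
  rewrite Cmod_0; pose proof (Rabs_pos (s - t)); nra.
Qed.

Lemma cder_const (c : C) (t : R) : cder (fun _ => c) t 0.
Proof. apply cder_exact; intros; ring. Qed.

Lemma cder_affine (p e : C) (t : R) : cder (fun t => p + RtoC t * e)%C t e.
Proof. apply cder_exact; intros; rewrite RtoC_minus; ring. Qed.

Lemma cder_RtoC (c t : R) : cder (fun s => RtoC (s - c)) t 1.
Proof. apply cder_exact; intros; rewrite !RtoC_minus; ring. Qed.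

Lemma cder_Lipschitz (f : R -> C) (t : R) (l : C) : cder f t l ->
  exists d, 0 < d /\ forall s, Rabs (s - t) < d ->
    Cmod (f s - f t) <= (Cmod l + 1) * Rabs (s - t).
Proof.
  intros H; apply (first_order_Lipschitz _ _ _ (Cmod l) H); intros s.
  rewrite Cmod_mult, Cmod_R; lra.
Qed.

Lemma sder_cder (g : C -> C) (phi : R -> C) (t : R) (l m : C) :
  sder g (phi t) l -> cder phi t m -> cder (fun s => g (phi s)) t (l * m)%C.
Proof.
  intros Hg Hphi.
  assert (H : first_order (fun s => Rabs (s - t)) (fun s => g (phi s) - g (phi t))%C
    (fun s => l * (RtoC (s - t) * m))%C).
  { apply (first_order_chain _ _ _ _ _ _ (Cmod m)); auto using Rabs_pos, Cmod_ge_0.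
    intros s; rewrite Cmod_mult, Cmod_R; lra. }
  intros k Hk; destruct (H k Hk) as [d [Hd H']]; exists d; split; auto; intros s Hs.
  replace (RtoC (s - t) * (l * m))%C with (l * (RtoC (s - t) * m))%C by ring; auto.
Qed.

Lemma cder_rcont (f : R -> C) (t : R) (l : C) : cder f t l -> rcont f t.
Proof.
  intros H k Hk; destruct (cder_Lipschitz f t l H) as [d [Hd H']].
  pose proof (Cmod_ge_0 l).
  exists (Rmin d (k / (Cmod l + 1))); split.
  - apply Rmin_pos; auto; apply Rdiv_lt_0_compat; lra.
  - intros s Hs.
    destruct (lt_Rmin _ _ _ Hs) as [Hs1 Hs2].
    apply Rlt_div_r in Hs2; [|lra].
    specialize (H' s Hs1); lra.
Qed.

Lemma rcont_comp (g : C -> C) (f : R -> C) (t : R) :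
  ccont g (f t) -> rcont f t -> rcont (fun s => g (f s)) t.
Proof.
  intros Hg Hf k Hk; destruct (Hg k Hk) as [d [Hd H]]; destruct (Hf d Hd) as [e [He H']].
  exists e; split; auto.
Qed.

Lemma rcont_minus (f g : R -> C) (t : R) :
  rcont f t -> rcont g t -> rcont (fun s => f s - g s)%C t.
Proof.
  intros Hf Hg k Hk.
  destruct (Hf (k/2)) as [d [Hd H1]]; [lra|]; destruct (Hg (k/2)) as [e [He H2]]; [lra|].
  exists (Rmin d e); split; [apply Rmin_pos; auto|]; intros s Hs.
  replace (f s - g s - (f t - g t))%C with ((f s - f t) - (g s - g t))%C by ring.
  pose proof (Cmod_triangle (f s - f t) (- (g s - g t))) as T; rewrite Cmod_opp in T.
  destruct (lt_Rmin _ _ _ Hs) as [s1 s2]; specialize (H1 s s1); specialize (H2 s s2).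
  unfold Cminus in *; lra.
Qed.

Lemma ccont_minus (f g : C -> C) (a : C) :
  ccont f a -> ccont g a -> ccont (fun s => f s - g s)%C a.
Proof.
  intros Hf Hg k Hk.
  destruct (Hf (k/2)) as [d [Hd H1]]; [lra|]; destruct (Hg (k/2)) as [e [He H2]]; [lra|].
  exists (Rmin d e); split; [apply Rmin_pos; auto|]; intros s Hs.
  destruct (lt_Rmin _ _ _ Hs) as [s1 s2]; specialize (H1 s s1); specialize (H2 s s2).
  replace (f s - g s - (f a - g a))%C with ((f s - f a) + - (g s - g a))%C by ring.
  eapply Rle_lt_trans; [apply Cmod_triangle|]; rewrite Cmod_opp; lra.
Qed.

Lemma rcont_mult (f g : R -> C) (t : R) :
  rcont f t -> rcont g t -> rcont (fun s => f s * g s)%C t.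
Proof.
  intros Hf Hg k Hk.
  pose proof (Cmod_ge_0 (f t)); pose proof (Cmod_ge_0 (g t)).
  set (A := Cmod (f t) + Cmod (g t) + 1).
  set (e := Rmin 1 (k / (2 * A))).
  assert (HA : 1 <= A) by (unfold A; lra).
  assert (He : 0 < e) by (apply Rmin_pos; [lra|apply Rdiv_lt_0_compat; lra]).
  assert (He1 : e <= 1) by apply Rmin_l.
  assert (He2 : e * A <= k / 2).
  { apply Rle_trans with (k / (2 * A) * A); [apply Rmult_le_compat_r; [lra|apply Rmin_r]|].
    apply Req_le; field; lra. }
  destruct (Hf e He) as [d1 [Hd1 H1]]; destruct (Hg e He) as [d2 [Hd2 H2]].
  exists (Rmin d1 d2); split; [apply Rmin_pos; auto|]; intros s Hs.
  destruct (lt_Rmin _ _ _ Hs) as [s1 s2]; specialize (H1 s s1); specialize (H2 s s2).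
  replace (f s * g s - f t * g t)%C
    with ((f s - f t) * (g s - g t) + ((f s - f t) * g t + f t * (g s - g t)))%C by ring.
  eapply Rle_lt_trans; [apply Cmod_triangle|].
  pose proof (Cmod_triangle ((f s - f t) * g t) (f t * (g s - g t))) as T.
  rewrite !Cmod_mult in *.
  set (p := Cmod (f s - f t)) in *; set (q := Cmod (g s - g t)) in *.
  assert (0 <= p) by apply Cmod_ge_0; assert (0 <= q) by apply Cmod_ge_0.
  clearbody e p q; unfold A in *; clear A.
  assert (p * q <= e * 1) by (apply Rmult_le_compat; lra).
  assert (p * Cmod (g t) <= e * Cmod (g t)) by (apply Rmult_le_compat_r; lra).
  assert (Cmod (f t) * q <= Cmod (f t) * e) by (apply Rmult_le_compat_l; lra).
  lra.
Qed.

Lemma ccont_inv (a : C) : a <> 0 -> ccont Cinv a.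
Proof.
  intros Ha k Hk.
  assert (Hm : 0 < Cmod a) by (apply Cmod_gt_0; auto).
  set (m := Cmod a) in *.
  exists (Rmin (m/2) (k * m * m / 2)); split.
  { apply Rmin_pos; [lra|]; assert (0 < k * m * m) by (repeat apply Rmult_lt_0_compat; auto); lra. }
  intros z Hz.
  destruct (lt_Rmin _ _ _ Hz) as [h1 h2].
  assert (h3 : m / 2 < Cmod z).
  { pose proof (Cmod_triangle_inv a z) as T; rewrite Cmod_minus_sym in T; fold m in T; lra. }
  assert (Hz0 : z <> 0) by (apply Cmod_gt_0; lra).
  replace (/ z - / a)%C with ((a - z) / (z * a))%C by (field; auto).
  rewrite Cmod_div by (apply Cmult_neq_0; auto).
  rewrite Cmod_mult, Cmod_minus_sym; fold m.
  assert (Hp : 0 < Cmod z * m) by nra.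
  apply Rlt_div_l; auto.
  assert (0 < k * m) by nra; nra.
Qed.

Lemma rcont_inv (f : R -> C) (t : R) : rcont f t -> f t <> 0 -> rcont (fun s => / f s)%C t.
Proof. intros H1 H2; apply (rcont_comp Cinv f); auto; apply ccont_inv; auto. Qed.

(** The one-point notion, which is what [entire] provides and what Goursat's argument works with;
    strict derivatives of the chart maps come later, from the primitive. *)
Definition cdiff (f : C -> C) (z : C) : Prop := exists l, forall k, 0 < k ->
  exists d, 0 < d /\ forall w, Cmod (w - z) < d -> Cmod (f w - f z - l * (w - z)) <= k * Cmod (w - z).

Lemma cdiff_affine (a l q z : C) : cdiff (fun w => a + l * (w - q))%C z.
Proof.
  exists l; intros k Hk; exists 1; split; [lra|]; intros w _.
  match goal with |- Cmod ?x <= _ => replace x with (RtoC 0) by ring end.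
  rewrite Cmod_0; pose proof (Cmod_ge_0 (w - z)); nra.
Qed.

Lemma cdiff_Lipschitz (f : C -> C) (z : C) : cdiff f z -> exists K d, 0 < d /\ 0 < K /\
  forall w, Cmod (w - z) < d -> Cmod (f w - f z) <= K * Cmod (w - z).
Proof.
  intros [l H]; pose proof (Cmod_ge_0 l).
  destruct (first_order_Lipschitz (fun w => Cmod (w - z)) _ _ (Cmod l) H) as [d [Hd H']].
  { intros w; rewrite Cmod_mult; lra. }
  exists (Cmod l + 1), d; repeat split; auto; lra.
Qed.

Lemma cdiff_ccont (f : C -> C) (z : C) : cdiff f z -> ccont f z.
Proof.
  intros H k Hk; destruct (cdiff_Lipschitz f z H) as [K [d [Hd [HK H']]]].
  exists (Rmin d (k / K)); split; [apply Rmin_pos; auto; apply Rdiv_lt_0_compat; auto|].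
  intros w Hw; destruct (lt_Rmin _ _ _ Hw) as [h1 h2].
  apply Rlt_div_r in h2; [|lra]; specialize (H' w h1); lra.
Qed.

Lemma sder_ccont (f : C -> C) (z l : C) : sder f z l -> ccont f z.
Proof.
  intros H; apply cdiff_ccont; exists l; intros k Hk; destruct (H k Hk) as [d [Hd H']].
  exists d; split; auto; intros w Hw; apply H'; auto; rewrite Cmod_minus_diag; auto.
Qed.

Lemma entire_cdiff (F : C -> C) (z : C) : entire F -> cdiff F z.
Proof.
  intros HF; destruct (HF z) as [l [_ H]]; exists l; intros k Hk.
  specialize (H z (fun P H => H) (mkposreal k Hk)).
  destruct (locally_norm_le_locally (V := AbsRing_NormedModule C_AbsRing) z _ H) as [d Hd].
  exists d; split; [apply cond_pos|]; intros w Hw; specialize (Hd w Hw).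
  eapply Rle_trans; [|exact Hd]; apply Req_le.
  rewrite (Cmult_comm l); reflexivity.
Qed.

Lemma entire_ccont (F : C -> C) (z : C) : entire F -> ccont F z.
Proof. intros; apply cdiff_ccont, entire_cdiff; auto. Qed.

Lemma sder_inv (a : C) : a <> 0 -> sder Cinv a (- / (a * a))%C.
Proof.
  intros Ha k Hk.
  set (m := Cmod (/ a)); assert (Hm : 0 <= m) by apply Cmod_ge_0.
  set (e := Rmin 1 (k / (2 * m + 1))).
  assert (He : 0 < e) by (apply Rmin_pos; [lra|apply Rdiv_lt_0_compat; lra]).
  assert (e1 : e <= 1) by apply Rmin_l.
  assert (e2 : e * (2 * m + 1) <= k).
  { apply Rle_trans with (k / (2 * m + 1) * (2 * m + 1)).
    - apply Rmult_le_compat_r; [lra|apply Rmin_r].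
    - apply Req_le; field; lra. }
  destruct (ccont_inv a Ha e He) as [d [Hd H]].
  assert (Hma : 0 < Cmod a) by (apply Cmod_gt_0; auto).
  exists (Rmin d (Cmod a)); split; [apply Rmin_pos; auto|]; intros z w Hz Hw.
  assert (Hnz : forall u, Cmod (u - a) < Rmin d (Cmod a) -> u <> 0).
  { intros u Hu E; subst u; replace (0 - a)%C with (- a)%C in Hu by ring.
    rewrite Cmod_opp in Hu; pose proof (Rmin_r d (Cmod a)); lra. }
  pose proof (Hnz z Hz); pose proof (Hnz w Hw).
  specialize (H z (Rlt_le_trans _ _ _ Hz (Rmin_l _ _))) as Hz'.
  specialize (H w (Rlt_le_trans _ _ _ Hw (Rmin_l _ _))) as Hw'.
  (* In the factor of w - z each summand contains 1/w - 1/a or 1/z - 1/a, which continuity makes at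
     most e; the total is at most e (2m + e), hence at most k as e <= 1. *)
  replace (/ w - / z - - / (a * a) * (w - z))%C
    with (- ((/ a * (/ w - / a)) + (/ w * (/ z - / a))) * (w - z))%C by (field; auto).
  rewrite Cmod_mult, Cmod_opp; apply Rmult_le_compat_r; [apply Cmod_ge_0|].
  eapply Rle_trans; [apply Cmod_triangle|]; rewrite !Cmod_mult; fold m.
  pose proof (Cmod_triangle_inv (/ w) (/ a)) as Tw; fold m in Tw.
  assert (Hw2 : Cmod (/ w) <= m + e) by lra.
  pose proof (Cmod_ge_0 (/ w)); pose proof (Cmod_ge_0 (/ w - / a)); pose proof (Cmod_ge_0 (/ z - / a)).
  assert (m * Cmod (/ w - / a) <= m * e) by (apply Rmult_le_compat_l; lra).
  assert (Cmod (/ w) * Cmod (/ z - / a) <= (m + e) * e) by (apply Rmult_le_compat; lra).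
  nra.
Qed.

Lemma cdiff_inv (F : C -> C) (z : C) : entire F -> F z <> 0 -> cdiff (fun w => / F w)%C z.
Proof.
  intros HF H0; destruct (entire_cdiff F z HF) as [l H].
  exists (- / (F z * F z) * l)%C; intros k Hk.
  destruct (first_order_chain (fun w => Cmod (w - z)) F (fun w => l * (w - z))%C Cinv (F z)
    (- / (F z * F z)) (Cmod l)) with (k := k) as [d [Hd H']]; auto using Cmod_ge_0, sder_inv.
  { intros w; rewrite Cmod_mult; lra. }
  exists d; split; auto; intros w Hw; rewrite <- Cmult_assoc; auto.
Qed.

(** * Goursat's theorem *)

Definition seg (f : C -> C) (p e : C) (a b : R) : C :=
  CI (fun t => e * f (p + RtoC t * e))%C a b.

(** The contour integral, counterclockwise for a <= b and c <= d. Each side is parametrized by its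
    varying coordinate, so adjacent rectangles share sides literally and these cancel by [ring]. *)
Definition rect (f : C -> C) (a b c d : R) : C :=
  (seg f (Ci * RtoC c) 1 a b + seg f (RtoC b) Ci c d
   - seg f (Ci * RtoC d) 1 a b - seg f (RtoC a) Ci c d)%C.

Lemma rcont_seg (f : C -> C) (p e : C) (t : R) : ccont f (p + RtoC t * e)%C ->
  rcont (fun t => e * f (p + RtoC t * e))%C t.
Proof.
  intros H; apply rcont_mult; [apply rcont_const|].
  apply (rcont_comp f (fun t => (p + RtoC t * e)%C)); auto.
  eapply cder_rcont, cder_affine.
Qed.

Lemma seg_affine (q al l p e : C) (a b : R) :
  seg (fun z => al + l * (z - q))%C p e a b =
  (let A z := al * z + l * ((z - q) * (z - q)) / 2 in
   A (p + RtoC b * e) - A (p + RtoC a * e))%C.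
Proof.
  set (A := fun z => (al * z + l * ((z - q) * (z - q)) / 2)%C).
  change (seg (fun z => al + l * (z - q))%C p e a b = (A (p + RtoC b * e) - A (p + RtoC a * e))%C).
  unfold seg.
  apply (CI_primitive (fun t => A (p + RtoC t * e)%C)).
  - intros t _; apply (rcont_seg (fun z => al + l * (z - q))%C), cdiff_ccont, cdiff_affine.
  - intros t _ k Hk.
    pose proof (Cmod_ge_0 (l * (e * e) / 2)) as Hm; set (m := Cmod (l * (e * e) / 2)) in *.
    exists (k / (m + 1)); split; [apply Rdiv_lt_0_compat; lra|]; intros s Hs.
    match goal with |- Cmod ?x <= _ =>
      replace x with (l * (e * e) / 2 * (RtoC (s - t) * RtoC (s - t)))%C end.
    2: { unfold A; rewrite RtoC_minus; field. }
    rewrite !Cmod_mult, Cmod_R; fold m.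
    apply Rlt_div_r in Hs; [|lra].
    pose proof (Rabs_pos (s - t)); nra.
Qed.

(** Affine functions have quadratic primitives; they are the local models in [Goursat]. *)
Lemma rect_affine (q al l : C) (a b c d : R) :
  rect (fun z => al + l * (z - q))%C a b c d = 0.
Proof.
  unfold rect; rewrite !seg_affine; cbv beta zeta; field.
Qed.

Lemma inrect_pt (a b c d x y : R) :
  a <= x <= b -> c <= y <= d -> inrect a b c d (RtoC x + Ci * RtoC y)%C.
Proof. unfold inrect, Re, Im; simpl; lra. Qed.

Lemma C_Re_Im (z : C) : z = (RtoC (Re z) + Ci * RtoC (Im z))%C.
Proof. apply injective_projections; unfold Re, Im; simpl; ring. Qed.

Lemma inrect_H (a b c d x y : R) :
  a <= x <= b -> c <= y <= d -> inrect a b c d (Ci * RtoC y + RtoC x * 1)%C.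
Proof. unfold inrect, Re, Im; simpl; lra. Qed.

Lemma inrect_V (a b c d x y : R) :
  a <= x <= b -> c <= y <= d -> inrect a b c d (RtoC x + RtoC y * Ci)%C.
Proof. unfold inrect, Re, Im; simpl; lra. Qed.

Lemma Rminmax_between (a b x y t : R) : x <= a <= y -> x <= b <= y ->
  Rmin a b <= t <= Rmax a b -> x <= t <= y.
Proof.
  intros Ha Hb Ht; split.
  - eapply Rle_trans; [|apply Ht]; apply Rmin_glb; lra.
  - eapply Rle_trans; [apply Ht|]; apply Rmax_lub; lra.
Qed.

Section Goursat.
Context (f : C -> C) (a0 b0 c0 d0 : R) (Hf : forall z, inrect a0 b0 c0 d0 z -> cdiff f z).

Lemma rcont_on_H (y a b : R) : c0 <= y <= d0 -> a0 <= a <= b0 -> a0 <= b <= b0 ->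
  rcont_on (fun t => 1 * f (Ci * RtoC y + RtoC t * 1))%C a b.
Proof.
  intros Hy Ha Hb t Ht; apply rcont_seg, cdiff_ccont, Hf, inrect_H; auto.
  eapply Rminmax_between; [| |exact Ht]; auto.
Qed.

Lemma rcont_on_V (x c d : R) : a0 <= x <= b0 -> c0 <= c <= d0 -> c0 <= d <= d0 ->
  rcont_on (fun t => Ci * f (RtoC x + RtoC t * Ci))%C c d.
Proof.
  intros Hy Ha Hb t Ht; apply rcont_seg, cdiff_ccont, Hf, inrect_V; auto.
  eapply Rminmax_between; [| |exact Ht]; auto.
Qed.

Lemma seg_H_Chasles (y a b c : R) : c0 <= y <= d0 ->
  a0 <= a <= b0 -> a0 <= b <= b0 -> a0 <= c <= b0 ->
  seg f (Ci * RtoC y) 1 a c = (seg f (Ci * RtoC y) 1 a b + seg f (Ci * RtoC y) 1 b c)%C.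
Proof. intros; symmetry; apply CI_Chasles; apply rcont_on_H; auto. Qed.

Lemma seg_V_Chasles (x a b c : R) : a0 <= x <= b0 ->
  c0 <= a <= d0 -> c0 <= b <= d0 -> c0 <= c <= d0 ->
  seg f (RtoC x) Ci a c = (seg f (RtoC x) Ci a b + seg f (RtoC x) Ci b c)%C.
Proof. intros; symmetry; apply CI_Chasles; apply rcont_on_V; auto. Qed.

Lemma seg_near (u w : C -> C) (p e : C) (a b M : R) : Cmod e = 1 ->
  rcont_on (fun t => e * u (p + RtoC t * e))%C a b ->
  rcont_on (fun t => e * w (p + RtoC t * e))%C a b ->
  (forall t, Rmin a b <= t <= Rmax a b ->
     Cmod (u (p + RtoC t * e)%C - w (p + RtoC t * e)%C) <= M) ->
  Cmod (seg u p e a b - seg w p e a b) <= M * Rabs (b - a).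
Proof.
  intros He H1 H2 HM; unfold seg; rewrite <- CI_minus by auto.
  apply CI_bound; [intros t Ht; apply rcont_minus; auto|].
  intros t Ht.
  replace (e * u (p + RtoC t * e) - e * w (p + RtoC t * e))%C
    with (e * (u (p + RtoC t * e) - w (p + RtoC t * e)))%C by ring.
  rewrite Cmod_mult, He, Rmult_1_l; auto.
Qed.

(** With S half the perimeter, the bound k S^2 is additive under quadrisection: four quarters give 4
    (S/2)^2. On a small rectangle around q, [f] differs from its affine part by at most k/2 times S,
    and the contour has length 2S, which gives exactly k S^2. *)
Lemma Goursat : a0 <= b0 -> c0 <= d0 -> rect f a0 b0 c0 d0 = 0.
Proof.
  intros Hab Hcd; apply Cmod_eq_0.
  apply Rle_antisym; [|apply Cmod_ge_0].
  apply le_of_forall_eps; intros k' Hk'.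
  set (S0 := (b0 - a0) + (d0 - c0)); assert (HS0 : 0 <= S0) by (unfold S0; lra).
  set (k := k' / (S0 ^ 2 + 1)).
  assert (Hk : 0 < k) by (apply Rdiv_lt_0_compat; nra).
  enough (Cmod (rect f a0 b0 c0 d0) <= k * S0 ^ 2).
  { assert (k * (S0 ^ 2 + 1) = k') by (unfold k; field; nra). nra. }
  revert Hk; generalize k; clear k; intros k Hk; unfold S0.
  (* Containment in the original rectangle becomes part of the predicate, so that [Hf] applies to
     every piece. *)
  enough (HP : a0 <= a0 -> b0 <= b0 -> c0 <= c0 -> d0 <= d0 ->
     Cmod (rect f a0 b0 c0 d0) <= k * (b0 - a0 + (d0 - c0)) ^ 2) by (apply HP; lra).
  apply (quadrisection (fun a b c d => a0 <= a -> b <= b0 -> c0 <= c -> d <= d0 ->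
     Cmod (rect f a b c d) <= k * (b - a + (d - c)) ^ 2)); auto.
  - intros a b c d ab cd P1 P2 P3 P4 h1 h2 h3 h4.
    specialize (P1 ltac:(lra) ltac:(lra) ltac:(lra) ltac:(lra)).
    specialize (P2 ltac:(lra) ltac:(lra) ltac:(lra) ltac:(lra)).
    specialize (P3 ltac:(lra) ltac:(lra) ltac:(lra) ltac:(lra)).
    specialize (P4 ltac:(lra) ltac:(lra) ltac:(lra) ltac:(lra)).
    set (m := (a + b) / 2) in *; set (n := (c + d) / 2) in *.
    assert (Hm : a <= m <= b) by (unfold m; lra).
    assert (Hn : c <= n <= d) by (unfold n; lra).
    replace (rect f a b c d)
      with (rect f a m c n + rect f m b c n + (rect f a m n d + rect f m b n d))%C.
    + pose proof (Cmod_triangle (rect f a m c n + rect f m b c n)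
         (rect f a m n d + rect f m b n d)) as T.
      pose proof (Cmod_triangle (rect f a m c n) (rect f m b c n)) as T1.
      pose proof (Cmod_triangle (rect f a m n d) (rect f m b n d)) as T2.
      assert (Em : m - a = (b - a) / 2 /\ b - m = (b - a) / 2) by (unfold m; lra).
      assert (En : n - c = (d - c) / 2 /\ d - n = (d - c) / 2) by (unfold n; lra).
      destruct Em as [E1 E2]; destruct En as [E3 E4]; rewrite E1, E3 in P1;
        rewrite E2, E3 in P2; rewrite E1, E4 in P3; rewrite E2, E4 in P4; lra.
    + unfold rect.
      rewrite (seg_H_Chasles c a m b), (seg_H_Chasles d a m b) by lra.
      rewrite (seg_V_Chasles a c n d), (seg_V_Chasles b c n d) by lra.
      ring.
  - intros x y Hx Hy.
    set (q := (RtoC x + Ci * RtoC y)%C).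
    assert (Hq : inrect a0 b0 c0 d0 q) by (apply inrect_pt; auto).
    destruct (Hf q Hq) as [l Hl].
    destruct (Hl (k / 2)) as [e [He Hl']]; [lra|].
    exists (e / 2); split; [lra|].
    intros a b c d Ha Hb Hc Hd Hba Hdc h1 h2 h3 h4.
    set (g := fun z => (f q + l * (z - q))%C).
    assert (Hg : forall z, ccont g z) by (intros z; apply cdiff_ccont, cdiff_affine).
    set (M := k / 2 * (b - a + (d - c))).
    assert (Hnear : forall z, inrect a b c d z -> Cmod (f z - g z) <= M).
    { intros z [Hz1 Hz2].
      assert (Hzq : Cmod (z - q) <= b - a + (d - c)).
      { eapply Rle_trans; [apply Cmod_le_Re_Im|].
        replace (Re (z - q)) with (Re z - x) by (unfold q, Re; simpl; ring).
        replace (Im (z - q)) with (Im z - y) by (unfold q, Im; simpl; ring).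
        apply Rplus_le_compat; apply Rabs_le; lra. }
      replace (f z - g z)%C with (f z - f q - l * (z - q))%C by (unfold g; ring).
      eapply Rle_trans; [apply Hl'; lra|].
      unfold M; apply Rmult_le_compat_l; lra. }
    set (dif := fun p e s t => (seg f p e s t - seg g p e s t)%C).
    assert (NH : forall y0, c <= y0 <= d -> Cmod (dif (Ci * RtoC y0)%C 1 a b) <= M * (b - a)).
    { intros y0 Hy0; rewrite <- (Rabs_pos_eq (b - a)) by lra.
      apply seg_near; [apply Cmod_1|apply rcont_on_H; lra|intros t _; apply rcont_seg; auto|].
      rewrite Rmin_left, Rmax_right by lra; intros t Ht; apply Hnear, inrect_H; lra. }
    assert (NV : forall x0, a <= x0 <= b -> Cmod (dif (RtoC x0) Ci c d) <= M * (d - c)).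
    { intros x0 Hx0; rewrite <- (Rabs_pos_eq (d - c)) by lra.
      apply seg_near; [apply Cmod_Ci|apply rcont_on_V; lra|intros t _; apply rcont_seg; auto|].
      rewrite Rmin_left, Rmax_right by lra; intros t Ht; apply Hnear, inrect_V; lra. }
    pose proof (NH c ltac:(lra)) as R1; pose proof (NH d ltac:(lra)) as R2.
    pose proof (NV a ltac:(lra)) as R3; pose proof (NV b ltac:(lra)) as R4.
    pose proof (rect_affine q (f q) l a b c d) as RA; unfold rect in RA; fold g in RA.
    replace (rect f a b c d) with (dif (Ci * RtoC c)%C 1 a b + dif (RtoC b) Ci c d
      + - (dif (Ci * RtoC d)%C 1 a b + dif (RtoC a) Ci c d))%C.
    2: { rewrite <- (Cplus_0_r (rect f a b c d)), <- Copp_0, <- RA; unfold rect, dif; ring. }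
    set (r1 := dif (Ci * RtoC c)%C 1 a b) in *; set (r2 := dif (Ci * RtoC d)%C 1 a b) in *.
    set (r3 := dif (RtoC a) Ci c d) in *; set (r4 := dif (RtoC b) Ci c d) in *.
    pose proof (Cmod_triangle (r1 + r4) (- (r2 + r3))) as T; rewrite Cmod_opp in T.
    pose proof (Cmod_triangle r1 r4); pose proof (Cmod_triangle r2 r3).
    unfold M in *; nra.
Qed.

End Goursat.

(** * Flow charts *)

(** For the primitive, the second point may lie on any side of the first, so the order of the
    corners is dropped; exchanging them only changes the sign. *)
Lemma rect_0 (f : C -> C) (a0 b0 c0 d0 : R) :
  (forall z, inrect a0 b0 c0 d0 z -> cdiff f z) ->
  forall a b c d, a0 <= a <= b0 -> a0 <= b <= b0 -> c0 <= c <= d0 -> c0 <= d <= d0 ->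
  rect f a b c d = 0.
Proof.
  intros Hf.
  assert (H1 : forall a b c d, a <= b -> c <= d -> a0 <= a <= b0 -> a0 <= b <= b0 ->
    c0 <= c <= d0 -> c0 <= d <= d0 -> rect f a b c d = 0).
  { intros a b c d ab cd ha hb hc hd; apply Goursat; auto.
    intros z [h1 h2]; apply Hf; split; lra. }
  assert (H2 : forall a b c d, a <= b -> a0 <= a <= b0 -> a0 <= b <= b0 ->
    c0 <= c <= d0 -> c0 <= d <= d0 -> rect f a b c d = 0).
  { intros a b c d ab ha hb hc hd; destruct (Rle_dec c d); [apply H1; auto|].
    assert (E : rect f a b d c = 0) by (apply H1; auto; lra).
    replace (rect f a b c d) with (- rect f a b d c)%C; [rewrite E; ring|].
    unfold rect, seg.
    rewrite (CI_swap _ d c) by (apply (rcont_on_V f a0 b0 c0 d0); auto).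
    rewrite (CI_swap (fun t => Ci * f (RtoC a + RtoC t * Ci))%C d c)
      by (apply (rcont_on_V f a0 b0 c0 d0); auto).
    ring. }
  intros a b c d ha hb hc hd; destruct (Rle_dec a b); [apply H2; auto|].
  assert (E : rect f b a c d = 0) by (apply H2; auto; lra).
  replace (rect f a b c d) with (- rect f b a c d)%C; [rewrite E; ring|].
  unfold rect, seg.
  rewrite (CI_swap _ b a) by (apply (rcont_on_H f a0 b0 c0 d0); auto).
  rewrite (CI_swap (fun t => 1 * f (Ci * RtoC d + RtoC t * 1))%C b a)
    by (apply (rcont_on_H f a0 b0 c0 d0); auto).
  ring.
Qed.

Lemma seg_near_const (f : C -> C) (p e c : C) (a b M : R) : Cmod e = 1 ->
  rcont_on (fun t => e * f (p + RtoC t * e))%C a b ->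
  (forall t, Rmin a b <= t <= Rmax a b -> Cmod (f (p + RtoC t * e)%C - c) <= M) ->
  Cmod (seg f p e a b - RtoC (b - a) * (e * c)) <= M * Rabs (b - a).
Proof.
  intros He Hc HM; rewrite <- CI_const.
  apply (seg_near f (fun _ => c)); auto; intros t _; apply rcont_const.
Qed.

(** [G] integrates along the bottom side and then vertically. The estimate leaves [c] free: c = f(q)
    yields strict differentiability, and a fixed [c] on the whole rectangle yields the contraction
    bound for Newton's method. The factor 2 counts a horizontal and a vertical leg; both coordinates
    of a point of the legs are within e of those of q, hence the 2e. *)
Lemma primitive_exists (f : C -> C) (a0 b0 c0 d0 : R) : a0 <= b0 -> c0 <= d0 ->
  (forall z, inrect a0 b0 c0 d0 z -> cdiff f z) ->
  exists G : C -> C, forall (z w q c : C) (e M : R),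
    inrect a0 b0 c0 d0 z -> inrect a0 b0 c0 d0 w ->
    Cmod (z - q) < e -> Cmod (w - q) < e ->
    (forall v, inrect a0 b0 c0 d0 v -> Cmod (v - q) < 2 * e -> Cmod (f v - c) <= M) ->
    Cmod (G w - G z - c * (w - z)) <= 2 * M * Cmod (w - z).
Proof.
  intros Hab Hcd Hf.
  exists (fun z => seg f (Ci * RtoC c0) 1 a0 (Re z) + seg f (RtoC (Re z)) Ci c0 (Im z))%C.
  intros z w q c e M [Hz1 Hz2] [Hw1 Hw2] Hzq Hwq HM.
  set (H := seg f (Ci * RtoC (Im z)) 1 (Re z) (Re w)).
  set (V := seg f (RtoC (Re w)) Ci (Im z) (Im w)).
  match goal with |- Cmod (?A - _) <= _ => replace A with (H + V)%C end.
  (* Goursat on the rectangle between the bottom side and height Im z turns the difference of the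
     two values of [G] into the legs [H] and [V]. *)
  2: { pose proof (rect_0 f a0 b0 c0 d0 Hf (Re z) (Re w) c0 (Im z) Hz1 Hw1
         ltac:(lra) ltac:(lra)) as R0; unfold rect in R0; fold H in R0.
       rewrite (seg_H_Chasles f a0 b0 c0 d0 Hf c0 a0 (Re z) (Re w)) by lra.
       rewrite (seg_V_Chasles f a0 b0 c0 d0 Hf (Re w) c0 (Im z) (Im w)) by lra.
       fold V.
       match goal with |- _ = ?B => replace B with
         ((seg f (Ci * RtoC c0) 1 (Re z) (Re w) + seg f (RtoC (Re w)) Ci c0 (Im z) - H
          - seg f (RtoC (Re z)) Ci c0 (Im z)) + (H + V))%C by ring end.
       rewrite R0; ring. }
  assert (bnd : forall v, Rmin (Re z) (Re w) <= Re v <= Rmax (Re z) (Re w) ->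
     Rmin (Im z) (Im w) <= Im v <= Rmax (Im z) (Im w) -> Cmod (f v - c) <= M).
  { intros v Hv1 Hv2; apply HM.
    - split; (eapply Rminmax_between; [| |eassumption]); auto.
    - eapply Rle_lt_trans; [apply Cmod_le_Re_Im|].
      assert (A1 : Rabs (Re (v - q)) < e /\ Rabs (Im (v - q)) < e); [|lra].
      pose proof (Rle_lt_trans _ _ _ (Rabs_Re_le (z - q)) Hzq) as z1.
      pose proof (Rle_lt_trans _ _ _ (Rabs_Im_le (z - q)) Hzq) as z2.
      pose proof (Rle_lt_trans _ _ _ (Rabs_Re_le (w - q)) Hwq) as w1.
      pose proof (Rle_lt_trans _ _ _ (Rabs_Im_le (w - q)) Hwq) as w2.
      apply Rabs_def2 in z1; apply Rabs_def2 in z2; apply Rabs_def2 in w1; apply Rabs_def2 in w2.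
      change (Re (z - q)) with (Re z - Re q) in z1; change (Im (z - q)) with (Im z - Im q) in z2.
      change (Re (w - q)) with (Re w - Re q) in w1; change (Im (w - q)) with (Im w - Im q) in w2.
      change (Re (v - q)) with (Re v - Re q); change (Im (v - q)) with (Im v - Im q).
      unfold Rmin, Rmax in *;
        destruct (Rle_dec (Re z) (Re w)); destruct (Rle_dec (Im z) (Im w));
        split; apply Rabs_def1; lra. }
  assert (B1 : Cmod (H - RtoC (Re w - Re z) * (1 * c)) <= M * Rabs (Re w - Re z)).
  { apply seg_near_const; [apply Cmod_1|apply (rcont_on_H f a0 b0 c0 d0); auto|].
    intros t Ht; apply bnd.
    - replace (Re (Ci * RtoC (Im z) + RtoC t * 1)) with t by (unfold Re; simpl; ring); auto.
    - replace (Im (Ci * RtoC (Im z) + RtoC t * 1)) with (Im z) by (unfold Im; simpl; ring).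
      split; [apply Rmin_l|apply Rmax_l]. }
  assert (B2 : Cmod (V - RtoC (Im w - Im z) * (Ci * c)) <= M * Rabs (Im w - Im z)).
  { apply seg_near_const; [apply Cmod_Ci|apply (rcont_on_V f a0 b0 c0 d0); auto|].
    intros t Ht; apply bnd.
    - replace (Re (RtoC (Re w) + RtoC t * Ci)) with (Re w) by (unfold Re; simpl; ring).
      split; [apply Rmin_r|apply Rmax_r].
    - replace (Im (RtoC (Re w) + RtoC t * Ci)) with t by (unfold Im; simpl; ring); auto. }
  assert (M0 : 0 <= M).
  { eapply Rle_trans; [apply Cmod_ge_0|]; apply (bnd z); split;
      first [apply Rmin_l|apply Rmax_l]. }
  replace (H + V - c * (w - z))%C with
    ((H - RtoC (Re w - Re z) * (1 * c)) + (V - RtoC (Im w - Im z) * (Ci * c)))%C.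
  2: { assert (E : (w - z)%C = (RtoC (Re w - Re z) + Ci * RtoC (Im w - Im z))%C)
         by (apply injective_projections; unfold Re, Im; simpl; ring).
       rewrite E; ring. }
  eapply Rle_trans; [apply Cmod_triangle|].
  pose proof (Rabs_Re_le (w - z)) as a1; pose proof (Rabs_Im_le (w - z)) as a2.
  change (Re (w - z)) with (Re w - Re z) in a1; change (Im (w - z)) with (Im w - Im z) in a2.
  nra.
Qed.

(* Straightening coordinates: h' = F(h), and its inverse g is a primitive of 1/F. *)
Record chart (F : C -> C) (z : C) (rho L : R) (h g : C -> C) : Prop := {
  ch_pos : 0 < rho;
  ch_L : 0 < L;
  ch_0 : h 0 = z;
  ch_gh : forall a, Cmod a < rho -> g (h a) = a;
  ch_nz : forall a, Cmod a < rho -> F (h a) <> 0;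
  ch_sder : forall a, Cmod a < rho -> sder h a (F (h a));
  ch_gder : forall a, Cmod a < rho -> sder g (h a) (/ F (h a))%C;
  ch_open : forall a, Cmod a < rho -> exists d, 0 < d /\
    forall w, Cmod (w - h a) < d -> Cmod (g w) < rho /\ h (g w) = w;
  ch_lip : forall a b, Cmod a < rho -> Cmod b < rho -> Cmod (h a - h b) <= L * Cmod (a - b)
}.
Arguments ch_pos {F z rho L h g}.
Arguments ch_L {F z rho L h g}.
Arguments ch_0 {F z rho L h g}.
Arguments ch_gh {F z rho L h g}.
Arguments ch_nz {F z rho L h g}.
Arguments ch_sder {F z rho L h g}.
Arguments ch_gder {F z rho L h g}.
Arguments ch_open {F z rho L h g}.
Arguments ch_lip {F z rho L h g}.

(** Newton's iteration with the derivative frozen at [f0]: the hypothesis makes each step halve the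
    residual, and the steps add up to less than 2 Cmod a / Cmod f0 < s/4. *)
Lemma newton_solve (G : C -> C) (z0 f0 : C) (s : R) : 0 < s -> f0 <> 0 -> G z0 = 0 ->
  (forall z w, Cmod (z - z0) < s -> Cmod (w - z0) < s ->
     Cmod (G w - G z - f0 * (w - z)) <= Cmod f0 / 2 * Cmod (w - z)) ->
  forall a, Cmod a < Cmod f0 * s / 8 -> exists z, Cmod (z - z0) < s /\ G z = a.
Proof.
  intros Hs Hf0 G0 HG a Ha; apply NNPP; intros Hno.
  set (m := Cmod f0) in *; assert (Hm : 0 < m) by (apply Cmod_gt_0; auto).
  assert (Hiter : forall n : nat, exists z,
    Cmod (z - z0) <= 2 * (Cmod a / m) * (1 - (/2) ^ n) /\ Cmod (G z - a) <= Cmod a * (/2) ^ n).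
  { induction n as [|n [z [H1 H2]]].
    - exists z0; rewrite G0; split.
      + rewrite Cmod_minus_diag; simpl; lra.
      + replace (0 - a)%C with (- a)%C by ring; rewrite Cmod_opp; simpl; lra.
    - assert (Hp : 0 < (/2)^n) by (apply pow_lt; lra).
      assert (Ha0 : 0 <= Cmod a / m) by (apply Rdiv_le_0_compat; auto; apply Cmod_ge_0).
      assert (Ha1 : Cmod a / m < s / 8) by (apply Rlt_div_l; lra).
      set (w := (z - (G z - a) / f0)%C).
      assert (Hwz : Cmod (w - z) <= Cmod a / m * (/2)^n).
      { replace (w - z)%C with (- ((G z - a) / f0))%C by (unfold w; ring).
        rewrite Cmod_opp, Cmod_div by auto; fold m.
        apply Rmult_le_reg_r with m; auto; unfold Rdiv; rewrite Rmult_assoc, Rinv_l by lra.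
        replace (Cmod a * / m * (/2)^n * m) with (Cmod a * (/2)^n) by (field; lra); lra. }
      assert (Hz : Cmod (z - z0) < s) by nra.
      assert (Hw : Cmod (w - z0) <= 2 * (Cmod a / m) * (1 - (/2) ^ S n)).
      { pose proof (Cmod_triangle_minus w z z0) as T; rewrite <- tech_pow_Rmult; lra. }
      assert (Hp' : 0 < (/2)^ S n) by (apply pow_lt; lra).
      exists w; split; auto.
      replace (G w - a)%C with (G w - G z - f0 * (w - z))%C by (unfold w; field; auto).
      eapply Rle_trans; [apply HG; auto; nra|].
      rewrite <- tech_pow_Rmult.
      apply Rle_trans with (m / 2 * (Cmod a / m * (/2)^n)).
      + apply Rmult_le_compat_l; lra.
      + apply Req_le; field; lra. }
  (* Without a solution, compactness bounds the residual away from 0 on a square of half side s/4.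
     This square contains all iterates and lies in the disc of radius s/2, so the vanishing
     residuals are contradictory. *)
  assert (Hbelow : exists c, 0 < c /\ forall v,
     inrect (Re z0 - s/4) (Re z0 + s/4) (Im z0 - s/4) (Im z0 + s/4) v -> c <= Cmod (G v - a)).
  { apply (rectangle_compactness (fun c v => c <= Cmod (G v - a))); try lra.
    { intros c c' v Hcc Hv; lra. }
    intros q Hq; apply Cmod_inrect in Hq.
    assert (Hc : 0 < Cmod (G q - a)).
    { apply Cmod_minus_pos; intros E; apply Hno; exists q; split; auto; lra. }
    set (c := Cmod (G q - a)) in *.
    exists (c / 2), (Rmin (s / 4) (c / (4 * m))); split; [lra|].
    split; [apply Rmin_pos; [lra|apply Rdiv_lt_0_compat; lra]|]; intros v Hv.
    destruct (lt_Rmin _ _ _ Hv) as [v1 v2]; apply Rlt_div_r in v2; [|lra].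
    pose proof (Cmod_triangle_minus v q z0) as T.
    specialize (HG q v ltac:(lra) ltac:(lra)).
    pose proof (Cmod_triangle_inv (G q - a) (G q - G v)) as T1.
    replace (G q - a - (G q - G v))%C with (G v - a)%C in T1 by ring.
    rewrite (Cmod_minus_sym (G q) (G v)) in T1.
    pose proof (Cmod_triangle_inv (G v - G q) (f0 * (v - q))) as T2.
    rewrite Cmod_mult in T2; fold m in T2; fold c in T1; lra. }
  destruct Hbelow as [c [Hc Hb]].
  destruct (pow_lt_1_zero (/2)) with (y := c / (Cmod a + 1)) as [n Hn].
  { rewrite Rabs_pos_eq; lra. }
  { apply Rdiv_lt_0_compat; auto; pose proof (Cmod_ge_0 a); lra. }
  specialize (Hn n (Nat.le_refl n)).
  assert (Hp : 0 < (/2)^n) by (apply pow_lt; lra).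
  rewrite Rabs_pos_eq in Hn by lra.
  pose proof (Cmod_ge_0 a).
  apply Rlt_div_r in Hn; [|lra].
  destruct (Hiter n) as [z [H1 H2]].
  assert (Ha1 : Cmod a / m < s / 8) by (apply Rlt_div_l; lra).
  assert (Ha0 : 0 <= Cmod a / m) by (apply Rdiv_le_0_compat; auto).
  assert (Hz : Cmod (z - z0) <= s / 4) by nra.
  specialize (Hb z (inrect_Cmod _ _ _ Hz)); nra.
Qed.

(** [h] inverts a primitive [G] of 1/F normalized by G z0 = 0. [G] is close to multiplication by
    1/F(z0), with lower Lipschitz constant m/2, hence L = 2/m; [rho] is the radius that
    [newton_solve] can reach. *)
Lemma chart_exists (F : C -> C) (z0 : C) : entire F -> F z0 <> 0 ->
  exists rho L h g, chart F z0 rho L h g.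
Proof.
  intros HF Hz0.
  set (f := fun w => (/ F w)%C).
  set (m := Cmod (f z0)).
  assert (Hf0 : f z0 <> 0).
  { intros E; apply C1_nz; rewrite <- (Cinv_r (F z0)) by auto; fold (f z0); rewrite E; ring. }
  assert (Hm : 0 < m) by (apply Cmod_gt_0; auto).
  destruct (entire_ccont F z0 HF (Cmod (F z0))) as [d1 [Hd1 H1]]; [apply Cmod_gt_0; auto|].
  assert (Hnz : forall w, Cmod (w - z0) < d1 -> F w <> 0).
  { intros w Hw E; specialize (H1 w Hw); rewrite E in H1.
    replace (0 - F z0)%C with (- F z0)%C in H1 by ring; rewrite Cmod_opp in H1; lra. }
  assert (Hdiff : forall w, Cmod (w - z0) < d1 -> cdiff f w)
    by (intros w Hw; apply cdiff_inv; auto).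
  destruct (cdiff_ccont f z0) with (k := m / 4) as [d2 [Hd2 H2]].
  { apply Hdiff; rewrite Cmod_minus_diag; auto. }
  { lra. }
  (* The square of half side s lies in the disc of radius 2s, which has to stay below d1 and d2. *)
  set (s := Rmin d1 d2 / 3).
  assert (Hs : 0 < s) by (assert (0 < Rmin d1 d2) by (apply Rmin_pos; auto); unfold s; lra).
  assert (Hs1 : 2 * s < d1) by (pose proof (Rmin_l d1 d2); unfold s in *; lra).
  assert (Hs2 : 2 * s < d2) by (pose proof (Rmin_r d1 d2); unfold s in *; lra).
  set (Q := inrect (Re z0 - s) (Re z0 + s) (Im z0 - s) (Im z0 + s)).
  assert (HQ : forall v, Q v -> Cmod (v - z0) <= 2 * s) by (intros v; apply Cmod_inrect).
  assert (HQ' : forall v, Cmod (v - z0) < s -> Q v)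
    by (intros v Hv; apply inrect_Cmod; lra).
  destruct (primitive_exists f (Re z0 - s) (Re z0 + s) (Im z0 - s) (Im z0 + s)) as [G0 HG0];
    [lra|lra| |].
  { intros z Hz; apply Hdiff; specialize (HQ z Hz); lra. }
  set (G := fun z => (G0 z - G0 z0)%C).
  assert (HG : forall z w, Cmod (z - z0) < s -> Cmod (w - z0) < s ->
     Cmod (G w - G z - f z0 * (w - z)) <= Cmod (f z0) / 2 * Cmod (w - z)).
  { intros z w Hz Hw; replace (G w - G z)%C with (G0 w - G0 z)%C by (unfold G; ring).
    replace (Cmod (f z0) / 2) with (2 * (m / 4)) by (unfold m; lra).
    apply (HG0 z w z0 (f z0) s (m / 4)); auto; try (apply HQ'; auto).
    intros v Hv _; apply Rlt_le, H2; specialize (HQ v Hv); lra. }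
  assert (HGd : forall c, Cmod (c - z0) < s -> sder G c (f c)).
  { intros c Hc k Hk.
    destruct (cdiff_ccont f c) with (k := k / 2) as [d3 [Hd3 H3]]; [apply Hdiff; lra|lra|].
    exists (Rmin (s - Cmod (c - z0)) (d3 / 2)); split; [apply Rmin_pos; lra|].
    intros z w Hz Hw.
    set (e := Rmin (s - Cmod (c - z0)) (d3 / 2)) in *.
    assert (e1 : e <= s - Cmod (c - z0)) by apply Rmin_l.
    assert (e2 : e <= d3 / 2) by apply Rmin_r.
    replace (G w - G z)%C with (G0 w - G0 z)%C by (unfold G; ring).
    replace k with (2 * (k / 2)) by lra.
    apply (HG0 z w c (f c) e (k / 2)); auto.
    - apply HQ'; pose proof (Cmod_triangle_minus z c z0); lra.
    - apply HQ'; pose proof (Cmod_triangle_minus w c z0); lra.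
    - intros v _ Hv; apply Rlt_le, H3; lra. }
  assert (Glow : forall z w, Cmod (z - z0) < s -> Cmod (w - z0) < s ->
     m / 2 * Cmod (w - z) <= Cmod (G w - G z) <= 3 * m / 2 * Cmod (w - z)).
  { intros z w Hz Hw; specialize (HG z w Hz Hw).
    pose proof (Cmod_triangle_inv (f z0 * (w - z)) (G w - G z)) as T.
    rewrite (Cmod_minus_sym (f z0 * (w - z)) (G w - G z)), Cmod_mult in T.
    pose proof (Cmod_triangle_inv (G w - G z) (f z0 * (w - z))) as T'.
    rewrite Cmod_mult in T'; fold m in HG, T, T'; lra. }
  assert (Gz0 : G z0 = 0) by (unfold G; ring).
  pose proof (newton_solve G z0 (f z0) s Hs Hf0 Gz0 HG) as Hsolve; fold m in Hsolve.
  set (rho := m * s / 8) in *.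
  set (h := fun a => epsilon (inhabits z0) (fun z => Cmod (z - z0) < s /\ G z = a)).
  assert (Hh : forall a, Cmod a < rho -> Cmod (h a - z0) < s /\ G (h a) = a).
  { intros a Ha; apply (epsilon_spec (inhabits z0) (fun z => Cmod (z - z0) < s /\ G z = a)).
    apply Hsolve; auto. }
  assert (Hrho : 0 < rho) by (unfold rho; nra).
  assert (Ginj : forall z w, Cmod (z - z0) < s -> Cmod (w - z0) < s -> G z = G w -> z = w).
  { intros z w Hz Hw E; symmetry; apply Cmod_eq_minus.
    destruct (Glow z w Hz Hw) as [T _]; rewrite E in T.
    replace (G w - G w)%C with (RtoC 0) in T by ring; rewrite Cmod_0 in T.
    pose proof (Cmod_ge_0 (w - z)); nra. }
  assert (Hlip : forall a b, Cmod a < rho -> Cmod b < rho -> Cmod (h a - h b) <= 2 / m * Cmod (a - b)).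
  { intros a b Ha Hb; destruct (Hh a Ha) as [a1 a2]; destruct (Hh b Hb) as [b1 b2].
    destruct (Glow (h b) (h a) b1 a1) as [T _]; rewrite a2, b2 in T.
    apply Rmult_le_reg_l with (m / 2); [lra|].
    eapply Rle_trans; [exact T|]; apply Req_le; field; lra. }
  assert (Hnh : forall a, Cmod a < rho -> F (h a) <> 0).
  { intros a Ha; apply Hnz; destruct (Hh a Ha); lra. }
  exists rho, (2 / m), h, G; constructor; auto.
  - apply Rdiv_lt_0_compat; lra.
  - destruct (Hh 0) as [e1 e2]; [rewrite Cmod_0; auto|].
    apply Ginj; auto; [|congruence].
    rewrite Cmod_minus_diag; auto.
  - intros a Ha; apply Hh; auto.
  - intros a Ha k Hk.
    (* The error of [h] is F(h a) times that of [G], and Cmod (h w - h z) is at most 2/m times Cmod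
       (w - z); the tolerance k m / (2M) for [G] compensates both factors. *)
    set (M := Cmod (F (h a))); assert (HM : 0 < M) by (apply Cmod_gt_0; auto).
    destruct (HGd (h a)) with (k := k * m / (2 * M)) as [d [Hd H]]; [apply Hh; auto| |].
    { apply Rdiv_lt_0_compat; nra. }
    exists (Rmin (rho - Cmod a) (d * m / 2)); split; [apply Rmin_pos; [lra|nra]|].
    assert (Hnear : forall z, Cmod (z - a) < Rmin (rho - Cmod a) (d * m / 2) ->
       Cmod z < rho /\ Cmod (h z - h a) < d).
    { intros z Hz.
      destruct (lt_Rmin _ _ _ Hz) as [z1 z2].
      assert (z3 : Cmod z < rho) by (pose proof (Cmod_triangle_inv z a); lra).
      split; auto; eapply Rle_lt_trans; [apply Hlip; auto|].
      apply Rmult_lt_reg_l with (m / 2); [lra|].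
      replace (m / 2 * (2 / m * Cmod (z - a))) with (Cmod (z - a)) by (field; lra); lra. }
    intros z w Hz Hw.
    destruct (Hnear z Hz) as [z1 z2]; destruct (Hnear w Hw) as [w1 w2].
    specialize (H (h z) (h w) z2 w2).
    rewrite (proj2 (Hh z z1)), (proj2 (Hh w w1)) in H.
    replace (h w - h z - F (h a) * (w - z))%C
      with (- F (h a) * (w - z - f (h a) * (h w - h z)))%C by (unfold f; field; auto).
    rewrite Cmod_mult, Cmod_opp; fold M.
    apply Rle_trans with (M * (k * m / (2 * M) * (2 / m * Cmod (w - z)))).
    + apply Rmult_le_compat_l; [lra|].
      eapply Rle_trans; [exact H|]; apply Rmult_le_compat_l; auto.
      apply Rlt_le, Rdiv_lt_0_compat; nra.
    + apply Req_le; field; lra.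
  - intros a Ha; apply HGd, Hh; auto.
  - intros a Ha; destruct (Hh a Ha) as [a1 a2].
    exists (Rmin (s - Cmod (h a - z0)) ((rho - Cmod a) / (3 * m / 2))).
    split; [apply Rmin_pos; [lra|apply Rdiv_lt_0_compat; lra]|].
    intros w Hw.
    destruct (lt_Rmin _ _ _ Hw) as [w1 w2].
    assert (w3 : Cmod (w - z0) < s) by (pose proof (Cmod_triangle_minus w (h a) z0); lra).
    apply Rlt_div_r in w2; [|lra].
    assert (w4 : Cmod (G w) < rho).
    { destruct (Glow (h a) w a1 w3) as [_ T]; rewrite a2 in T.
      pose proof (Cmod_triangle_inv (G w) a); lra. }
    split; auto; destruct (Hh (G w) w4) as [w5 w6]; apply Ginj; auto.
Qed.

Lemma cder_Re_Im (phi : R -> C) (t : R) (l : C) : cder phi t l ->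
  is_derive (fun s => Re (phi s)) t (Re l) /\ is_derive (fun s => Im (phi s)) t (Im l).
Proof.
  intros H; apply is_derive_cder in H; split.
  - exact (filterdiff_comp' (K := R_AbsRing) (V := C_R_NormedModule) (W := R_NormedModule) phi fst t _ _
     H (filterdiff_linear _ (is_linear_fst (K := R_AbsRing) (U := R_NormedModule) (V := R_NormedModule)))).
  - exact (filterdiff_comp' (K := R_AbsRing) (V := C_R_NormedModule) (W := R_NormedModule) phi snd t _ _
     H (filterdiff_linear _ (is_linear_snd (K := R_AbsRing) (U := R_NormedModule) (V := R_NormedModule)))).
Qed.

Lemma cder_zero_const (phi : R -> C) (a b : R) : a <= b ->
  (forall t, a <= t <= b -> cder phi t 0) -> phi a = phi b.
Proof.
  intros Hab H; destruct (Req_dec a b) as [->|]; auto.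
  apply (eq_is_derive (V := C_R_NormedModule) phi); [|lra].
  intros t Ht; apply is_derive_cder, H; auto.
Qed.

Lemma cder_minus (f g : R -> C) (t : R) (l m : C) :
  cder f t l -> cder g t m -> cder (fun s => f s - g s)%C t (l - m)%C.
Proof.
  intros Hf Hg k Hk.
  destruct (Hf (k/2)) as [d1 [Hd1 H1]]; [lra|]; destruct (Hg (k/2)) as [d2 [Hd2 H2]]; [lra|].
  exists (Rmin d1 d2); split; [apply Rmin_pos; auto|]; intros s Hs.
  destruct (lt_Rmin _ _ _ Hs) as [l1 l2]; specialize (H1 s l1); specialize (H2 s l2).
  replace (f s - g s - (f t - g t) - RtoC (s - t) * (l - m))%C
    with ((f s - f t - RtoC (s - t) * l) + - (g s - g t - RtoC (s - t) * m))%C by ring.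
  eapply Rle_trans; [apply Cmod_triangle|]; rewrite Cmod_opp; lra.
Qed.

Lemma cder_ext_loc (f g : R -> C) (t : R) (l : C) :
  (exists d, 0 < d /\ forall s, Rabs (s - t) < d -> f s = g s) -> cder f t l -> cder g t l.
Proof.
  intros [d [Hd E]] H k Hk; destruct (H k Hk) as [e [He H']].
  exists (Rmin d e); split; [apply Rmin_pos; auto|]; intros s Hs.
  rewrite <- (E s), <- (E t).
  - apply H'; eapply Rlt_le_trans; [exact Hs|apply Rmin_r].
  - rewrite Rminus_eq_0, Rabs_R0; auto.
  - eapply Rlt_le_trans; [exact Hs|apply Rmin_l].
Qed.

Lemma cder_shift (f : R -> C) (c t : R) (l : C) :
  cder f (t + c) l -> cder (fun s => f (s + c)) t l.
Proof.
  intros H k Hk; destruct (H k Hk) as [d [Hd H']]; exists d; split; auto.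
  intros s Hs; replace (s - t) with (s + c - (t + c)) in * by ring; auto.
Qed.

(** * Uniqueness of solutions and the flow *)

(** A complex direction [e] is complex time: e = 1 follows the flow, imaginary [e] follows the
    transversal section. *)
Lemma chart_cder F z rho L h g (a e : C) (t : R) : chart F z rho L h g ->
  Cmod (a + RtoC t * e) < rho ->
  cder (fun s => h (a + RtoC s * e)%C) t (F (h (a + RtoC t * e)%C) * e)%C.
Proof.
  intros Hc Ht.
  apply (sder_cder h (fun s => (a + RtoC s * e)%C)); [apply Hc; auto|apply cder_affine].
Qed.

Lemma chart_cder_1 F z rho L h g (a : C) (t : R) : chart F z rho L h g ->
  Cmod (a + RtoC t) < rho ->
  cder (fun s => h (a + RtoC s)%C) t (F (h (a + RtoC t)%C)).
Proof.
  intros Hc Ht.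
  assert (E : forall s : R, (a + RtoC s * 1)%C = (a + RtoC s)%C) by (intros; ring).
  pose proof (chart_cder F z rho L h g a 1 t Hc) as H; rewrite E in H; specialize (H Ht).
  rewrite Cmult_1_r in H.
  eapply cder_ext_loc; [|exact H]; exists 1; split; [lra|]; intros s _; cbv beta; rewrite E; auto.
Qed.

Definition sol_near (F : C -> C) (phi : R -> C) (t0 : R) : Prop :=
  exists d, 0 < d /\ forall t, Rabs (t - t0) < d -> cder phi t (F (phi t)).

(** In the chart, g(phi(t)) - (t - t0) has derivative F/F - 1 = 0. *)
Lemma chart_sol_unique F q rho L h g (phi : R -> C) (t0 : R) : chart F q rho L h g ->
  sol_near F phi t0 -> phi t0 = q ->
  exists d, 0 < d /\ forall t, Rabs (t - t0) < d -> phi t = h (RtoC (t - t0)).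
Proof.
  intros Hc [d1 [Hd1 H1]] Hq.
  assert (C0 : Cmod 0 < rho) by (rewrite Cmod_0; apply Hc).
  destruct (ch_open Hc 0 C0) as [e [He Hop]].
  rewrite (ch_0 Hc), <- Hq in Hop.
  assert (Hr : rcont phi t0).
  { eapply cder_rcont, H1; rewrite Rminus_eq_0, Rabs_R0; auto. }
  destruct (Hr e He) as [d2 [Hd2 H2]].
  exists (Rmin d1 d2); split; [apply Rmin_pos; auto|]; intros t Ht.
  assert (Hder : forall s, Rabs (s - t0) < Rmin d1 d2 ->
     cder (fun s => g (phi s) - RtoC (s - t0))%C s 0).
  { intros s Hs.
    destruct (lt_Rmin _ _ _ Hs) as [s1 s2].
    destruct (Hop _ (H2 s s2)) as [g1 g2].
    replace (RtoC 0) with (/ F (phi s) * F (phi s) - 1)%C.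
    2: { rewrite Cinv_l; [ring|]; rewrite <- g2; apply (ch_nz Hc); auto. }
    apply cder_minus; [|apply cder_RtoC].
    apply (sder_cder g phi); [|apply H1; auto].
    rewrite <- g2 at 1 2; apply (ch_gder Hc); auto. }
  assert (Heq : (g (phi t) - RtoC (t - t0) = g (phi t0) - RtoC (t0 - t0))%C).
  { apply Rabs_def2 in Ht.
    destruct (Rle_dec t t0).
    - apply (cder_zero_const (fun s => g (phi s) - RtoC (s - t0))%C t t0); auto.
      intros s Hs; apply Hder, Rabs_def1; lra.
    - symmetry; apply (cder_zero_const (fun s => g (phi s) - RtoC (s - t0))%C t0 t); [lra|].
      intros s Hs; apply Hder, Rabs_def1; lra. }
  assert (Hg0 : g (phi t0) = 0).
  { rewrite Hq, <- (ch_0 Hc); apply (ch_gh Hc); auto. }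
  rewrite Hg0, Rminus_eq_0 in Heq.
  assert (t2 : Rabs (t - t0) < d2) by (eapply Rlt_le_trans; [exact Ht|apply Rmin_r]).
  destruct (Hop _ (H2 t t2)) as [g1 g2].
  rewrite <- g2; f_equal.
  replace (g (phi t)) with (g (phi t) - RtoC (t - t0) + RtoC (t - t0))%C by ring.
  rewrite Heq; ring.
Qed.

Arguments chart_sol_unique {F q rho L h g}.

Lemma Gronwall (D D' : R -> R) (K a b : R) : a <= b ->
  (forall t, a <= t <= b -> is_derive D t (D' t)) ->
  (forall t, a <= t <= b -> D' t <= K * D t) -> D b <= D a * exp (K * (b - a)).
Proof.
  intros Hab Hd Hb.
  set (E := fun t => D t * exp (- K * t)).
  set (E' := fun t => D' t * exp (- K * t) + D t * (- K * exp (- K * t))).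
  assert (HE : forall t, a <= t <= b -> is_derive E t (E' t)).
  { intros t Ht.
    apply (is_derive_mult (K := R_AbsRing) D (fun t => exp (- K * t)) t);
      [apply Hd; auto| |intros; apply Rmult_comm].
    auto_derive; auto; ring. }
  destruct (MVT_gen E a b E') as [c [Hc Heq]]; rewrite ?Rmin_left, ?Rmax_right in * by auto.
  - intros x Hx; apply HE; lra.
  - intros x Hx; apply continuity_pt_filterlim.
    apply (ex_derive_continuous (K := R_AbsRing) (V := R_NormedModule) E x).
    eexists; apply HE; auto.
  - assert (HE' : E' c <= 0).
    { specialize (Hb c Hc); pose proof (exp_pos (- K * c)); unfold E'; nra. }
    assert (Hle : E b <= E a) by nra; unfold E in Hle.
    replace (exp (K * (b - a))) with (exp (- K * a) * / exp (- K * b)).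
    2: { rewrite <- exp_Ropp, <- exp_plus; f_equal; ring. }
    pose proof (exp_pos (- K * b)).
    rewrite <- Rmult_assoc; apply Rle_div_r; [lra|exact Hle].
Qed.

(* Gronwall applied to the squared distance to a zero of F. *)
Lemma equilibrium_distance (F : C -> C) (phi : R -> C) (q : C) (K a b : R) :
  a <= b -> F q = 0 ->
  (forall t, a <= t <= b -> cder phi t (F (phi t))) ->
  (forall t, a <= t <= b -> Cmod (F (phi t) - F q) <= K * Cmod (phi t - q)) ->
  (Cmod (phi b - q)) ^ 2 <= (Cmod (phi a - q)) ^ 2 * exp (2 * K * (b - a)) /\
  (Cmod (phi a - q)) ^ 2 <= (Cmod (phi b - q)) ^ 2 * exp (2 * K * (b - a)).
Proof.
  intros Hab Hq Hd HK.
  set (D := fun t => (Cmod (phi t - q)) ^ 2).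
  set (D' := fun t => 2 * Re ((phi t - q) * Cconj (F (phi t)))).
  assert (HD : forall t, a <= t <= b -> is_derive D t (D' t)).
  { intros t Ht; destruct (cder_Re_Im _ _ _ (Hd t Ht)) as [H1 H2].
    assert (Hsq : forall (u v : R -> R) (a b u' v' : R), is_derive u t u' -> is_derive v t v' ->
      is_derive (fun t => (u t - a) ^ 2 + (v t - b) ^ 2) t
        (2 * ((u t - a) * u' + (v t - b) * v'))).
    { intros u v a' b' u' v' Hu Hv.
      pose proof (is_derive_unique _ _ _ Hu) as U1; pose proof (is_derive_unique _ _ _ Hv) as U2.
      auto_derive.
      - repeat split; eexists; eassumption.
      - change (Derive (fun x => u x) t) with (Derive u t).
        change (Derive (fun x => v x) t) with (Derive v t).
        rewrite U1, U2; ring. }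
    apply (is_derive_ext (fun t => (Re (phi t) - Re q) ^ 2 + (Im (phi t) - Im q) ^ 2)).
    { intros s; unfold D; rewrite Cmod_sqr; reflexivity. }
    unfold D'; replace (Re ((phi t - q) * Cconj (F (phi t)))) with
      ((Re (phi t) - Re q) * Re (F (phi t)) + (Im (phi t) - Im q) * Im (F (phi t)))
      by (unfold Re, Im; simpl; ring).
    apply (Hsq (fun t => Re (phi t)) (fun t => Im (phi t))); auto. }
  assert (Hb : forall t, a <= t <= b -> Rabs (D' t) <= 2 * K * D t).
  { intros t Ht; unfold D', D; rewrite Rabs_mult, (Rabs_pos_eq 2) by lra.
    pose proof (Rabs_Re_le ((phi t - q) * Cconj (F (phi t)))) as T.
    rewrite Cmod_mult, Cmod_conj in T.
    specialize (HK t Ht); rewrite Hq in HK.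
    replace (F (phi t) - 0)%C with (F (phi t)) in HK by ring.
    pose proof (Cmod_ge_0 (phi t - q)); nra. }
  split.
  - apply (Gronwall D D'); auto; intros t Ht; apply (Rabs_le_between _ _), Hb; auto.
  - pose proof (exp_pos (2 * K * (b - a))).
    assert (HG : - D b <= - D a * exp (- (2 * K) * (b - a))).
    { apply (Gronwall (fun t => - D t) (fun t => - D' t)); auto.
      - intros t Ht; apply (is_derive_opp (V := R_NormedModule) D), HD; auto.
      - intros t Ht; specialize (Hb t Ht); apply Rabs_le_between in Hb; lra. }
    replace (- (2 * K) * (b - a)) with (- (2 * K * (b - a))) in HG by ring.
    rewrite exp_Ropp in HG; fold (D a) (D b); apply Rle_div_l; [lra|].
    unfold Rdiv; lra.
Qed.

(** At a zero of [F] there is no chart; there the Gronwall estimate in both time directions keeps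
    distance 0 equal to 0. *)
Lemma equilibrium_sol_unique (F : C -> C) (phi : R -> C) (t0 : R) : entire F ->
  sol_near F phi t0 -> F (phi t0) = 0 ->
  exists d, 0 < d /\ forall t, Rabs (t - t0) < d -> phi t = phi t0.
Proof.
  intros HF [d1 [Hd1 H1]] Hq.
  destruct (cdiff_Lipschitz F _ (entire_cdiff F (phi t0) HF)) as [K [e [He [HK HL]]]].
  assert (Hr : rcont phi t0).
  { eapply cder_rcont, H1; rewrite Rminus_eq_0, Rabs_R0; auto. }
  destruct (Hr e He) as [d2 [Hd2 H2]].
  exists (Rmin d1 d2); split; [apply Rmin_pos; auto|]; intros t Ht.
  assert (Hn : forall s, Rabs (s - t0) < Rmin d1 d2 -> cder phi s (F (phi s)) /\
     Cmod (F (phi s) - F (phi t0)) <= K * Cmod (phi s - phi t0)).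
  { intros s Hs; destruct (lt_Rmin _ _ _ Hs); auto. }
  apply Rabs_def2 in Ht.
  assert (Z : (Cmod (phi t0 - phi t0)) ^ 2 = 0).
  { replace (phi t0 - phi t0)%C with (RtoC 0) by ring; rewrite Cmod_0; ring. }
  apply Cmod_eq_minus; pose proof (Cmod_ge_0 (phi t - phi t0)).
  destruct (Rle_dec t0 t).
  - destruct (equilibrium_distance F phi (phi t0) K t0 t) as [T _]; auto; try lra.
    + intros s Hs; apply Hn, Rabs_def1; lra.
    + intros s Hs; apply Hn, Rabs_def1; lra.
    + rewrite Z in T; nra.
  - destruct (equilibrium_distance F phi (phi t0) K t t0) as [_ T]; auto; try lra.
    + intros s Hs; apply Hn, Rabs_def1; lra.
    + intros s Hs; apply Hn, Rabs_def1; lra.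
    + rewrite Z in T; nra.
Qed.

Lemma sol_unique_near (F : C -> C) (phi psi : R -> C) (t0 : R) : entire F ->
  sol_near F phi t0 -> sol_near F psi t0 -> phi t0 = psi t0 ->
  exists d, 0 < d /\ forall t, Rabs (t - t0) < d -> phi t = psi t.
Proof.
  intros HF H1 H2 E; destruct (Ceq_dec (F (phi t0)) 0) as [Hz|Hz].
  - destruct (equilibrium_sol_unique F phi t0 HF H1 Hz) as [d1 [Hd1 E1]].
    rewrite E in Hz; destruct (equilibrium_sol_unique F psi t0 HF H2 Hz) as [d2 [Hd2 E2]].
    exists (Rmin d1 d2); split; [apply Rmin_pos; auto|]; intros t Ht.
    destruct (lt_Rmin _ _ _ Ht); rewrite E1, E2, E; auto.
  - destruct (chart_exists F (phi t0) HF Hz) as (rho & L & h & g & Hc).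
    destruct (chart_sol_unique phi t0 Hc H1 eq_refl) as [d1 [Hd1 E1]].
    destruct (chart_sol_unique psi t0 Hc H2 (eq_sym E)) as [d2 [Hd2 E2]].
    exists (Rmin d1 d2); split; [apply Rmin_pos; auto|]; intros t Ht.
    destruct (lt_Rmin _ _ _ Ht); rewrite E1, E2; auto.
Qed.

Lemma rcont_eq_limit (phi psi : R -> C) (t : R) : rcont phi t -> rcont psi t ->
  (forall d, 0 < d -> exists s, Rabs (s - t) < d /\ phi s = psi s) -> phi t = psi t.
Proof.
  intros H1 H2 H; apply Cmod_eq_minus, Rle_antisym; [|apply Cmod_ge_0].
  apply le_of_forall_eps; intros k Hk.
  destruct (H1 (k/2)) as [d1 [Hd1 K1]]; [lra|]; destruct (H2 (k/2)) as [d2 [Hd2 K2]]; [lra|].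
  destruct (H (Rmin d1 d2)) as [s [Hs E]]; [apply Rmin_pos; auto|].
  destruct (lt_Rmin _ _ _ Hs) as [l1 l2]; specialize (K1 s l1); specialize (K2 s l2).
  pose proof (Cmod_triangle_minus (phi t) (phi s) (psi t)) as T.
  rewrite (Cmod_minus_sym (phi t) (phi s)) in T; rewrite <- E in K2; lra.
Qed.

Lemma sol_unique (F : C -> C) (phi psi : R -> C) (a b t : R) : entire F ->
  (forall s, a < s < b -> cder phi s (F (phi s))) ->
  (forall s, a < s < b -> cder psi s (F (psi s))) ->
  forall t0, a < t0 < b -> phi t0 = psi t0 -> a < t < b -> phi t = psi t.
Proof.
  intros HF H1 H2 t0 Ht0 E Ht.
  (* Induction on the parameter l of the segment from t0 to t treats both time directions at
     once. *)
  assert (Hin : forall l, 0 <= l <= 1 -> a < t0 + l * (t - t0) < b).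
  { intros l Hl; destruct (Rle_dec t0 t).
    - assert (0 <= l * (t - t0) <= 1 * (t - t0)) by (split; nra); lra.
    - assert (0 <= l * (t0 - t) <= 1 * (t0 - t)) by (split; nra); lra. }
  assert (Hnear : forall s, a < s < b -> sol_near F phi s /\ sol_near F psi s).
  { intros s Hs.
    assert (Hm : 0 < Rmin (s - a) (b - s)) by (apply Rmin_pos; lra).
    split; exists (Rmin (s - a) (b - s)); split; auto; intros r Hr;
      apply Rabs_def2 in Hr; pose proof (Rmin_l (s - a) (b - s)); pose proof (Rmin_r (s - a) (b - s));
      [apply H1|apply H2]; lra. }
  replace t with (t0 + 1 * (t - t0)) by ring.
  apply (real_induction (fun l => phi (t0 + l * (t - t0)) = psi (t0 + l * (t - t0))) 0 1); try lra.
  - replace (t0 + 0 * (t - t0)) with t0 by ring; auto.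
  - intros l Hl Hs.
    destruct (Hnear (t0 + l * (t - t0))) as [N1 N2]; [apply Hin; lra|].
    destruct (sol_unique_near F phi psi _ HF N1 N2 (Hs l ltac:(lra))) as [d [Hd Heq]].
    exists (d / (Rabs (t - t0) + 1)).
    pose proof (Rabs_pos (t - t0)).
    split; [apply Rdiv_lt_0_compat; lra|]; intros s Hs1 _; apply Heq.
    replace (t0 + s * (t - t0) - (t0 + l * (t - t0))) with ((s - l) * (t - t0)) by ring.
    rewrite Rabs_mult, (Rabs_pos_eq (s - l)) by lra.
    assert (s - l < d / (Rabs (t - t0) + 1)) as Hlt by lra.
    apply Rlt_div_r in Hlt; [|lra]; nra.
  - intros l Hl Hs; apply rcont_eq_limit.
    + eapply cder_rcont, H1, Hin; lra.
    + eapply cder_rcont, H2, Hin; lra.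
    + intros d Hd; pose proof (Rabs_pos (t - t0)).
      set (s := Rmax 0 (l - d / (Rabs (t - t0) + 1) / 2)).
      assert (Hp : 0 < d / (Rabs (t - t0) + 1)) by (apply Rdiv_lt_0_compat; lra).
      assert (Hs1 : 0 <= s < l) by (unfold s, Rmax; destruct (Rle_dec 0 _); lra).
      assert (Hs2 : l - s < d / (Rabs (t - t0) + 1)) by (unfold s, Rmax; destruct (Rle_dec 0 _); lra).
      exists (t0 + s * (t - t0)); split; [|apply Hs; lra].
      replace (t0 + s * (t - t0) - (t0 + l * (t - t0))) with (- ((l - s) * (t - t0))) by ring.
      rewrite Rabs_Ropp, Rabs_mult, (Rabs_pos_eq (l - s)) by lra.
      apply Rlt_div_r in Hs2; [|lra]; nra.
Qed.

(** * Maximal intervals and the group law *)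

Lemma interval_nbhd (a b t : R) : a < t < b ->
  exists d, 0 < d /\ forall s, Rabs (s - t) < d -> a < s < b.
Proof.
  intros Ht; exists (Rmin (t - a) (b - t)); split; [apply Rmin_pos; lra|].
  intros s Hs; apply Rabs_def2 in Hs.
  pose proof (Rmin_l (t - a) (b - t)); pose proof (Rmin_r (t - a) (b - t)); lra.
Qed.

Lemma is_solution_cder F J x phi : is_solution F J x phi <->
  phi 0 = x /\ forall t, J t -> cder phi t (F (phi t)).
Proof.
  unfold is_solution; split; intros [H1 H2]; split; auto; intros t Ht;
    apply is_derive_cder; auto.
Qed.

Lemma max_interval_sol F x t : max_interval F x t -> exists a b phi,
  a < 0 < b /\ a < t < b /\ phi 0 = x /\ forall s, a < s < b -> cder phi s (F (phi s)).
Proof.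
  intros (a & b & phi & H0 & Ht & H); apply is_solution_cder in H; exists a, b, phi; tauto.
Qed.

Lemma max_interval_intro F x t a b phi : a < 0 < b -> a < t < b -> phi 0 = x ->
  (forall s, a < s < b -> cder phi s (F (phi s))) -> max_interval F x t.
Proof.
  intros H0 Ht E D; exists a, b, phi; split; [auto|split; [auto|]].
  apply is_solution_cder; auto.
Qed.

Lemma max_interval_conv F x t1 t2 s : max_interval F x t1 -> max_interval F x t2 ->
  t1 <= s <= t2 -> max_interval F x s.
Proof.
  intros H1 H2 Hs.
  destruct (max_interval_sol _ _ _ H1) as (a1 & b1 & p1 & A1 & B1 & C1 & D1).
  destruct (max_interval_sol _ _ _ H2) as (a2 & b2 & p2 & A2 & B2 & C2 & D2).
  destruct (Rle_dec s 0).
  - apply (max_interval_intro F x s a1 b1 p1); auto; lra.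
  - apply (max_interval_intro F x s a2 b2 p2); auto; lra.
Qed.

Lemma max_interval_open F x t : max_interval F x t ->
  exists d, 0 < d /\ forall s, Rabs (s - t) < d -> max_interval F x s.
Proof.
  intros H; destruct (max_interval_sol _ _ _ H) as (a & b & p & A & B & C & D).
  destruct (interval_nbhd a b t B) as [d [Hd H']]; exists d; split; auto.
  intros s Hs; apply (max_interval_intro F x s a b p); auto.
Qed.

Lemma max_interval_has_0 F x t : max_interval F x t -> max_interval F x 0.
Proof.
  intros H; destruct (max_interval_sol _ _ _ H) as (a & b & p & A & B & C & D).
  apply (max_interval_intro F x 0 a b p); auto.
Qed.

Lemma sol_unique_2 F (phi psi : R -> C) (x : C) (a b a' b' t : R) : entire F ->
  a < 0 < b -> a' < 0 < b' -> phi 0 = x -> psi 0 = x ->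
  (forall s, a < s < b -> cder phi s (F (phi s))) ->
  (forall s, a' < s < b' -> cder psi s (F (psi s))) ->
  a < t < b -> a' < t < b' -> phi t = psi t.
Proof.
  intros HF A A' E E' H H' Ht Ht'.
  assert (M : forall s, Rmax a a' < s < Rmin b b' -> a < s < b /\ a' < s < b').
  { intros s Hs; pose proof (Rmax_l a a'); pose proof (Rmax_r a a').
    pose proof (Rmin_l b b'); pose proof (Rmin_r b b'); lra. }
  assert (M' : forall s, a < s < b -> a' < s < b' -> Rmax a a' < s < Rmin b b').
  { intros s h1 h2; split; [apply Rmax_lub_lt; lra|apply Rmin_glb_lt; lra]. }
  apply (sol_unique F phi psi (Rmax a a') (Rmin b b') t HF) with (t0 := 0); auto.
  - intros s Hs; apply H, M; auto.
  - intros s Hs; apply H', M; auto.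
  - congruence.
Qed.

(** [flow] is a choice, so a solution on the whole maximal interval has to be produced: local
    solutions are picked time by time and agree by uniqueness. *)
Lemma flow_is_solution F x : entire F ->
  is_solution F (max_interval F x) x (fun t => flow F t x).
Proof.
  intros HF; unfold flow.
  apply (epsilon_spec (inhabits (fun _ : R => x)) (is_solution F (max_interval F x) x)).
  set (S := fun t phi => exists a b, a < 0 < b /\ a < t < b /\ phi 0 = x /\
     forall s, a < s < b -> cder phi s (F (phi s))).
  set (psi := fun t => epsilon (inhabits (fun _ : R => x)) (S t)).
  assert (HS : forall t, max_interval F x t -> S t (psi t)).
  { intros t Ht; apply (epsilon_spec (inhabits (fun _ : R => x)) (S t)).
    destruct (max_interval_sol _ _ _ Ht) as (a & b & p & H); exists p, a, b; tauto. }
  (* The default [x] yields phi 0 = x even where 0 is not known to lie in the maximal interval. *)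
  set (phi := fun t => if excluded_middle_informative (max_interval F x t) then psi t t else x).
  assert (Hphi : forall t, max_interval F x t -> phi t = psi t t).
  { intros t Ht; unfold phi; destruct (excluded_middle_informative _); tauto. }
  exists phi; apply is_solution_cder; split.
  - unfold phi; destruct (excluded_middle_informative _) as [h|h]; auto.
    destruct (HS 0 h) as (a & b & _ & _ & E & _); exact E.
  - intros t Ht; destruct (HS t Ht) as (a & b & A & B & E & D).
    assert (Heq : forall s, a < s < b -> psi t s = phi s).
    { intros s Hs.
      assert (Hs' : max_interval F x s) by (apply (max_interval_intro F x s a b (psi t)); auto).
      rewrite Hphi by auto; destruct (HS s Hs') as (a' & b' & A' & B' & E' & D').
      apply (sol_unique_2 F (psi t) (psi s) x a b a' b' s); auto. }
    rewrite <- (Heq t B).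
    apply (cder_ext_loc (psi t)); [|auto].
    destruct (interval_nbhd a b t B) as [d [Hd H']]; exists d; split; auto.
Qed.

Lemma flow_0 F x : entire F -> flow F 0 x = x.
Proof. intros HF; apply (flow_is_solution F x HF). Qed.

Lemma flow_cder F x t : entire F -> max_interval F x t ->
  cder (fun s => flow F s x) t (F (flow F t x)).
Proof.
  intros HF Ht; pose proof (flow_is_solution F x HF) as H.
  apply is_solution_cder in H; apply H; auto.
Qed.

Lemma flow_eq F x phi a b t : entire F -> a < 0 < b -> phi 0 = x ->
  (forall s, a < s < b -> cder phi s (F (phi s))) -> a < t < b ->
  max_interval F x t /\ flow F t x = phi t.
Proof.
  intros HF A E D Ht.
  assert (HI : forall s, a < s < b -> max_interval F x s)
    by (intros s Hs; apply (max_interval_intro F x s a b phi); auto).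
  split; auto.
  apply (sol_unique F (fun s => flow F s x) phi a b t HF) with (t0 := 0); auto.
  - intros s Hs; apply flow_cder; auto.
  - rewrite flow_0; auto.
Qed.

Lemma flow_near_sol F x t : entire F -> max_interval F x t ->
  exists a b, a < 0 < b /\ a < t < b /\ forall s, a < s < b -> max_interval F x s.
Proof.
  intros HF Ht; destruct (max_interval_sol _ _ _ Ht) as (a & b & p & A & B & E & D).
  exists a, b; repeat split; try lra; intros s Hs.
  apply (max_interval_intro F x s a b p); auto.
Qed.

(** The group law when the life of the orbit of [x] is known; in [flow_plus] the life of the orbit
    of Phi(s,x) is known instead, and two solutions must be glued. *)
Lemma flow_minus F x s t : entire F -> max_interval F x s -> max_interval F x (s + t) ->
  max_interval F (flow F s x) t /\ flow F t (flow F s x) = flow F (s + t) x.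
Proof.
  intros HF Hs Ht.
  destruct (flow_near_sol F x s HF Hs) as (a1 & b1 & A1 & B1 & I1).
  destruct (flow_near_sol F x (s + t) HF Ht) as (a2 & b2 & A2 & B2 & I2).
  pose proof (Rmin_l a1 a2); pose proof (Rmin_r a1 a2).
  pose proof (Rmax_l b1 b2); pose proof (Rmax_r b1 b2).
  assert (HI : forall r, Rmin a1 a2 < r < Rmax b1 b2 -> max_interval F x r).
  { intros r [Hr1 Hr2]; destruct (Rlt_dec a1 r) as [h1|h1].
    - destruct (Rlt_dec r b1); [apply I1; lra|].
      destruct (Rlt_dec r b2); [apply I2; lra|].
      exfalso; unfold Rmax in Hr2; destruct (Rle_dec b1 b2); lra.
    - destruct (Rlt_dec a2 r); [apply I2; lra|].
      exfalso; unfold Rmin in Hr1; destruct (Rle_dec a1 a2); lra. }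
  destruct (flow_eq F (flow F s x) (fun r => flow F (r + s) x) (Rmin a1 a2 - s) (Rmax b1 b2 - s) t)
    as [h1 h2]; auto; try lra.
  - f_equal; lra.
  - intros r Hr; apply (cder_shift (fun r => flow F r x)), flow_cder; auto; apply HI; lra.
  - split; auto; rewrite h2; f_equal; lra.
Qed.

Lemma flow_plus F x s t : entire F -> max_interval F x s -> max_interval F (flow F s x) t ->
  max_interval F x (s + t) /\ flow F (s + t) x = flow F t (flow F s x).
Proof.
  intros HF Hs Ht.
  destruct (flow_near_sol F x s HF Hs) as (a1 & b1 & A1 & B1 & I1).
  destruct (flow_near_sol F _ t HF Ht) as (a2 & b2 & A2 & B2 & I2).
  set (chi := fun r => if excluded_middle_informative (a1 < r < b1) then flow F r x
              else flow F (r - s) (flow F s x)).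
  assert (E1 : forall r, a1 < r < b1 -> flow F r x = chi r).
  { intros r Hr; unfold chi; destruct (excluded_middle_informative _); tauto. }
  assert (E2 : forall r, a2 + s < r < b2 + s -> flow F (r - s) (flow F s x) = chi r).
  { intros r Hr; unfold chi; destruct (excluded_middle_informative _) as [h|h]; auto.
    destruct (flow_minus F x s (r - s) HF Hs) as [_ e].
    - apply I1; lra.
    - rewrite e; f_equal; lra. }
  pose proof (Rmin_l a1 (a2 + s)); pose proof (Rmin_r a1 (a2 + s)).
  pose proof (Rmax_l b1 (b2 + s)); pose proof (Rmax_r b1 (b2 + s)).
  destruct (flow_eq F x chi (Rmin a1 (a2 + s)) (Rmax b1 (b2 + s)) (s + t)) as [h1 h2]; auto; try lra.
  - rewrite <- E1 by lra; apply flow_0; auto.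
  - intros r [Hr1 Hr2].
    assert (Hc : a1 < r < b1 \/ a2 + s < r < b2 + s).
    { unfold Rmin, Rmax in *; destruct (Rle_dec a1 (a2 + s)); destruct (Rle_dec b1 (b2 + s));
        destruct (Rlt_dec r b1); destruct (Rlt_dec a1 r); lra. }
    destruct Hc as [Hc|Hc].
    + rewrite <- E1 by auto.
      apply (cder_ext_loc (fun r => flow F r x)); [|apply flow_cder; auto].
      destruct (interval_nbhd _ _ _ Hc) as [d [Hd H']]; exists d; split; auto.
    + rewrite <- E2 by auto.
      apply (cder_ext_loc (fun r => flow F (r - s) (flow F s x))).
      * destruct (interval_nbhd _ _ _ Hc) as [d [Hd H']]; exists d; split; auto.
      * apply (cder_shift (fun r => flow F r (flow F s x)) (- s)), flow_cder; auto; apply I2; lra.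
  - split; auto; rewrite h2, <- E2 by lra; f_equal; lra.
Qed.

(** A horizontal line meets the disc in an interval of times; this is the form that [flow_eq]
    takes. *)
Lemma Cmod_plus_real_lt (a : C) (t rho : R) : 0 < rho -> Rabs (Im a) < rho ->
  (Cmod (a + RtoC t) < rho <-> Rabs (Re a + t) < sqrt (rho ^ 2 - Im a ^ 2)).
Proof.
  intros Hr Ha.
  assert (E : Cmod (a + RtoC t) ^ 2 = (Re a + t) ^ 2 + Im a ^ 2).
  { rewrite Cmod_sqr; unfold Re, Im; simpl; ring. }
  rewrite <- (pow2_abs (Re a + t)) in E.
  pose proof (Cmod_ge_0 (a + RtoC t)); pose proof (Rabs_pos (Re a + t)).
  assert (H2 : 0 <= rho ^ 2 - Im a ^ 2) by (rewrite <- (pow2_abs (Im a)); pose proof (Rabs_pos (Im a)); nra).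
  pose proof (sqrt_pos (rho ^ 2 - Im a ^ 2)); pose proof (pow2_sqrt _ H2).
  split; intros Hlt; apply Rnot_le_lt; intros Hle; nra.
Qed.

Lemma chart_flow F z rho L h g (a : C) (t : R) : entire F -> chart F z rho L h g ->
  Cmod a < rho -> Cmod (a + RtoC t) < rho ->
  max_interval F (h a) t /\ flow F t (h a) = h (a + RtoC t)%C.
Proof.
  intros HF Hc Ha Hat.
  pose proof (Rle_lt_trans _ _ _ (Rabs_Im_le a) Ha) as HIm.
  set (q := sqrt (rho ^ 2 - Im a ^ 2)).
  assert (Hin : forall s, Cmod (a + RtoC s) < rho <-> - q - Re a < s < q - Re a).
  { intros s; rewrite (Cmod_plus_real_lt a s rho (ch_pos Hc) HIm); fold q.
    split; intros Hs; [apply Rabs_def2 in Hs; lra|apply Rabs_def1; lra]. }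
  apply (flow_eq F (h a) (fun s => h (a + RtoC s)%C) (- q - Re a) (q - Re a)); auto.
  - apply Hin; rewrite Cplus_0_r; auto.
  - f_equal; ring.
  - intros s Hs; apply (chart_cder_1 F z rho L h g); auto; apply Hin; auto.
  - apply Hin; auto.
Qed.

Arguments chart_flow {F z rho L h g}.

Lemma max_interval_0 F x : entire F -> F x <> 0 -> max_interval F x 0.
Proof.
  intros HF Hx; destruct (chart_exists F x HF Hx) as (rho & L & h & g & Hc).
  rewrite <- (ch_0 Hc).
  apply (chart_flow 0 0 HF Hc); rewrite ?Cplus_0_r, Cmod_0; apply Hc.
Qed.

Lemma flow_nonzero F x t : entire F -> F x <> 0 -> max_interval F x t -> F (flow F t x) <> 0.
Proof.
  intros HF Hx Ht E.
  destruct (flow_near_sol F x t HF Ht) as (a & b & A & B & I).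
  apply Hx.
  assert (E0 : flow F 0 x = flow F t x).
  { apply (sol_unique F (fun s => flow F s x) (fun _ => flow F t x) a b 0 HF) with (t0 := t); auto.
    - intros s Hs; apply flow_cder; auto.
    - intros s Hs; rewrite E; apply cder_const. }
  rewrite flow_0 in E0 by auto; rewrite E0; auto.
Qed.

Lemma period_of_coincidence F a s t : entire F -> max_interval F a s -> max_interval F a t ->
  flow F s a = flow F t a -> s < t -> is_period F a (t - s).
Proof.
  intros HF Hs Ht E Hst.
  assert (I0 : max_interval F a (s + - s)) by (rewrite Rplus_opp_r; eapply max_interval_has_0; eauto).
  destruct (flow_minus F a s (- s) HF Hs I0) as [h1 h2].
  rewrite Rplus_opp_r, flow_0, E in h2 by auto; rewrite E in h1.
  destruct (flow_plus F a t (- s) HF Ht h1) as [h3 h4].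
  split; [lra|split; [exact h3|unfold Rminus; congruence]].
Qed.

(** * The flow in charts *)

Lemma chart_near F z rho L h g (a : C) (e : R) : chart F z rho L h g -> Cmod a < rho -> 0 < e ->
  exists d, 0 < d /\ forall w, Cmod (w - h a) < d ->
    Cmod (g w - a) < e /\ Cmod (g w) < rho /\ h (g w) = w.
Proof.
  intros Hc Ha He.
  destruct (sder_ccont g (h a) _ (ch_gder Hc a Ha) e He) as [d1 [Hd1 H1]].
  destruct (ch_open Hc a Ha) as [d2 [Hd2 H2]].
  rewrite (ch_gh Hc a Ha) in H1.
  exists (Rmin d1 d2); split; [apply Rmin_pos; auto|]; intros w Hw.
  destruct (lt_Rmin _ _ _ Hw) as [w1 w2]; split; auto.
Qed.

Arguments chart_near {F z rho L h g}.

Lemma chart_recentre F z rho L h g (a : C) : chart F z rho L h g -> Cmod a < rho ->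
  chart F (h a) (rho - Cmod a) L (fun b => h (a + b)%C) (fun w => g w - a)%C.
Proof.
  intros Hc Ha.
  assert (Hin : forall b, Cmod b < rho - Cmod a -> Cmod (a + b) < rho)
    by (intros b Hb; pose proof (Cmod_triangle a b); lra).
  constructor.
  - lra.
  - apply Hc.
  - f_equal; ring.
  - intros b Hb; rewrite (ch_gh Hc) by auto; ring.
  - intros b Hb; apply Hc; auto.
  - intros b Hb k Hk; destruct (ch_sder Hc (a + b)%C (Hin b Hb) k Hk) as [d [Hd H]].
    exists d; split; auto; intros u v Hu Hv.
    replace (v - u)%C with ((a + v) - (a + u))%C by ring; apply H.
    + replace (a + u - (a + b))%C with (u - b)%C by ring; auto.
    + replace (a + v - (a + b))%C with (v - b)%C by ring; auto.
  - intros b Hb k Hk; destruct (ch_gder Hc (a + b)%C (Hin b Hb) k Hk) as [d [Hd H]].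
    exists d; split; auto; intros u v Hu Hv.
    replace (g v - a - (g u - a))%C with (g v - g u)%C by ring; apply H; auto.
  - intros b Hb.
    destruct (chart_near (a + b)%C (rho - Cmod a - Cmod b) Hc (Hin b Hb)) as [d [Hd H]]; [lra|].
    exists d; split; auto; intros w Hw; destruct (H w Hw) as (h1 & h2 & h3); split.
    + replace (g w - a)%C with ((g w - (a + b)) + b)%C by ring.
      pose proof (Cmod_triangle (g w - (a + b)) b); lra.
    + replace (a + (g w - a))%C with (g w) by ring; auto.
  - intros b c Hb Hc'; replace (b - c)%C with ((a + b) - (a + c))%C by ring.
    apply (ch_lip Hc); auto.
Qed.

Arguments chart_recentre {F z rho L h g}.

(** Along each ray from 0, g2(h1(a)) - a has derivative zero. This rigidity is what makes time maps
    the identity in charts. *)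
Lemma chart_agree F z r1 L1 h1 g1 r2 L2 h2 g2 :
  chart F z r1 L1 h1 g1 -> chart F z r2 L2 h2 g2 ->
  exists d, 0 < d /\ forall a, Cmod a < d -> h1 a = h2 a.
Proof.
  intros H1 H2.
  assert (C1 : Cmod 0 < r1) by (rewrite Cmod_0; apply H1).
  assert (C2 : Cmod 0 < r2) by (rewrite Cmod_0; apply H2).
  destruct (ch_open H2 0 C2) as [d2 [Hd2 Hop]].
  rewrite (ch_0 H2), <- (ch_0 H1) in Hop.
  destruct (sder_ccont h1 0 _ (ch_sder H1 0 C1) d2 Hd2) as [d1 [Hd1 Hn]].
  exists (Rmin r1 d1); split; [apply Rmin_pos; auto; apply H1|]; intros a Ha.
  destruct (lt_Rmin _ _ _ Ha) as [a1 a2].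
  assert (Hs : forall s, 0 <= s <= 1 -> Cmod (0 + RtoC s * a) < r1 /\ Cmod (0 + RtoC s * a - 0) < d1).
  { intros s Hs; replace (0 + RtoC s * a - 0)%C with (0 + RtoC s * a)%C by ring.
    rewrite Cplus_0_l, Cmod_mult, Cmod_R, Rabs_pos_eq by lra; pose proof (Cmod_ge_0 a); split; nra. }
  assert (E : (g2 (h1 (0 + RtoC 0 * a)%C) - (0 + RtoC 0 * a) =
               g2 (h1 (0 + RtoC 1 * a)%C) - (0 + RtoC 1 * a))%C).
  { apply (cder_zero_const (fun s => g2 (h1 (0 + RtoC s * a)%C) - (0 + RtoC s * a))%C 0 1); [lra|].
    intros s Hs1; destruct (Hs s Hs1) as [s1 s2].
    set (p := (0 + RtoC s * a)%C) in *.
    destruct (Hop (h1 p) (Hn _ s2)) as [k1 k2].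
    assert (Hcd : cder (fun s => g2 (h1 (0 + RtoC s * a)%C) - (0 + RtoC s * a))%C s
                    (/ F (h1 p) * (F (h1 p) * a) - a)%C).
    { apply cder_minus; [|apply cder_affine].
      apply (sder_cder g2 (fun s => h1 (0 + RtoC s * a)%C)).
      - fold p; rewrite <- k2; apply (ch_gder H2); auto.
      - apply (chart_cder F z r1 L1 h1 g1 0 a s); auto. }
    replace (/ F (h1 p) * (F (h1 p) * a) - a)%C with (RtoC 0) in Hcd; auto.
    field; apply (ch_nz H1); auto. }
  destruct (Hs 1) as [s1 s2]; [lra|].
  destruct (Hop _ (Hn _ s2)) as [k1 k2].
  replace (0 + RtoC 0 * a)%C with (RtoC 0) in E by ring.
  replace (0 + RtoC 1 * a)%C with a in * by ring.
  rewrite (ch_0 H1), <- (ch_0 H2), (ch_gh H2) in E by auto.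
  rewrite <- k2; f_equal.
  replace (g2 (h1 a)) with (g2 (h1 a) - a + a)%C by ring; rewrite <- E; ring.
Qed.

Lemma chart_flow_at F x t rho L k g (s : R) : entire F -> max_interval F x t ->
  chart F (flow F t x) rho L k g -> Rabs (s - t) < rho ->
  max_interval F x s /\ flow F s x = k (RtoC (s - t)).
Proof.
  intros HF Ht Hc Hs.
  assert (C0 : Cmod 0 < rho) by (rewrite Cmod_0; apply Hc).
  destruct (chart_flow 0 (s - t) HF Hc C0) as [h1 h2].
  { rewrite Cplus_0_l, Cmod_R; auto. }
  rewrite (ch_0 Hc), Cplus_0_l in *.
  destruct (flow_plus F x t (s - t) HF Ht h1) as [h3 h4].
  replace (t + (s - t)) with s in * by ring; split; auto; congruence.
Qed.

Arguments chart_flow_at {F} x t {rho L k g}.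

(* Near x the time-T map is, in flow charts at x and at Phi(T,x), the identity. *)
Definition flow_box_at F x rho (h : C -> C) (T : R) : Prop :=
  (forall e, 0 < e -> exists d, 0 < d /\ forall a, Cmod a < d -> Cmod a < rho /\
     forall t, 0 <= t <= T -> max_interval F (h a) t /\ Cmod (flow F t (h a) - flow F t x) < e) /\
  (forall rho' L' k g', chart F (flow F T x) rho' L' k g' ->
     exists d, 0 < d /\ forall a, Cmod a < d -> flow F T (h a) = k a).

(** A single chart at Phi(t,x) contains both Phi(t1,x) and Phi(t2,x), and there the flow adds real
    numbers. The base time t is separate because the induction takes t = t1 when it moves on and t =
    t2 when it reaches a limit. *)
Lemma flow_box_step F x rho L h g (t t1 t2 r0 L0 : R) k0 g0 : entire F ->
  chart F x rho L h g -> max_interval F x t ->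
  chart F (flow F t x) r0 L0 k0 g0 -> 0 <= t1 <= t2 ->
  Rabs (t1 - t) < r0 / 4 -> Rabs (t2 - t) < r0 / 4 ->
  flow_box_at F x rho h t1 -> flow_box_at F x rho h t2.
Proof.
  intros HF Hc Ht Hc0 Ht12 H1 H2 [A1 A2].
  assert (Hr0 : 0 < r0) by apply Hc0.
  assert (HL0 : 0 < L0) by apply Hc0.
  destruct (chart_flow_at x t t1 HF Ht Hc0) as [I1 E1]; [lra|].
  destruct (chart_flow_at x t t2 HF Ht Hc0) as [I2 E2]; [lra|].
  assert (c1 : Cmod (RtoC (t1 - t)) < r0) by (rewrite Cmod_R; lra).
  assert (c2 : Cmod (RtoC (t2 - t)) < r0) by (rewrite Cmod_R; lra).
  pose proof (chart_recentre _ Hc0 c1) as R1; rewrite <- E1 in R1.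
  pose proof (chart_recentre _ Hc0 c2) as R2; rewrite <- E2 in R2.
  destruct (A2 _ _ _ _ R1) as [d1 [Hd1 K1]].
  destruct (A1 1 Rlt_0_1) as [d2 [Hd2 K2]].
  set (d3 := Rmin (Rmin d1 d2) (r0 / 4)).
  assert (Hd3 : 0 < d3) by (repeat apply Rmin_pos; lra).
  assert (Hext : forall a, Cmod a < d3 -> forall s, t1 <= s <= t2 ->
     max_interval F (h a) s /\ flow F s (h a) = k0 (RtoC (s - t) + a)%C).
  { intros a Ha s Hs.
    destruct (lt_Rmin _ _ _ Ha) as [a12 a3].
    destruct (lt_Rmin _ _ _ a12) as [a1 a2].
    specialize (K1 a a1); cbv beta in K1.
    destruct (K2 a a2) as [_ K2a]; destruct (K2a t1) as [J _]; [lra|].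
    assert (Hst : Rabs (s - t) < r0 / 4).
    { apply Rabs_def2 in H1; apply Rabs_def2 in H2; apply Rabs_def1; lra. }
    destruct (chart_flow (RtoC (t1 - t) + a)%C (s - t1) HF Hc0) as [h1 h2].
    - eapply Rle_lt_trans; [apply Cmod_triangle|]; rewrite Cmod_R; lra.
    - replace (RtoC (t1 - t) + a + RtoC (s - t1))%C with (RtoC (s - t) + a)%C
        by (rewrite !RtoC_minus; ring).
      eapply Rle_lt_trans; [apply Cmod_triangle|]; rewrite Cmod_R; lra.
    - rewrite <- K1 in h1, h2.
      destruct (flow_plus F (h a) t1 (s - t1) HF J h1) as [h3 h4].
      replace (t1 + (s - t1)) with s in * by ring; split; auto.
      rewrite h4, h2; f_equal; rewrite !RtoC_minus; ring. }
  split.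
  - intros e He; destruct (A1 e He) as [d4 [Hd4 K4]].
    exists (Rmin (Rmin d3 d4) (e / L0)); split.
    { apply Rmin_pos; [apply Rmin_pos; auto|apply Rdiv_lt_0_compat; auto]. }
    intros a Ha.
    destruct (lt_Rmin _ _ _ Ha) as [a34 a5].
    destruct (lt_Rmin _ _ _ a34) as [a3 a4].
    destruct (K4 a a4) as [h1 h2]; split; auto.
    intros s Hs; destruct (Rle_dec s t1); [apply h2; lra|].
    destruct (Hext a a3 s) as [h3 h4]; [lra|]; split; auto.
    assert (Hst : Rabs (s - t) < r0 / 4).
    { apply Rabs_def2 in H1; apply Rabs_def2 in H2; apply Rabs_def1; lra. }
    destruct (chart_flow_at x t s HF Ht Hc0) as [_ E]; [lra|].
    rewrite h4, E.
    assert (a6 : Cmod a < r0 / 4).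
    { eapply Rlt_le_trans; [exact a3|apply Rmin_r]. }
    eapply Rle_lt_trans; [apply (ch_lip Hc0)|].
    + eapply Rle_lt_trans; [apply Cmod_triangle|]; rewrite Cmod_R; lra.
    + rewrite Cmod_R; lra.
    + replace (RtoC (s - t) + a - RtoC (s - t))%C with a by ring.
      apply Rlt_div_r in a5; lra.
  - intros rho' L' k g' Hk.
    destruct (chart_agree F _ _ _ _ _ _ _ _ _ R2 Hk) as [d5 [Hd5 K5]].
    exists (Rmin d3 d5); split; [apply Rmin_pos; auto|]; intros a Ha.
    rewrite <- K5 by (eapply Rlt_le_trans; [exact Ha|apply Rmin_r]).
    apply Hext; [eapply Rlt_le_trans; [exact Ha|apply Rmin_l]|lra].
Qed.

Lemma flow_box F x rho L h g (T : R) : entire F -> chart F x rho L h g ->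
  0 <= T -> max_interval F x T -> flow_box_at F x rho h T.
Proof.
  intros HF Hc HT HI.
  assert (Hx : F x <> 0).
  { rewrite <- (ch_0 Hc); apply (ch_nz Hc); rewrite Cmod_0; apply Hc. }
  pose proof (max_interval_has_0 F x T HI) as I0.
  assert (HIt : forall t, 0 <= t <= T -> max_interval F x t)
    by (intros t Ht; apply (max_interval_conv F x 0 T); auto).
  apply (real_induction (flow_box_at F x rho h) 0 T); auto; try lra.
  - split.
    + intros e He.
      assert (C0 : Cmod 0 < rho) by (rewrite Cmod_0; apply Hc).
      destruct (sder_ccont h 0 _ (ch_sder Hc 0 C0) e He) as [d [Hd H]].
      assert (Hr : 0 < rho) by apply Hc.
      exists (Rmin rho d); split; [apply Rmin_pos; auto|]; intros a Ha.
      assert (a1 : Cmod a < rho) by (eapply Rlt_le_trans; [exact Ha|apply Rmin_l]).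
      split; auto; intros t Ht; replace t with 0 by lra.
      rewrite !flow_0 by auto; split.
      * apply max_interval_0; auto; apply Hc; auto.
      * rewrite <- (ch_0 Hc); apply H.
        replace (a - 0)%C with a by ring; eapply Rlt_le_trans; [exact Ha|apply Rmin_r].
    + intros rho' L' k g' Hk; rewrite flow_0 in Hk by auto.
      destruct (chart_agree F _ _ _ _ _ _ _ _ _ Hc Hk) as [d [Hd H]].
      exists d; split; auto; intros a Ha; rewrite flow_0 by auto; auto.
  - intros t Ht Hs.
    destruct (chart_exists F (flow F t x) HF) as (r0 & L0 & k0 & g0 & Hc0).
    { apply flow_nonzero; auto; apply HIt; lra. }
    assert (Hr0 : 0 < r0) by apply Hc0.
    exists (r0 / 4); split; [lra|]; intros s Hs1 Hs2.
    apply (flow_box_step F x rho L h g t t s r0 L0 k0 g0); auto; try lra.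
    + apply HIt; lra.
    + rewrite Rminus_eq_0, Rabs_R0; lra.
    + apply Rabs_def1; lra.
    + apply Hs; lra.
  - intros t Ht Hs.
    destruct (chart_exists F (flow F t x) HF) as (r0 & L0 & k0 & g0 & Hc0).
    { apply flow_nonzero; auto; apply HIt; lra. }
    assert (Hr0 : 0 < r0) by apply Hc0.
    assert (exists s, 0 <= s < t /\ t - s < r0 / 4) as [s [Hs1 Hs2]].
    { destruct (Rlt_dec t (r0 / 4)); [exists 0; lra|exists (t - r0 / 8); lra]. }
    apply (flow_box_step F x rho L h g t s t r0 L0 k0 g0); auto; try lra.
    + apply HIt; lra.
    + apply Rabs_def1; lra.
    + rewrite Rminus_eq_0, Rabs_R0; lra.
Qed.

Arguments flow_box {F x rho L h g}.

(** Analytic continuation along a segment: the set of l for which the identity holds is open by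
    [flow_box] in recentred charts and closed by continuity. Survival up to time t is required only
    over this segment. *)
Lemma flow_continuation F x r1 L1 h g y r2 L2 k g' (a b c : C) (t : R) : entire F ->
  chart F x r1 L1 h g -> chart F y r2 L2 k g' -> 0 <= t ->
  (forall l, 0 <= l <= 1 -> Cmod (a + RtoC l * c) < r1 /\ Cmod (b + RtoC l * c) < r2 /\
     max_interval F (h (a + RtoC l * c)%C) t) ->
  flow F t (h a) = k b -> flow F t (h (a + c)%C) = k (b + c)%C.
Proof.
  intros HF H1 H2 Ht Hl E.
  replace (a + c)%C with (a + RtoC 1 * c)%C by ring.
  replace (b + c)%C with (b + RtoC 1 * c)%C by ring.
  pose proof (Cmod_ge_0 c) as Hc0.
  apply (real_induction (fun l => flow F t (h (a + RtoC l * c)%C) = k (b + RtoC l * c)%C) 0 1); try lra.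
  - replace (a + RtoC 0 * c)%C with a by ring; replace (b + RtoC 0 * c)%C with b by ring; auto.
  - intros l Hl1 Hs; destruct (Hl l) as (l1 & l2 & l3); [lra|].
    pose proof (chart_recentre _ H1 l1) as R1.
    pose proof (chart_recentre _ H2 l2) as R2.
    rewrite <- (Hs l) in R2 by lra.
    destruct (flow_box t HF R1 Ht l3) as [_ B].
    destruct (B _ _ _ _ R2) as [d [Hd HB]].
    exists (d / (Cmod c + 1)); split; [apply Rdiv_lt_0_compat; lra|]; intros s Hs1 _.
    assert (Hsl : s - l < d / (Cmod c + 1)) by lra.
    apply Rlt_div_r in Hsl; [|lra].
    specialize (HB (RtoC (s - l) * c)%C); cbv beta in HB.
    replace (a + RtoC l * c + RtoC (s - l) * c)%C with (a + RtoC s * c)%C in HB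
      by (rewrite RtoC_minus; ring).
    replace (b + RtoC l * c + RtoC (s - l) * c)%C with (b + RtoC s * c)%C in HB
      by (rewrite RtoC_minus; ring).
    apply HB; rewrite Cmod_mult, Cmod_R, Rabs_pos_eq by lra; nra.
  - intros l Hl1 Hs; destruct (Hl l) as (l1 & l2 & l3); [lra|].
    apply (rcont_eq_limit (fun l => flow F t (h (a + RtoC l * c)%C)) (fun l => k (b + RtoC l * c)%C)).
    + pose proof (chart_recentre _ H1 l1) as R1.
      destruct (flow_box t HF R1 Ht l3) as [B _].
      intros e He; destruct (B e He) as [d [Hd HB]].
      exists (d / (Cmod c + 1)); split; [apply Rdiv_lt_0_compat; lra|]; intros s Hs1.
      apply Rlt_div_r in Hs1; [|lra].
      specialize (HB (RtoC (s - l) * c)%C); cbv beta in HB.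
      replace (a + RtoC l * c + RtoC (s - l) * c)%C with (a + RtoC s * c)%C in HB
        by (rewrite RtoC_minus; ring).
      apply HB; [|lra]; rewrite Cmod_mult, Cmod_R; pose proof (Rabs_pos (s - l)); nra.
    + eapply cder_rcont, (chart_cder F y r2 L2 k g'); auto.
    + intros d Hd; exists (Rmax 0 (l - d / 2)).
      unfold Rmax; destruct (Rle_dec 0 (l - d / 2)); (split; [apply Rabs_def1; lra|apply Hs; lra]).
Qed.

(** * Solutions that end in finite time are unbounded *)

Lemma last_time (D : R -> R) (a b m : R) : a <= b ->
  (forall t, a <= t <= b -> forall k, 0 < k -> exists d, 0 < d /\
     forall s, Rabs (s - t) < d -> Rabs (D s - D t) < k) ->
  m <= D a -> D b < m ->
  exists s, a <= s < b /\ D s = m /\ forall r, s < r <= b -> D r < m.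
Proof.
  intros Hab Hc Ha Hb.
  destruct (completeness (fun t => a <= t <= b /\ m <= D t)) as [s [Hs1 Hs2]].
  { exists b; intros t [Ht _]; lra. }
  { exists a; split; auto; lra. }
  assert (Has : a <= s) by (apply Hs1; split; auto; lra).
  assert (Hsb : s <= b) by (apply Hs2; intros t [Ht _]; lra).
  assert (Hafter : forall r, s < r <= b -> D r < m).
  { intros r Hr; apply Rnot_le_lt; intros Hn.
    assert (r <= s) by (apply Hs1; split; auto; lra); lra. }
  assert (Hge : m <= D s).
  { apply Rnot_lt_le; intros Hlt.
    destruct (Hc s (conj Has Hsb) (m - D s)) as [d [Hd Hd']]; [lra|].
    assert (s <= s - d / 2); [|lra].
    apply Hs2; intros t [Ht1 Ht2]; apply Rnot_lt_le; intros Htn.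
    assert (t <= s) by (apply Hs1; auto).
    specialize (Hd' t ltac:(apply Rabs_def1; lra)).
    apply Rabs_def2 in Hd'; lra. }
  assert (Hlt : s < b) by (destruct (Req_dec s b) as [->|]; lra).
  exists s; repeat split; auto; apply Rle_antisym; auto.
  apply Rnot_lt_le; intros Hn.
  destruct (Hc s (conj Has Hsb) (D s - m)) as [d [Hd Hd']]; [lra|].
  assert (exists r, s < r <= b /\ r < s + d) as [r [Hr1 Hr2]].
  { destruct (Rlt_dec (s + d / 2) b); [exists (s + d / 2); lra|exists b; lra]. }
  specialize (Hd' r ltac:(apply Rabs_def1; lra)).
  specialize (Hafter r Hr1); apply Rabs_def2 in Hd'; lra.
Qed.

Lemma rcont_Cmod_sqr (phi : R -> C) (q : C) (t : R) : rcont phi t ->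
  forall k, 0 < k -> exists d, 0 < d /\ forall s, Rabs (s - t) < d ->
    Rabs ((Cmod (phi s - q)) ^ 2 - (Cmod (phi t - q)) ^ 2) < k.
Proof.
  intros H k Hk.
  set (A := Cmod (phi t - q)); assert (HA : 0 <= A) by apply Cmod_ge_0.
  set (e := Rmin 1 (k / (2 * A + 1))).
  assert (He : 0 < e) by (apply Rmin_pos; [lra|apply Rdiv_lt_0_compat; lra]).
  assert (e1 : e <= 1) by apply Rmin_l.
  assert (e2 : e * (2 * A + 1) <= k).
  { apply Rle_trans with (k / (2 * A + 1) * (2 * A + 1)).
    - apply Rmult_le_compat_r; [lra|apply Rmin_r].
    - apply Req_le; field; lra. }
  destruct (H e He) as [d [Hd H']]; exists d; split; auto; intros s Hs; specialize (H' s Hs).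
  set (B := Cmod (phi s - q)); assert (HB : 0 <= B) by apply Cmod_ge_0.
  assert (T1 : B <= Cmod (phi s - phi t) + A) by apply Cmod_triangle_minus.
  assert (T2 : A <= Cmod (phi s - phi t) + B).
  { rewrite (Cmod_minus_sym (phi s) (phi t)); apply Cmod_triangle_minus. }
  clearbody A B e; set (x := Cmod (phi s - phi t)) in *; clearbody x.
  apply Rabs_def1; nra.
Qed.

(** Every point q has a neighbourhood that the orbit avoids shortly before T: near a zero of [F]
    because a zero is not approached in finite time, elsewhere because a chart would prolong the
    solution past T. Compactness makes the time margin uniform on a square. *)
Lemma escape F x T : entire F -> F x <> 0 -> 0 < T ->
  (forall t, 0 <= t < T -> max_interval F x t) -> ~ max_interval F x T ->
  forall B t1, 0 <= t1 < T -> exists t, t1 <= t < T /\ B < Cmod (flow F t x).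
Proof.
  intros HF Hx HT HI Hn B t1 Ht1; apply NNPP; intros Hno.
  assert (HB : forall t, t1 <= t < T -> Cmod (flow F t x) <= B).
  { intros t Ht; apply Rnot_lt_le; intros Hlt; apply Hno; exists t; auto. }
  assert (B0 : 0 <= B) by (eapply Rle_trans; [apply Cmod_ge_0|apply (HB t1); lra]).
  assert (Hloc : forall q, exists d e, 0 < d /\ 0 < e /\
     forall t, T - e < t < T -> 0 <= t -> d <= Cmod (flow F t x - q)).
  { intros q; destruct (Ceq_dec (F q) 0) as [Hq|Hq].
    - destruct (cdiff_Lipschitz F q (entire_cdiff F q HF)) as [K [r [Hr [HK HL]]]].
      (* After the last time at squared distance [m] the orbit stays where [F] is Lipschitz, and
         Gronwall limits how much closer it gets within time T. *)
      set (m := Rmin ((Cmod (x - q)) ^ 2) ((r / 2) ^ 2)).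
      assert (Hm : 0 < m).
      { apply Rmin_pos; apply pow_lt; [apply Cmod_minus_pos; intros E; subst; auto|lra]. }
      pose proof (exp_pos (2 * K * T)) as Hexp.
      assert (Hclaim : forall t, 0 <= t < T -> m <= (Cmod (flow F t x - q)) ^ 2 * exp (2 * K * T)).
      { intros t Ht; apply Rnot_lt_le; intros Hlt.
        assert (Hexp1 : 1 <= exp (2 * K * T)).
        { rewrite <- exp_0; apply Rlt_le, exp_increasing; nra. }
        pose proof (pow2_ge_0 (Cmod (flow F t x - q))) as P2.
        destruct (last_time (fun t => (Cmod (flow F t x - q)) ^ 2) 0 t m) as [s [Hs [Es Hs']]]; try lra.
        - intros u Hu; apply (rcont_Cmod_sqr (fun t => flow F t x)).
          eapply cder_rcont, flow_cder; auto; apply HI; lra.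
        - rewrite flow_0 by auto; apply Rmin_l.
        - nra.
        - destruct (equilibrium_distance F (fun t => flow F t x) q K s t) as [_ G]; auto; try lra.
          + intros u Hu; apply flow_cder; auto; apply HI; lra.
          + intros u Hu; apply HL.
            assert (Hu2 : (Cmod (flow F u x - q)) ^ 2 <= (r / 2) ^ 2).
            { apply Rle_trans with m; [|apply Rmin_r].
              destruct (Req_dec s u) as [<-|]; [lra|apply Rlt_le, Hs'; lra]. }
            pose proof (Cmod_ge_0 (flow F u x - q)); nra.
          + cbv beta in G; rewrite Es in G.
            assert (Hmon : exp (2 * K * (t - s)) <= exp (2 * K * T)).
            { apply Rlt_le, exp_increasing; nra. }
            nra. }
      exists (sqrt (m / exp (2 * K * T))), T.
      assert (Hp : 0 < m / exp (2 * K * T)) by (apply Rdiv_lt_0_compat; auto).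
      split; [apply sqrt_lt_R0; auto|split; auto].
      intros t Ht1' Ht2'; rewrite <- (sqrt_pow2 (Cmod (flow F t x - q))) by apply Cmod_ge_0.
      apply sqrt_le_1_alt.
      apply Rle_div_l; auto; apply Hclaim; lra.
    - destruct (chart_exists F q HF Hq) as (rho & L & h & g & Hc).
      assert (Hrho : 0 < rho) by apply Hc.
      destruct (chart_near 0 (rho / 2) Hc) as [d [Hd Hnear]];
        [rewrite Cmod_0; auto|lra|].
      exists d, (rho / 2); split; auto; split; [lra|]; intros t Ht Ht0.
      apply Rnot_lt_le; intros Hlt.
      rewrite (ch_0 Hc) in Hnear.
      destruct (Hnear _ Hlt) as (n1 & n2 & n3).
      replace (g (flow F t x) - 0)%C with (g (flow F t x)) in n1 by ring.
      destruct (chart_flow (g (flow F t x)) (T - t) HF Hc n2) as [J _].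
      { eapply Rle_lt_trans; [apply Cmod_triangle|]; rewrite Cmod_R, Rabs_pos_eq; lra. }
      rewrite n3 in J.
      apply Hn; replace T with (t + (T - t)) by ring; apply flow_plus; auto; apply HI; lra. }
  destruct (rectangle_compactness (fun e z => forall t, T - e < t < T -> 0 <= t -> flow F t x <> z)
    (Re 0 - B) (Re 0 + B) (Im 0 - B) (Im 0 + B)) as [e [He Hall]]; try lra.
  { intros e e' z He' H t Ht; apply H; lra. }
  { intros q _; destruct (Hloc q) as (d & e & Hd & He & H).
    exists e, d; split; auto; split; auto; intros z Hz t Ht Ht0 E; subst z.
    specialize (H t Ht Ht0); lra. }
  assert (exists t, t1 <= t < T /\ T - e < t) as [t [Ht2 Ht3]].
  { destruct (Rlt_dec t1 (T - e / 2)); [exists (T - e / 2); lra|exists t1; lra]. }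
  apply (Hall (flow F t x)) with t; auto; try lra.
  apply inrect_Cmod; replace (flow F t x - 0)%C with (flow F t x) by ring; auto.
Qed.

(** * Winding numbers *)

Lemma rcont_bounded (f : R -> C) (a b : R) : a <= b ->
  (forall t, a <= t <= b -> rcont f t) ->
  exists M, 0 < M /\ forall t, a <= t <= b -> Cmod (f t) <= M.
Proof.
  intros Hab Hf.
  destruct (continuity_ab_maj (fun t => Cmod (f t)) a b Hab) as [x [Hx _]].
  - intros t Ht e He; destruct (Hf t Ht e He) as [d [Hd H]]; exists d; split; auto.
    intros s [_ Hs]; specialize (H s Hs); simpl; unfold R_dist.
    pose proof (Cmod_triangle_inv (f s) (f t)); pose proof (Cmod_triangle_inv (f t) (f s)) as T.
    rewrite Cmod_minus_sym in T; apply Rabs_def1; lra.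
  - exists (Cmod (f x) + 1); split; [pose proof (Cmod_ge_0 (f x)); lra|].
    intros t Ht; specialize (Hx t Ht); lra.
Qed.

Lemma cder_scal (c : C) (f : R -> C) (t : R) (l : C) :
  cder f t l -> cder (fun s => c * f s)%C t (c * l)%C.
Proof.
  intros H; apply (sder_cder (fun z => (c * z)%C) f); auto.
  intros k Hk; exists 1; split; [lra|]; intros z w _ _.
  match goal with |- Cmod ?x <= _ => replace x with (RtoC 0) by ring end.
  rewrite Cmod_0; pose proof (Cmod_ge_0 (w - z)); nra.
Qed.

Record is_path (c c' : R -> C) (a b : R) : Prop := {
  path_le : a <= b;
  path_cder : forall t, a <= t <= b -> cder c t (c' t);
  path_cont : forall t, a <= t <= b -> rcont c' t
}.

Definition Cauchy (c c' : R -> C) (a b : R) (z : C) : C :=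
  CI (fun t => c' t * / (c t - z))%C a b.

Lemma is_path_sub c c' a b a' b' : is_path c c' a b -> a <= a' -> a' <= b' -> b' <= b ->
  is_path c c' a' b'.
Proof.
  intros H h1 h2 h3; constructor; auto; intros t Ht; apply H; lra.
Qed.

Lemma path_kernel_rcont c c' a b z t : is_path c c' a b -> a <= t <= b -> c t <> z ->
  rcont (fun t => c' t * / (c t - z))%C t.
Proof.
  intros H Ht Hz; apply rcont_mult; [apply H; auto|].
  apply (rcont_inv (fun t => c t - z)%C).
  - apply rcont_minus; [eapply cder_rcont, H; auto|apply rcont_const].
  - intros E; apply Hz, Cmod_eq_minus; rewrite E; apply Cmod_0.
Qed.

Lemma path_kernel_rcont_on c c' a b z : is_path c c' a b ->
  (forall t, a <= t <= b -> c t <> z) ->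
  rcont_on (fun t => c' t * / (c t - z))%C a b.
Proof.
  intros H Hz t Ht; pose proof (path_le _ _ _ _ H).
  rewrite Rmin_left, Rmax_right in Ht by auto.
  eapply path_kernel_rcont; eauto.
Qed.

Lemma path_dist c c' a b z : is_path c c' a b -> (forall t, a <= t <= b -> c t <> z) ->
  exists d, 0 < d /\ forall t, a <= t <= b -> d <= Cmod (c t - z).
Proof.
  intros H Hz.
  assert (Hnz : forall t, a <= t <= b -> (c t - z)%C <> 0).
  { intros t Ht E; apply (Hz t Ht), Cmod_eq_minus; rewrite E; apply Cmod_0. }
  destruct (rcont_bounded (fun t => / (c t - z))%C a b) as [M [HM HB]].
  - apply H.
  - intros t Ht; apply (rcont_inv (fun t => c t - z)%C); auto.
    apply rcont_minus; [eapply cder_rcont, H; auto|apply rcont_const].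
  - exists (/ M); split; [apply Rinv_0_lt_compat; auto|]; intros t Ht; specialize (HB t Ht).
    pose proof (Cmod_gt_0 (c t - z)) as [G _]; specialize (G (Hnz t Ht)).
    rewrite Cmod_inv in HB by auto.
    apply Rmult_le_reg_l with M; auto; rewrite Rinv_r by lra.
    apply Rmult_le_compat_r with (r := Cmod (c t - z)) in HB; [|lra].
    rewrite Rinv_l in HB by lra; auto.
Qed.

(** The derivative in z integrates c'/(c - z)^2, which has the primitive -1/(c - z), so the linear
    term depends only on the endpoints of the path. *)
Lemma Cauchy_quad c c' a b z : is_path c c' a b -> (forall t, a <= t <= b -> c t <> z) ->
  exists K d, 0 < K /\ 0 < d /\ forall w, Cmod (w - z) < d ->
    Cmod (Cauchy c c' a b w - Cauchy c c' a b z
          - (w - z) * (/ (c a - z) - / (c b - z))) <= K * (Cmod (w - z)) ^ 2.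
Proof.
  intros H Hz; pose proof (path_le _ _ _ _ H) as Hab.
  destruct (path_dist c c' a b z H Hz) as [d [Hd Hdist]].
  destruct (rcont_bounded c' a b Hab) as [M [HM HB]]; [apply H|].
  exists (2 * M / (d * d * d) * (b - a) + 1), (d / 2).
  assert (Hd3 : 0 < d * d * d) by (repeat apply Rmult_lt_0_compat; auto).
  assert (HK : 0 <= 2 * M / (d * d * d) * (b - a)).
  { apply Rmult_le_pos; [|lra]; apply Rdiv_le_0_compat; lra. }
  split; [lra|split; [lra|]]; intros w Hw.
  assert (Hdw : forall t, a <= t <= b -> d / 2 <= Cmod (c t - w)).
  { intros t Ht; specialize (Hdist t Ht).
    pose proof (Cmod_triangle_minus (c t) w z); lra. }
  assert (Hz0 : forall t, a <= t <= b -> (c t - z)%C <> 0)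
    by (intros t Ht; apply Cmod_gt_0; specialize (Hdist t Ht); lra).
  assert (Hw0 : forall t, a <= t <= b -> (c t - w)%C <> 0)
    by (intros t Ht; apply Cmod_gt_0; specialize (Hdw t Ht); lra).
  assert (Hwn : forall t, a <= t <= b -> c t <> w).
  { intros t Ht E; apply (Hw0 t Ht); rewrite E; ring. }
  assert (Hmm : forall t, Rmin a b <= t <= Rmax a b -> a <= t <= b).
  { intros t; rewrite Rmin_left, Rmax_right by auto; auto. }
  (* Subtracting this linear part leaves c' (w - z)^2 / ((c - z)^2 (c - w)); with distances at least
     d and d/2 this gives the constant 2 M / d^3. *)
  set (k2 := fun t => ((w - z) * (c' t * / (c t - z) * / (c t - z)))%C).
  assert (Hk2 : rcont_on k2 a b).
  { intros t Ht; apply Hmm in Ht; unfold k2; apply rcont_mult; [apply rcont_const|].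
    apply rcont_mult.
    - eapply path_kernel_rcont; eauto.
    - apply (rcont_inv (fun t => c t - z)%C); auto.
      apply rcont_minus; [eapply cder_rcont, H; auto|apply rcont_const]. }
  assert (E2 : CI k2 a b = ((w - z) * (/ (c a - z) - / (c b - z)))%C).
  { rewrite (CI_primitive (fun t => - (w - z) * / (c t - z))%C k2 a b Hk2); [ring|].
    intros t Ht; apply Hmm in Ht.
    replace (k2 t) with (- (w - z) * (- / ((c t - z) * (c t - z)) * (c' t - 0)))%C
      by (unfold k2; field; auto).
    apply cder_scal, (sder_cder Cinv (fun t => c t - z)%C).
    - apply sder_inv; auto.
    - apply cder_minus; [apply H; auto|apply cder_const]. }
  rewrite <- E2; unfold Cauchy.
  pose proof (path_kernel_rcont_on c c' a b z H Hz) as R1.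
  pose proof (path_kernel_rcont_on c c' a b w H Hwn) as R2.
  rewrite <- CI_minus, <- CI_minus; auto.
  2: { intros t Ht; apply rcont_minus; auto. }
  eapply Rle_trans.
  - apply (CI_bound_le _ a b (2 * M / (d * d * d) * (Cmod (w - z)) ^ 2)); auto.
    + intros t Ht; repeat apply rcont_minus; auto.
    + intros t Ht; unfold k2.
      replace (c' t * / (c t - w) - c' t * / (c t - z) - (w - z) * (c' t * / (c t - z) * / (c t - z)))%C
        with (c' t * ((w - z) * (w - z)) / ((c t - z) * (c t - z) * (c t - w)))%C by (field; auto).
      specialize (HB t Ht); specialize (Hdist t Ht); specialize (Hdw t Ht).
      rewrite Cmod_div by (repeat apply Cmult_neq_0; auto).
      rewrite !Cmod_mult.
      set (x := Cmod (w - z)) in *; assert (0 <= x) by apply Cmod_ge_0.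
      set (p := Cmod (c t - z)) in *; set (q := Cmod (c t - w)) in *.
      assert (Hpq : d * d * (d / 2) <= p * p * q).
      { apply Rmult_le_compat; try nra. }
      assert (Hpq0 : 0 < p * p * q) by nra.
      apply Rle_div_l; auto.
      apply Rle_trans with (M * (x * x)).
      { apply Rmult_le_compat_r; nra. }
      apply Rle_trans with (2 * M / (d * d * d) * x ^ 2 * (d * d * (d / 2))).
      { apply Req_le; field; lra. }
      apply Rmult_le_compat_l; auto.
      apply Rmult_le_pos; [apply Rdiv_le_0_compat; lra|nra].
  - pose proof (pow2_ge_0 (Cmod (w - z))); nra.
Qed.

Lemma Cauchy_cont c c' a b z : is_path c c' a b -> (forall t, a <= t <= b -> c t <> z) ->
  ccont (Cauchy c c' a b) z.
Proof.
  intros H Hz; apply cdiff_ccont; exists (/ (c a - z) - / (c b - z))%C; intros k Hk.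
  destruct (Cauchy_quad c c' a b z H Hz) as (K & d & HK & Hd & HQ).
  exists (Rmin d (k / K)); split; [apply Rmin_pos; auto; apply Rdiv_lt_0_compat; auto|]; intros w Hw.
  destruct (lt_Rmin _ _ _ Hw) as [w1 w2]; apply Rlt_div_r in w2; [|lra].
  specialize (HQ w w1); rewrite (Cmult_comm (w - z)) in HQ.
  pose proof (Cmod_ge_0 (w - z)); nra.
Qed.

Lemma Cauchy_decay c c' a b : is_path c c' a b ->
  exists K B, 0 < K /\ forall z, B < Cmod z ->
    (forall t, a <= t <= b -> c t <> z) /\ Cmod (Cauchy c c' a b z) * (Cmod z - B) <= K.
Proof.
  intros H; pose proof (path_le _ _ _ _ H) as Hab.
  destruct (rcont_bounded c' a b Hab) as [M [HM HB]]; [apply H|].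
  destruct (rcont_bounded c a b Hab) as [B [HB0 HB']].
  { intros t Ht; eapply cder_rcont, H; auto. }
  exists (M * (b - a) + 1), B; split; [nra|]; intros z Hz.
  assert (Hd : forall t, a <= t <= b -> Cmod z - B <= Cmod (c t - z)).
  { intros t Ht; specialize (HB' t Ht); pose proof (Cmod_triangle_inv z (c t)) as T.
    rewrite Cmod_minus_sym in T; lra. }
  assert (Hn : forall t, a <= t <= b -> c t <> z).
  { intros t Ht E; specialize (Hd t Ht); rewrite E in Hd.
    replace (z - z)%C with (RtoC 0) in Hd by ring; rewrite Cmod_0 in Hd; lra. }
  split; auto.
  apply Rle_trans with (M / (Cmod z - B) * (b - a) * (Cmod z - B)).
  - apply Rmult_le_compat_r; [lra|].
    apply CI_bound_le; auto; [apply path_kernel_rcont_on; auto|].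
    intros t Ht; specialize (HB t Ht); specialize (Hd t Ht).
    assert (Hcz : 0 < Cmod (c t - z)) by lra.
    rewrite Cmod_mult, Cmod_inv by (apply Cmod_gt_0; auto).
    apply Rmult_le_compat; auto; [apply Cmod_ge_0|apply Rlt_le, Rinv_0_lt_compat; auto|].
    apply Rinv_le_contravar; lra.
  - apply Rle_trans with (M * (b - a)); [|lra]; apply Req_le; field; lra.
Qed.

(* 2 pi i times the winding number of the loop that follows c1 and returns along c2. *)
Definition winding (c1 c1' : R -> C) (a1 b1 : R) (c2 c2' : R -> C) (a2 b2 : R) (z : C) : C :=
  (Cauchy c1 c1' a1 b1 z - Cauchy c2 c2' a2 b2 z)%C.

(** The two paths have common endpoints, so their linear terms in [Cauchy_quad] cancel. The
    remainder is quadratic, so the derivative along [p] vanishes. *)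
Lemma winding_constant c1 c1' a1 b1 c2 c2' a2 b2 (p : R -> C) (p' : R -> C) (t0 t1 : R) :
  is_path c1 c1' a1 b1 -> is_path c2 c2' a2 b2 -> c1 a1 = c2 a2 -> c1 b1 = c2 b2 ->
  t0 <= t1 ->
  (forall t, t0 <= t <= t1 -> cder p t (p' t)) ->
  (forall t, t0 <= t <= t1 -> forall s, a1 <= s <= b1 -> c1 s <> p t) ->
  (forall t, t0 <= t <= t1 -> forall s, a2 <= s <= b2 -> c2 s <> p t) ->
  winding c1 c1' a1 b1 c2 c2' a2 b2 (p t0) = winding c1 c1' a1 b1 c2 c2' a2 b2 (p t1).
Proof.
  intros H1 H2 Ea Eb Ht01 Hp Hn1 Hn2.
  set (N := winding c1 c1' a1 b1 c2 c2' a2 b2).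
  assert (Hloc : forall t, t0 <= t <= t1 -> forall k, 0 < k -> exists d, 0 < d /\
     forall s, Rabs (s - t) < d -> Cmod (N (p s) - N (p t)) <= k * Rabs (s - t)).
  { intros t Ht k Hk.
    destruct (Cauchy_quad _ _ _ _ _ H1 (Hn1 t Ht)) as (K1 & d1 & HK1 & Hd1 & HQ1).
    destruct (Cauchy_quad _ _ _ _ _ H2 (Hn2 t Ht)) as (K2 & d2 & HK2 & Hd2 & HQ2).
    destruct (cder_Lipschitz p t _ (Hp t Ht)) as [d3 [Hd3 HL]].
    destruct (cder_rcont p t _ (Hp t Ht) (Rmin d1 d2)) as [d4 [Hd4 Hc]]; [apply Rmin_pos; auto|].
    set (l := Cmod (p' t) + 1) in *.
    assert (Hl : 0 < l) by (unfold l; pose proof (Cmod_ge_0 (p' t)); lra).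
    set (K := (K1 + K2) * (l * l)).
    assert (HK : 0 < K) by (unfold K; repeat apply Rmult_lt_0_compat; lra).
    exists (Rmin (Rmin d3 d4) (k / K)); split.
    { apply Rmin_pos; [apply Rmin_pos; auto|apply Rdiv_lt_0_compat; auto]. }
    intros s Hs.
    destruct (lt_Rmin _ _ _ Hs) as [s34 s5].
    destruct (lt_Rmin _ _ _ s34) as [s3 s4].
    specialize (HL s s3); specialize (Hc s s4).
    destruct (lt_Rmin _ _ _ Hc) as [l1 l2]; specialize (HQ1 (p s) l1); specialize (HQ2 (p s) l2).
    rewrite <- Ea, <- Eb in HQ2.
    set (V := ((p s - p t) * (/ (c1 a1 - p t) - / (c1 b1 - p t)))%C) in *.
    unfold N, winding.
    set (A := Cauchy c1 c1' a1 b1 (p s)) in *; set (B := Cauchy c1 c1' a1 b1 (p t)) in *.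
    set (A2 := Cauchy c2 c2' a2 b2 (p s)) in *; set (B2 := Cauchy c2 c2' a2 b2 (p t)) in *.
    replace (A - A2 - (B - B2))%C with ((A - B - V) + - (A2 - B2 - V))%C by ring.
    eapply Rle_trans; [apply Cmod_triangle|]; rewrite Cmod_opp.
    set (x := Cmod (p s - p t)) in *; assert (0 <= x) by apply Cmod_ge_0.
    pose proof (Rabs_pos (s - t)) as Hr; set (r := Rabs (s - t)) in *.
    assert (Hx2 : x ^ 2 <= l * l * r * r) by nra.
    apply Rlt_div_r in s5; [|lra].
    apply Rle_trans with ((K1 + K2) * x ^ 2); [lra|].
    apply Rle_trans with ((K1 + K2) * (l * l * r * r)); [apply Rmult_le_compat_l; lra|].
    replace ((K1 + K2) * (l * l * r * r)) with (K * r * r) by (unfold K; ring).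
    apply Rmult_le_compat_r; lra. }
  symmetry; apply Cmod_eq_minus, Rle_antisym; [|apply Cmod_ge_0].
  apply le_of_forall_eps; intros k Hk.
  assert (Hall : forall t, t0 <= t <= t1 -> Cmod (N (p t) - N (p t0)) <= k / (t1 - t0 + 1) * (t - t0)).
  { set (k' := k / (t1 - t0 + 1)); assert (Hk' : 0 < k') by (apply Rdiv_lt_0_compat; lra).
    apply real_induction; auto.
    - replace (N (p t0) - N (p t0))%C with (RtoC 0) by ring; rewrite Cmod_0; lra.
    - intros t Ht Hs; destruct (Hloc t ltac:(lra) k' Hk') as [d [Hd H]].
      exists d; split; auto; intros s Hs1 Hs2.
      specialize (H s ltac:(apply Rabs_def1; lra)); rewrite Rabs_pos_eq in H by lra.
      specialize (Hs t ltac:(lra)).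
      pose proof (Cmod_triangle_minus (N (p s)) (N (p t)) (N (p t0))); lra.
    - intros t Ht Hs; destruct (Hloc t ltac:(lra) k' Hk') as [d [Hd H]].
      assert (exists s, t0 <= s < t /\ t - s < d) as [s [Hs1 Hs2]].
      { destruct (Rlt_dec t0 (t - d / 2)); [exists (t - d / 2); lra|exists t0; lra]. }
      specialize (H s ltac:(apply Rabs_def1; lra)).
      rewrite Rabs_minus_sym, Rabs_pos_eq in H by lra.
      specialize (Hs s ltac:(lra)).
      pose proof (Cmod_triangle_minus (N (p t)) (N (p s)) (N (p t0))) as T.
      rewrite (Cmod_minus_sym (N (p t)) (N (p s))) in T; lra. }
  specialize (Hall t1 ltac:(lra)).
  eapply Rle_trans; [exact Hall|].
  apply Rmult_le_reg_r with (t1 - t0 + 1); [lra|].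
  replace (k / (t1 - t0 + 1) * (t1 - t0) * (t1 - t0 + 1)) with (k * (t1 - t0)) by (field; lra).
  nra.
Qed.

Lemma winding_decay c1 c1' a1 b1 c2 c2' a2 b2 :
  is_path c1 c1' a1 b1 -> is_path c2 c2' a2 b2 ->
  forall e, 0 < e -> exists B, forall z, B < Cmod z -> Cmod (winding c1 c1' a1 b1 c2 c2' a2 b2 z) < e.
Proof.
  intros H1 H2 e He.
  destruct (Cauchy_decay _ _ _ _ H1) as (K1 & B1 & HK1 & D1).
  destruct (Cauchy_decay _ _ _ _ H2) as (K2 & B2 & HK2 & D2).
  assert (Hone : forall K B x z, 0 < K -> B + 3 * K / e < Cmod z -> 0 <= x ->
     x * (Cmod z - B) <= K -> x < e / 2).
  { intros K B x z HK Hz Hx Hle; apply Rnot_le_lt; intros Hn.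
    assert (HKe : 0 < 3 * K / e) by (apply Rdiv_lt_0_compat; lra).
    assert (e / 2 * (3 * K / e) <= x * (Cmod z - B)) by (apply Rmult_le_compat; lra).
    replace (e / 2 * (3 * K / e)) with (3 / 2 * K) in * by (field; lra); lra. }
  exists (Rmax (B1 + 3 * K1 / e) (B2 + 3 * K2 / e)); intros z Hz.
  assert (z1 : B1 + 3 * K1 / e < Cmod z) by (eapply Rle_lt_trans; [apply Rmax_l|exact Hz]).
  assert (z2 : B2 + 3 * K2 / e < Cmod z) by (eapply Rle_lt_trans; [apply Rmax_r|exact Hz]).
  assert (0 < 3 * K1 / e) by (apply Rdiv_lt_0_compat; lra).
  assert (0 < 3 * K2 / e) by (apply Rdiv_lt_0_compat; lra).
  destruct (D1 z) as [_ E1]; [lra|]; destruct (D2 z) as [_ E2]; [lra|].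
  apply (Hone K1 B1 _ z) in E1; auto; [|apply Cmod_ge_0].
  apply (Hone K2 B2 _ z) in E2; auto; [|apply Cmod_ge_0].
  unfold winding, Cminus; eapply Rle_lt_trans; [apply Cmod_triangle|]; rewrite Cmod_opp; lra.
Qed.

(** * The jump of the Cauchy integral across an arc *)

Lemma prod_near_one (a b : C) : Cmod a <= 1 / 16 -> Cmod b <= 1 / 16 ->
  Cmod ((1 + a) * (1 + b) - 1) <= 9 / 64.
Proof.
  intros Ha Hb; replace ((1 + a) * (1 + b) - 1)%C with (a + b + a * b)%C by ring.
  eapply Rle_trans; [apply Cmod_triangle|]; pose proof (Cmod_triangle a b).
  rewrite Cmod_mult; pose proof (Cmod_ge_0 a); pose proof (Cmod_ge_0 b).
  assert (Cmod a * Cmod b <= 1/16 * (1/16)) by (apply Rmult_le_compat; lra); lra.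
Qed.

Lemma rel_error (f u A : C) (k : R) : f <> 0 -> u <> 0 -> Cmod (A - f * u) <= k * (Cmod f * Cmod u) ->
  exists e, A = (f * u * (1 + e))%C /\ Cmod e <= k.
Proof.
  intros Hf Hu H; exists ((A - f * u) / (f * u))%C.
  assert (0 < Cmod f * Cmod u) by (apply Rmult_lt_0_compat; apply Cmod_gt_0; auto).
  split; [field; auto|].
  rewrite Cmod_div, Cmod_mult by (apply Cmult_neq_0; auto).
  apply Rle_div_l; lra.
Qed.

(** For a straight line with points at height plus and minus eta, the kernel difference is 2 i eta /
    (tau^2 + eta^2). Four relative errors of 1/16 change it by a factor within 1/2 of 1, so half of
    it survives. B - A needs its own bound: subtracting those for A and B would be useless when tau
    is large against eta. *)
Lemma kernel_Im (tau eta : R) (f A B G : C) : 0 < eta -> f <> 0 ->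
  let u := (RtoC tau - Ci * RtoC eta)%C in
  let v := (RtoC tau + Ci * RtoC eta)%C in
  let w := (2 * (Ci * RtoC eta))%C in
  Cmod (A - f * u) <= 1 / 16 * (Cmod f * Cmod u) ->
  Cmod (B - f * v) <= 1 / 16 * (Cmod f * Cmod v) ->
  Cmod (B - A - f * w) <= 1 / 16 * (Cmod f * Cmod w) ->
  Cmod (G - f * 1) <= 1 / 16 * (Cmod f * Cmod 1) ->
  A <> 0 /\ B <> 0 /\ eta / (tau ^ 2 + eta ^ 2) <= Im (G * / A - G * / B).
Proof.
  intros He Hf u v w HA HB HD HG.
  assert (Hpos : 0 < tau ^ 2 + eta ^ 2) by nra.
  assert (Huv : (u * v)%C = RtoC (tau ^ 2 + eta ^ 2)).
  { apply injective_projections; unfold u, v; simpl; ring. }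
  assert (Hne : RtoC (tau ^ 2 + eta ^ 2) <> 0) by (intros E; apply RtoC_inj in E; lra).
  assert (Hu : u <> 0) by (intros E; rewrite E in Huv; apply Hne; rewrite <- Huv; ring).
  assert (Hv : v <> 0) by (intros E; rewrite E in Huv; apply Hne; rewrite <- Huv; ring).
  assert (He0 : RtoC eta <> 0) by (intros E; apply RtoC_inj in E; lra).
  assert (Hw : w <> 0).
  { unfold w; repeat apply Cmult_neq_0; auto; [intros E; apply RtoC_inj in E; lra|apply Ci_nz]. }
  destruct (rel_error f u A _ Hf Hu HA) as [e1 [E1 K1]].
  destruct (rel_error f v B _ Hf Hv HB) as [e2 [E2 K2]].
  destruct (rel_error f w (B - A) _ Hf Hw HD) as [e3 [E3 K3]].
  destruct (rel_error f 1 G _ Hf C1_nz HG) as [e4 [E4 K4]].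
  assert (Hone : forall e, Cmod e <= 1 / 16 -> (1 + e)%C <> 0).
  { intros e Hle E; assert (Ee : e = (- (1))%C).
    { replace e with ((1 + e) - 1)%C by ring; rewrite E; ring. }
    rewrite Ee, Cmod_opp, Cmod_1 in Hle; lra. }
  pose proof (Hone e1 K1) as N1; pose proof (Hone e2 K2) as N2.
  assert (HA0 : A <> 0) by (rewrite E1; repeat apply Cmult_neq_0; auto).
  assert (HB0 : B <> 0) by (rewrite E2; repeat apply Cmult_neq_0; auto).
  split; auto; split; auto.
  set (Y := ((1 + e1) * (1 + e2))%C); set (Z := ((1 + e4) * (1 + e3))%C).
  assert (HY0 : Y <> 0) by (apply Cmult_neq_0; auto).
  assert (HY : Cmod (Y - 1) <= 9 / 64) by (apply prod_near_one; auto).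
  assert (HZ : Cmod (Z - 1) <= 9 / 64) by (apply prod_near_one; auto).
  assert (HYm : 55 / 64 <= Cmod Y).
  { pose proof (Cmod_triangle_inv 1 Y) as T; rewrite Cmod_minus_sym, Cmod_1 in T; lra. }
  assert (HX : Cmod (Z / Y - 1) <= 1 / 2).
  { replace (Z / Y - 1)%C with (((Z - 1) + - (Y - 1)) / Y)%C by (field; auto).
    rewrite Cmod_div by auto.
    apply Rle_div_l; [lra|].
    pose proof (Cmod_triangle (Z - 1) (- (Y - 1))) as T; rewrite Cmod_opp in T; lra. }
  assert (HRe : 1 / 2 <= Re (Z / Y)).
  { pose proof (Rle_trans _ _ _ (Rabs_Re_le (Z / Y - 1)) HX) as T.
    change (Re (Z / Y - 1)) with (Re (Z / Y) - 1) in T.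
    apply Rabs_le_between in T; lra. }
  assert (Ek : (G * / A - G * / B)%C = (Ci * RtoC (2 * eta / (tau ^ 2 + eta ^ 2)) * (Z / Y))%C).
  { replace (G * / A - G * / B)%C with (G * (B - A) / (A * B))%C by (field; auto).
    rewrite E3, E4, E1, E2, RtoC_div by lra.
    rewrite <- Huv; unfold Z, Y, w; rewrite RtoC_mult; field; auto. }
  rewrite Ek.
  set (r := 2 * eta / (tau ^ 2 + eta ^ 2)).
  replace (Im (Ci * RtoC r * (Z / Y))) with (r * Re (Z / Y)).
  2: { destruct (Z / Y)%C as [p q]; unfold Re, Im; simpl; ring. }
  assert (0 < r) by (unfold r; apply Rdiv_lt_0_compat; lra).
  replace (eta / (tau ^ 2 + eta ^ 2)) with (r * (1 / 2)) by (unfold r; field; lra).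
  apply Rmult_le_compat_l; lra.
Qed.

(** The integrand has nonnegative imaginary part, and the central piece of length 2 eta alone
    contributes 1. What matters is that [r1] and the bound 1 do not depend on eta. *)
Lemma Cauchy_local_jump F p rho L h g (a : C) c c' (e0 r : R) : entire F ->
  chart F p rho L h g -> Cmod a < rho -> 0 < r ->
  is_path c c' (e0 - r) (e0 + r) ->
  (forall t, e0 - r <= t <= e0 + r -> c t = h (a + RtoC (t - e0))%C /\ c' t = F (c t)) ->
  exists r1, 0 < r1 <= r /\ forall eta, 0 < eta < r1 ->
    (forall t, e0 - r1 <= t <= e0 + r1 -> c t <> h (a + Ci * RtoC eta)%C /\ c t <> h (a - Ci * RtoC eta)%C) /\
    1 <= Im (Cauchy c c' (e0 - r1) (e0 + r1) (h (a + Ci * RtoC eta)%C)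
           - Cauchy c c' (e0 - r1) (e0 + r1) (h (a - Ci * RtoC eta)%C)).
Proof.
  intros HF Hc Ha Hr Hp Hch.
  set (f := F (h a)); assert (Hf : f <> 0) by (apply (ch_nz Hc); auto).
  assert (Hm : 0 < Cmod f) by (apply Cmod_gt_0; auto).
  destruct (ch_sder Hc a Ha (1 / 16 * Cmod f)) as [d1 [Hd1 H1]]; [lra|].
  destruct (entire_ccont F (h a) HF (1 / 16 * Cmod f)) as [d2 [Hd2 H2]]; [lra|].
  destruct (sder_ccont h a _ (ch_sder Hc a Ha) d2 Hd2) as [d3 [Hd3 H3]].
  set (r1 := Rmin (Rmin (d1 / 2) (d3 / 2)) r).
  assert (Hr1 : 0 < r1) by (repeat apply Rmin_pos; lra).
  assert (Hr1r : r1 <= r) by apply Rmin_r.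
  assert (Hr13 : r1 <= Rmin (d1 / 2) (d3 / 2)) by apply Rmin_l.
  assert (Hr1d1 : r1 < d1) by (pose proof (Rmin_l (d1 / 2) (d3 / 2)); lra).
  assert (Hr1d3 : r1 < d3) by (pose proof (Rmin_r (d1 / 2) (d3 / 2)); lra).
  exists r1; split; [lra|]; intros eta He.
  set (zp := h (a + Ci * RtoC eta)%C); set (zm := h (a - Ci * RtoC eta)%C).
  assert (He' : Cmod (a + Ci * RtoC eta - a) < d1 /\ Cmod (a - Ci * RtoC eta - a) < d1).
  { replace (a + Ci * RtoC eta - a)%C with (Ci * RtoC eta)%C by ring.
    replace (a - Ci * RtoC eta - a)%C with (- (Ci * RtoC eta))%C by ring.
    rewrite Cmod_opp, Cmod_imag, Rabs_pos_eq by lra; lra. }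
  destruct He' as [He1 He2].
  assert (Hker : forall t, e0 - r1 <= t <= e0 + r1 -> (c t - zp)%C <> 0 /\ (c t - zm)%C <> 0 /\
     eta / ((t - e0) ^ 2 + eta ^ 2) <= Im (c' t * / (c t - zp) - c' t * / (c t - zm))).
  { intros t Ht; destruct (Hch t ltac:(lra)) as [E E'].
    assert (Habs : Rabs (t - e0) <= r1) by (apply Rabs_le; lra).
    assert (Ht1 : Cmod (a + RtoC (t - e0) - a) <= r1).
    { replace (a + RtoC (t - e0) - a)%C with (RtoC (t - e0)) by ring; rewrite Cmod_R; auto. }
    apply (kernel_Im (t - e0) eta f); auto; try lra.
    - pose proof (H1 (a + Ci * RtoC eta)%C (a + RtoC (t - e0))%C He1 ltac:(lra)) as K.
      fold f zp in K; rewrite <- E in K.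
      replace (a + RtoC (t - e0) - (a + Ci * RtoC eta))%C with (RtoC (t - e0) - Ci * RtoC eta)%C in K by ring.
      rewrite <- Rmult_assoc; exact K.
    - pose proof (H1 (a - Ci * RtoC eta)%C (a + RtoC (t - e0))%C He2 ltac:(lra)) as K.
      fold f zm in K; rewrite <- E in K.
      replace (a + RtoC (t - e0) - (a - Ci * RtoC eta))%C with (RtoC (t - e0) + Ci * RtoC eta)%C in K by ring.
      rewrite <- Rmult_assoc; exact K.
    - pose proof (H1 (a - Ci * RtoC eta)%C (a + Ci * RtoC eta)%C He2 He1) as K.
      fold f zp zm in K.
      replace (a + Ci * RtoC eta - (a - Ci * RtoC eta))%C with (2 * (Ci * RtoC eta))%C in K by ring.
      replace (c t - zm - (c t - zp))%C with (zp - zm)%C by ring.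
      rewrite <- Rmult_assoc; exact K.
    - rewrite Cmod_1, !Rmult_1_r, Cmult_1_r, E'; apply Rlt_le, H2; rewrite E; apply H3; lra. }
  assert (Hnp : forall t, e0 - r1 <= t <= e0 + r1 -> c t <> zp).
  { intros t Ht E; apply (proj1 (Hker t Ht)); rewrite E; ring. }
  assert (Hnm : forall t, e0 - r1 <= t <= e0 + r1 -> c t <> zm).
  { intros t Ht E; apply (proj1 (proj2 (Hker t Ht))); rewrite E; ring. }
  split; [intros t Ht; split; auto|].
  assert (Hp1 : is_path c c' (e0 - r1) (e0 + r1)) by (apply (is_path_sub _ _ _ _ _ _ Hp); lra).
  pose proof (path_kernel_rcont_on _ _ _ _ _ Hp1 Hnp) as R1.
  pose proof (path_kernel_rcont_on _ _ _ _ _ Hp1 Hnm) as R2.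
  unfold Cauchy; rewrite <- CI_minus by auto.
  set (k := fun t => (c' t * / (c t - zp) - c' t * / (c t - zm))%C) in *.
  assert (Rk : rcont_on k (e0 - r1) (e0 + r1)) by (intros t Ht; apply rcont_minus; auto).
  assert (Mn : Rmin (e0 - r1) (e0 + r1) = e0 - r1) by (apply Rmin_left; lra).
  assert (Mx : Rmax (e0 - r1) (e0 + r1) = e0 + r1) by (apply Rmax_right; lra).
  assert (Rks : forall x y, e0 - r1 <= x <= e0 + r1 -> e0 - r1 <= y <= e0 + r1 -> rcont_on k x y)
    by (intros x y Hx Hy; apply (rcont_on_sub k _ _ _ _ Rk); rewrite Mn, Mx; lra).
  rewrite <- (CI_Chasles k (e0 - r1) (e0 - eta) (e0 + r1)) by (apply Rks; lra).
  rewrite <- (CI_Chasles k (e0 - eta) (e0 + eta) (e0 + r1)) by (apply Rks; lra).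
  assert (Hk0 : forall t, e0 - r1 <= t <= e0 + r1 -> 0 <= Im (k t)).
  { intros t Ht; destruct (Hker t Ht) as (_ & _ & K); eapply Rle_trans; [|exact K].
    pose proof (pow2_ge_0 (t - e0)); apply Rdiv_le_0_compat; [lra|].
    assert (0 < eta ^ 2) by (apply pow_lt; lra); lra. }
  pose proof (CI_Im_ge k (e0 - r1) (e0 - eta) 0 ltac:(lra) (Rks (e0 - r1) (e0 - eta) ltac:(lra) ltac:(lra))
    (fun t Ht => Hk0 t ltac:(lra))) as I1.
  pose proof (CI_Im_ge k (e0 + eta) (e0 + r1) 0 ltac:(lra) (Rks (e0 + eta) (e0 + r1) ltac:(lra) ltac:(lra))
    (fun t Ht => Hk0 t ltac:(lra))) as I3.
  (* For times within eta of [e0] the kernel is at least eta / (2 eta^2). *)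
  assert (I2 : 1 / (2 * eta) * (e0 + eta - (e0 - eta)) <= Im (CI k (e0 - eta) (e0 + eta))).
  { apply CI_Im_ge; [lra|apply Rks; lra|]; intros t Ht.
    destruct (Hker t ltac:(lra)) as (_ & _ & K); eapply Rle_trans; [|exact K].
    replace (1 / (2 * eta)) with (eta / (eta ^ 2 + eta ^ 2)).
    2: { assert (0 < eta * eta) by nra; field; split; lra. }
    apply Rmult_le_compat_l; [lra|]; apply Rinv_le_contravar.
    { pose proof (pow2_ge_0 (t - e0)); assert (0 < eta ^ 2) by (apply pow_lt; lra); lra. }
    assert ((t - e0) ^ 2 <= eta ^ 2) by (apply pow_maj_Rabs, Rabs_le; lra); lra. }
  replace (1 / (2 * eta) * (e0 + eta - (e0 - eta))) with 1 in I2 by (field; lra).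
  set (X := CI k (e0 - r1) (e0 - eta)) in *; set (X2 := CI k (e0 - eta) (e0 + eta)) in *;
  set (X3 := CI k (e0 + eta) (e0 + r1)) in *.
  change (Im (X + (X2 + X3))) with (Im X + (Im X2 + Im X3)); lra.
Qed.

Lemma Cauchy_Chasles c c' a b d z : is_path c c' a d -> a <= b <= d ->
  (forall t, a <= t <= d -> c t <> z) ->
  Cauchy c c' a d z = (Cauchy c c' a b z + Cauchy c c' b d z)%C.
Proof.
  intros H Hb Hz; symmetry; apply CI_Chasles; apply path_kernel_rcont_on.
  - apply (is_path_sub _ _ _ _ _ _ H); lra.
  - intros t Ht; apply Hz; lra.
  - apply (is_path_sub _ _ _ _ _ _ H); lra.
  - intros t Ht; apply Hz; lra.
Qed.

(** The rest of the loop stays away from the crossing point, so its integral [T] is continuous there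
    and varies by less than 1 between the two sides; this cannot cancel a local jump of at least
    1. *)
Lemma winding_jump F p rho L h g (a : C) c1 c1' (a1 b1 : R) c2 c2' (a2 b2 e0 r : R) : entire F ->
  chart F p rho L h g -> Cmod a < rho -> 0 < r ->
  is_path c1 c1' a1 b1 -> is_path c2 c2' a2 b2 -> a1 <= e0 - r -> e0 + r <= b1 ->
  (forall t, e0 - r <= t <= e0 + r -> c1 t = h (a + RtoC (t - e0))%C /\ c1' t = F (c1 t)) ->
  (forall t, a1 <= t <= b1 -> t <> e0 -> c1 t <> h a) ->
  (forall t, a2 <= t <= b2 -> c2 t <> h a) ->
  exists eta0, 0 < eta0 /\ forall eta, 0 < eta < eta0 ->
    winding c1 c1' a1 b1 c2 c2' a2 b2 (h (a + Ci * RtoC eta)%C) <>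
    winding c1 c1' a1 b1 c2 c2' a2 b2 (h (a - Ci * RtoC eta)%C).
Proof.
  intros HF Hc Ha Hr P1 P2 Hl Hu Hch Hn1 Hn2.
  assert (P1m : is_path c1 c1' (e0 - r) (e0 + r)) by (apply (is_path_sub _ _ _ _ _ _ P1); lra).
  destruct (Cauchy_local_jump F p rho L h g a c1 c1' e0 r HF Hc Ha Hr P1m Hch) as [r1 [Hr1 HJ]].
  assert (Pl : is_path c1 c1' a1 (e0 - r1)) by (apply (is_path_sub _ _ _ _ _ _ P1); lra).
  assert (Pr : is_path c1 c1' (e0 + r1) b1) by (apply (is_path_sub _ _ _ _ _ _ P1); lra).
  assert (Nl : forall t, a1 <= t <= e0 - r1 -> c1 t <> h a) by (intros; apply Hn1; lra).
  assert (Nr : forall t, e0 + r1 <= t <= b1 -> c1 t <> h a) by (intros; apply Hn1; lra).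
  set (T := fun z => (Cauchy c2 c2' a2 b2 z - Cauchy c1 c1' a1 (e0 - r1) z
    - Cauchy c1 c1' (e0 + r1) b1 z)%C).
  assert (CT : ccont T (h a)) by (repeat apply ccont_minus; apply Cauchy_cont; auto).
  destruct (CT (1 / 2)) as [d1 [Hd1 HT]]; [lra|].
  destruct (path_dist _ _ _ _ _ Pl Nl) as [d4 [Hd4 D1]].
  destruct (path_dist _ _ _ _ _ Pr Nr) as [d5 [Hd5 D2]].
  set (m := Rmin d1 (Rmin d4 d5)).
  assert (Hm : 0 < m) by (repeat apply Rmin_pos; auto).
  destruct (sder_ccont h a _ (ch_sder Hc a Ha) m Hm) as [d [Hd Hnear]].
  exists (Rmin r1 d); split; [apply Rmin_pos; lra|]; intros eta He.
  pose proof (Rmin_l r1 d); pose proof (Rmin_r r1 d).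
  destruct (HJ eta) as [HJ1 HJ2]; [lra|].
  set (zp := h (a + Ci * RtoC eta)%C) in *; set (zm := h (a - Ci * RtoC eta)%C) in *.
  assert (Hp : Cmod (zp - h a) < m).
  { apply Hnear; replace (a + Ci * RtoC eta - a)%C with (Ci * RtoC eta)%C by ring.
    rewrite Cmod_imag, Rabs_pos_eq; lra. }
  assert (Hm' : Cmod (zm - h a) < m).
  { apply Hnear; replace (a - Ci * RtoC eta - a)%C with (- (Ci * RtoC eta))%C by ring.
    rewrite Cmod_opp, Cmod_imag, Rabs_pos_eq; lra. }
  destruct (le_Rmin m _ _ (Rle_refl m)) as [m1 m45]; apply le_Rmin in m45.
  assert (Hne : forall z, Cmod (z - h a) < m ->
     (forall t, e0 - r1 <= t <= e0 + r1 -> c1 t <> z) -> forall t, a1 <= t <= b1 -> c1 t <> z).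
  { intros z Hz Hloc t Ht E.
    destruct (Rle_dec t (e0 - r1)) as [h1|h1].
    { specialize (D1 t (conj (proj1 Ht) h1)); rewrite E in D1; lra. }
    destruct (Rle_dec (e0 + r1) t) as [h2|h2].
    { specialize (D2 t (conj h2 (proj2 Ht))); rewrite E in D2; lra. }
    apply (Hloc t); auto; lra. }
  assert (Hnp := Hne zp Hp (fun t Ht => proj1 (HJ1 t Ht))).
  assert (Hnm := Hne zm Hm' (fun t Ht => proj2 (HJ1 t Ht))).
  intros E; unfold winding in E.
  rewrite (Cauchy_Chasles c1 c1' a1 (e0 - r1) b1 zp) in E by (auto; lra).
  rewrite (Cauchy_Chasles c1 c1' a1 (e0 - r1) b1 zm) in E by (auto; lra).
  assert (Pmr : is_path c1 c1' (e0 - r1) b1) by (apply (is_path_sub _ _ _ _ _ _ P1); lra).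
  rewrite (Cauchy_Chasles c1 c1' (e0 - r1) (e0 + r1) b1 zp) in E by (auto; try lra; intros; apply Hnp; lra).
  rewrite (Cauchy_Chasles c1 c1' (e0 - r1) (e0 + r1) b1 zm) in E by (auto; try lra; intros; apply Hnm; lra).
  assert (EJ : (Cauchy c1 c1' (e0 - r1) (e0 + r1) zp - Cauchy c1 c1' (e0 - r1) (e0 + r1) zm
                = T zp - T zm)%C).
  { unfold T; match type of E with (?u + (?j + ?v) - ?w = _)%C =>
      transitivity ((u + (j + v) - w) - (u + v - w) - Cauchy c1 c1' (e0 - r1) (e0 + r1) zm)%C; [ring|] end.
    rewrite E; ring. }
  rewrite EJ in HJ2.
  pose proof (Rle_trans _ _ _ (Rle_abs _) (Rabs_Im_le (T zp - T zm))).
  pose proof (Cmod_triangle_minus (T zp) (T (h a)) (T zm)) as TT.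
  rewrite (Cmod_minus_sym (T (h a))) in TT.
  pose proof (HT zp ltac:(lra)); pose proof (HT zm ltac:(lra)); lra.
Qed.

(** * Returns to a transversal section *)

Section Returns.
Context (F : C -> C) (p : C) (rho L : R) (h g : C -> C).
Context (HF : entire F) (Hc : chart F p rho L h g).

(** In the coordinates of [pt], x is time and y is the height on the section. The box with both
    coordinates below [r] in modulus lies inside the disc of the chart. *)
Let r := rho / 4.
Let pt (x y : R) : C := (RtoC x + Ci * RtoC y)%C.
Let sec (v : R) : C := h (pt 0 v).

(** Some crossing at time [t], of either sign or zero, with other crossings allowed in between. *)
Definition returns (v t w : R) : Prop :=
  max_interval F (sec v) t /\ flow F t (sec v) = sec w.

Definition first_return (v s w : R) : Prop :=
  0 < s /\ Rabs w < r /\ returns v s w /\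
  forall t u, 0 < t < s -> Rabs u < r -> ~ returns v t u.

Lemma r_pos : 0 < r.
Proof. unfold r; pose proof (ch_pos Hc); lra. Qed.

Lemma pt_in x y : Rabs x < r -> Rabs y < r -> Cmod (pt x y) < rho.
Proof.
  intros Hx Hy; unfold pt; eapply Rle_lt_trans; [apply Cmod_triangle|].
  rewrite Cmod_R, Cmod_imag; pose proof r_pos; unfold r in *; lra.
Qed.

Lemma pt_inj x y x' y' : Rabs x < r -> Rabs y < r -> Rabs x' < r -> Rabs y' < r ->
  h (pt x y) = h (pt x' y') -> x = x' /\ y = y'.
Proof.
  intros H1 H2 H3 H4 E.
  assert (E' : pt x y = pt x' y').
  { rewrite <- (ch_gh Hc (pt x y)), <- (ch_gh Hc (pt x' y')) by (apply pt_in; auto).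
    rewrite E; auto. }
  unfold pt in E'; inversion E'; lra.
Qed.

Lemma flow_pt x y t : Rabs x < r -> Rabs y < r -> Rabs (x + t) < r ->
  max_interval F (h (pt x y)) t /\ flow F t (h (pt x y)) = h (pt (x + t) y).
Proof.
  intros Hx Hy Ht.
  assert (E : (pt x y + RtoC t)%C = pt (x + t) y) by (unfold pt; rewrite RtoC_plus; ring).
  rewrite <- E; apply (chart_flow _ _ HF Hc); [apply pt_in; auto|].
  rewrite E; apply pt_in; auto.
Qed.

Lemma abs_0_r : Rabs 0 < r.
Proof. rewrite Rabs_R0; apply r_pos. Qed.

Lemma flow_sec v t : Rabs v < r -> Rabs t < r ->
  max_interval F (sec v) t /\ flow F t (sec v) = h (pt t v).
Proof.
  intros Hv Ht; destruct (flow_pt 0 v t) as [h1 h2]; auto; [apply abs_0_r|rewrite Rplus_0_l; auto|].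
  rewrite Rplus_0_l in h2; split; auto.
Qed.

Lemma returns_small v t w : Rabs v < r -> Rabs w < r -> Rabs t < r -> returns v t w -> t = 0 /\ v = w.
Proof.
  intros Hv Hw Ht [_ E]; destruct (flow_sec v t Hv Ht) as [_ E']; rewrite E' in E.
  apply pt_inj in E; auto; apply abs_0_r.
Qed.

Lemma returns_sub v t w s u : returns v t w -> returns v s u -> returns w (s - t) u.
Proof.
  intros [h1 h2] [h3 h4]; replace s with (t + (s - t)) in h3, h4 by ring.
  destruct (flow_minus F (sec v) t (s - t) HF h1 h3) as [h5 h6].
  rewrite h2 in h5, h6; split; auto; congruence.
Qed.

Lemma returns_refl v : Rabs v < r -> returns v 0 v.
Proof. intros Hv; destruct (flow_sec v 0 Hv abs_0_r) as [h1 h2]; split; auto. Qed.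

(** After a crossing the orbit moves horizontally in the box for time r and stays off the section.
    This gap makes induction over crossing times possible. *)
Lemma returns_gap v t w s u : Rabs v < r -> Rabs w < r -> Rabs u < r ->
  returns v t w -> returns v s u -> t < s -> r <= s - t.
Proof.
  intros Hv Hw Hu H1 H2 Hts; apply Rnot_lt_le; intros Hn.
  destruct (returns_small w (s - t) u); auto; [|eapply returns_sub; eauto|lra].
  apply Rabs_def1; lra.
Qed.

(** [flow_continuation] along the section: start and end move by the same amount, so the shift w - v
    is preserved as long as the orbits in between survive up to time t. *)
Lemma returns_shift v t w u : 0 <= t -> returns v t w ->
  (forall l, 0 <= l <= 1 -> Rabs (v + l * u) < r /\ Rabs (w + l * u) < r /\
     max_interval F (sec (v + l * u)) t) ->
  returns (v + u) t (w + u).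
Proof.
  intros Ht [h1 h2] Hl.
  assert (E : forall x l, (pt 0 x + RtoC l * (Ci * RtoC u))%C = pt 0 (x + l * u))
    by (intros; unfold pt; rewrite RtoC_plus, RtoC_mult; ring).
  assert (E1 : forall x, (pt 0 x + Ci * RtoC u)%C = pt 0 (x + u))
    by (intros; unfold pt; rewrite RtoC_plus; ring).
  split.
  - replace (v + u) with (v + 1 * u) by ring; apply Hl; lra.
  - unfold sec; rewrite <- !E1.
    apply (flow_continuation F p rho L h g p rho L h g); auto.
    intros l Hl'; rewrite !E; destruct (Hl l Hl') as (k1 & k2 & k3).
    split; [apply pt_in; auto; apply abs_0_r|split; [apply pt_in; auto; apply abs_0_r|exact k3]].
Qed.

Lemma first_return_exists v t w : Rabs v < r -> Rabs w < r -> 0 < t -> returns v t w ->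
  exists s u, first_return v s u /\ s <= t.
Proof.
  intros Hv Hw Ht H.
  revert w Hw H; apply (gap_induction (fun t => forall w, Rabs w < r -> returns v t w ->
     exists s u, first_return v s u /\ s <= t) r r_pos); auto.
  clear t Ht; intros t Ht IH w Hw H.
  destruct (classic (exists t0 u, 0 < t0 < t /\ Rabs u < r /\ returns v t0 u)) as [(t0 & u & k1 & k2 & k3)|Hno].
  - pose proof (returns_gap v t0 u t w Hv k2 Hw k3 H ltac:(lra)).
    destruct (IH t0 ltac:(lra) u k2 k3) as (s & u' & k4 & k5); exists s, u'; split; auto; lra.
  - exists t, w; split; [|lra]; repeat split; try apply H; try lra; auto.
    intros t0 u k1 k2 k3; apply Hno; exists t0, u; auto.
Qed.

Lemma first_return_unique v s w s' w' : Rabs v < r -> first_return v s w -> first_return v s' w' ->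
  s = s' /\ w = w'.
Proof.
  intros Hv (a1 & a2 & a3 & a4) (b1 & b2 & b3 & b4).
  assert (E : s = s').
  { destruct (Rtotal_order s s') as [E|[E|E]]; auto; exfalso.
    - apply (b4 s w); auto.
    - apply (a4 s' w'); auto. }
  split; auto; subst s'.
  destruct a3 as [_ a3]; destruct b3 as [_ b3]; rewrite a3 in b3.
  apply pt_inj in b3; try tauto; apply abs_0_r.
Qed.

(* The closed curve made of the orbit arc between two consecutive crossings of
   the section and of the piece of the section between them. *)
Section Loop.
Context (v1 s v2 : R) (Hv1 : Rabs v1 < r) (Hfr : first_return v1 s v2) (Hne : v1 <> v2).

Let c1 (t : R) : C := flow F t (sec v1).
Let c1' (t : R) : C := F (c1 t).
Let c2 (t : R) : C := h (pt 0 v1 + RtoC t * (Ci * RtoC (v2 - v1)))%C.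
Let c2' (t : R) : C := (F (c2 t) * (Ci * RtoC (v2 - v1)))%C.
Let N (z : C) : C := winding c1 c1' 0 s c2 c2' 0 1 z.

Lemma loop_v2 : Rabs v2 < r.
Proof. apply Hfr. Qed.

Lemma loop_s : r <= s.
Proof.
  destruct Hfr as (k1 & k2 & k3 & _).
  replace s with (s - 0) by ring.
  apply (returns_gap v1 0 v1 s v2); auto; apply returns_refl; auto.
Qed.

Lemma loop_dom t : 0 <= t <= s -> max_interval F (sec v1) t.
Proof.
  intros Ht; destruct Hfr as (k1 & k2 & [k3 _] & _).
  apply (max_interval_conv F _ 0 s); auto; eapply max_interval_has_0; eauto.
Qed.

Lemma c2_sec t : c2 t = sec (v1 + t * (v2 - v1)).
Proof. unfold c2, sec; f_equal; unfold pt; rewrite RtoC_plus, RtoC_mult; ring. Qed.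

Lemma between t : 0 <= t <= 1 -> Rmin v1 v2 <= v1 + t * (v2 - v1) <= Rmax v1 v2.
Proof.
  intros Ht; unfold Rmin, Rmax; destruct (Rle_dec v1 v2); nra.
Qed.

Lemma between_in y : Rmin v1 v2 <= y <= Rmax v1 v2 -> Rabs y < r.
Proof.
  intros Hy; pose proof loop_v2 as H2; apply Rabs_def2 in H2; pose proof Hv1 as H1; apply Rabs_def2 in H1.
  apply Rabs_def1; unfold Rmin, Rmax in Hy; destruct (Rle_dec v1 v2); lra.
Qed.

Lemma path1 : is_path c1 c1' 0 s.
Proof.
  pose proof loop_s; pose proof r_pos.
  assert (Hd : forall t, 0 <= t <= s -> cder c1 t (c1' t))
    by (intros t Ht; apply flow_cder; auto; apply loop_dom; auto).
  constructor; auto; [lra|].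
  intros t Ht; apply rcont_comp; [apply entire_ccont; auto|eapply cder_rcont, Hd; auto].
Qed.

Lemma path2 : is_path c2 c2' 0 1.
Proof.
  assert (Hin : forall t, 0 <= t <= 1 -> Cmod (pt 0 v1 + RtoC t * (Ci * RtoC (v2 - v1))) < rho).
  { intros t Ht; replace (pt 0 v1 + RtoC t * (Ci * RtoC (v2 - v1)))%C with (pt 0 (v1 + t * (v2 - v1)))
      by (unfold pt; rewrite RtoC_plus, RtoC_mult; ring).
    apply pt_in; [apply abs_0_r|apply between_in, between; auto]. }
  assert (Hd : forall t, 0 <= t <= 1 -> cder c2 t (c2' t))
    by (intros t Ht; apply (chart_cder F p rho L h g); auto).
  constructor; auto; [lra|].
  intros t Ht; apply rcont_mult; [|apply rcont_const].
  apply rcont_comp; [apply entire_ccont; auto|eapply cder_rcont, Hd; auto].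
Qed.

Lemma loop_start : c1 0 = c2 0.
Proof. rewrite c2_sec; unfold c1; rewrite flow_0 by auto; f_equal; ring. Qed.

Lemma loop_end : c1 s = c2 1.
Proof.
  rewrite c2_sec; unfold c1; destruct Hfr as (_ & _ & [_ E] & _); rewrite E; f_equal; ring.
Qed.

(** Moving by time -x leads to the section at time t - x. If this time lies in [0, s], it is 0 or s
    because [s] is the first return; times outside are excluded by following the orbit through the
    box at its two ends. *)
Lemma c1_box t x y : 0 <= t <= s -> Rabs x < r -> Rabs y < r -> c1 t = h (pt x y) ->
  (0 <= x /\ t = x /\ y = v1) \/ (x <= 0 /\ t = s + x /\ y = v2).
Proof.
  intros Ht Hx Hy E; pose proof loop_s as Hs; pose proof loop_v2 as H2.
  pose proof (Rabs_def2 _ _ Hx) as Hx'.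
  destruct (Rlt_dec t x) as [k1|k1].
  - exfalso; destruct (flow_sec v1 t Hv1) as [_ E']; [apply Rabs_def1; lra|].
    unfold c1 in E; rewrite E' in E.
    apply pt_inj in E; auto; [lra|apply Rabs_def1; lra].
  - destruct (Rlt_dec (s + x) t) as [k2|k2].
    + exfalso.
      destruct Hfr as (_ & _ & [F1 F2] & _).
      destruct (flow_sec v2 (t - s) H2) as [I' E']; [apply Rabs_def1; lra|].
      rewrite <- F2 in I', E'.
      destruct (flow_plus F (sec v1) s (t - s) HF F1 I') as [_ E2].
      replace (s + (t - s)) with t in E2 by ring; rewrite E' in E2.
      unfold c1 in E; rewrite E2 in E.
      apply pt_inj in E; auto; [lra|apply Rabs_def1; lra].
    + assert (Hret : returns v1 (t - x) y).
      { assert (I1 : max_interval F (sec v1) t) by (apply loop_dom; auto).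
        assert (I2 : max_interval F (sec v1) (t + - x)) by (apply loop_dom; lra).
        destruct (flow_minus F (sec v1) t (- x) HF I1 I2) as [_ E2].
        unfold c1 in E; rewrite E in E2.
        destruct (flow_pt x y (- x)) as [_ E3]; auto.
        { rewrite Rplus_opp_r; apply abs_0_r. }
        rewrite Rplus_opp_r in E3; split; [exact I2|].
        unfold Rminus; rewrite <- E2, E3; reflexivity. }
      destruct Hfr as (F0 & _ & F1 & F2).
      destruct (Req_dec (t - x) 0) as [e|e].
      * left; rewrite e in Hret; destruct (returns_small v1 0 y); auto; [apply abs_0_r|]; lra.
      * destruct (Req_dec (t - x) s) as [e'|e'].
        -- right; rewrite e' in Hret; destruct Hret as [_ G1]; destruct F1 as [_ G2].
           rewrite G2 in G1; apply pt_inj in G1; auto; try apply abs_0_r; lra.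
        -- exfalso; apply (F2 (t - x) y); auto; lra.
Qed.

Lemma c2_box t x y : 0 <= t <= 1 -> Rabs x < r -> Rabs y < r -> c2 t = h (pt x y) ->
  x = 0 /\ Rmin v1 v2 <= y <= Rmax v1 v2.
Proof.
  intros Ht Hx Hy E; rewrite c2_sec in E; pose proof (between t Ht) as Hb.
  apply pt_inj in E; auto; [|apply abs_0_r|apply between_in; auto].
  destruct E as [<- <-]; auto.
Qed.

Lemma N_const q q' t0 t1 : t0 <= t1 -> (forall t, t0 <= t <= t1 -> cder q t (q' t)) ->
  (forall t, t0 <= t <= t1 -> forall u, 0 <= u <= s -> c1 u <> q t) ->
  (forall t, t0 <= t <= t1 -> forall u, 0 <= u <= 1 -> c2 u <> q t) -> N (q t0) = N (q t1).
Proof.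
  apply winding_constant; [apply path1|apply path2|apply loop_start|apply loop_end].
Qed.

(** The three excluded sets are the whole trace of the loop in the box: the outgoing arc, the
    incoming arc and the piece of section. *)
Lemma N_move x0 y0 x1 y1 : Rabs x0 < r -> Rabs y0 < r -> Rabs x1 < r -> Rabs y1 < r ->
  (forall l, 0 <= l <= 1 -> let x := x0 + l * (x1 - x0) in let y := y0 + l * (y1 - y0) in
     ~ (0 <= x /\ y = v1) /\ ~ (x <= 0 /\ y = v2) /\ ~ (x = 0 /\ Rmin v1 v2 <= y <= Rmax v1 v2)) ->
  N (h (pt x0 y0)) = N (h (pt x1 y1)).
Proof.
  intros H1 H2 H3 H4 Hav.
  set (e := (pt x1 y1 - pt x0 y0)%C).
  assert (E : forall l, (pt x0 y0 + RtoC l * e)%C = pt (x0 + l * (x1 - x0)) (y0 + l * (y1 - y0))).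
  { intros l; unfold e, pt; rewrite !RtoC_plus, !RtoC_mult, !RtoC_minus; ring. }
  assert (Hb : forall a b l, Rabs a < r -> Rabs b < r -> 0 <= l <= 1 -> Rabs (a + l * (b - a)) < r).
  { intros a b l Ha Hb Hl; apply Rabs_def2 in Ha; apply Rabs_def2 in Hb.
    destruct (Rle_dec a b).
    - assert (0 <= l * (b - a) <= 1 * (b - a)) by (split; nra); apply Rabs_def1; lra.
    - assert (0 <= l * (a - b) <= 1 * (a - b)) by (split; nra); apply Rabs_def1; lra. }
  replace (pt x0 y0) with (pt x0 y0 + RtoC 0 * e)%C by ring.
  replace (pt x1 y1) with (pt x0 y0 + RtoC 1 * e)%C by (unfold e; ring).
  apply (N_const (fun l => h (pt x0 y0 + RtoC l * e)%C)
    (fun l => F (h (pt x0 y0 + RtoC l * e)) * e)%C); [lra| | |].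
  - intros l Hl; apply (chart_cder F p rho L h g); auto; rewrite E; apply pt_in; apply Hb; auto.
  - intros l Hl t Ht Eq; rewrite E in Eq.
    destruct (Hav l Hl) as (k1 & k2 & k3).
    apply c1_box in Eq; [|auto|apply Hb; auto|apply Hb; auto]; tauto.
  - intros l Hl t Ht Eq; rewrite E in Eq.
    destruct (Hav l Hl) as (k1 & k2 & k3).
    apply c2_box in Eq; [|auto|apply Hb; auto|apply Hb; auto]; tauto.
Qed.

Lemma half_in : Rabs (r / 2) < r.
Proof. pose proof r_pos; rewrite Rabs_pos_eq; lra. Qed.

Lemma neg_half_in : Rabs (- (r / 2)) < r.
Proof. rewrite Rabs_Ropp; apply half_in. Qed.

(** On the line x = r/2 the loop passes only at height v1. The jump there, known for points close to
    it, spreads vertically to all y and y'. *)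
Lemma sides_differ y y' : Rabs y < r -> Rabs y' < r -> v1 < y -> y' < v1 ->
  N (h (pt (r / 2) y)) <> N (h (pt (r / 2) y')).
Proof.
  intros Hy Hy' H1 H2; pose proof r_pos as Hr; pose proof loop_s as Hs; pose proof half_in as Hh.
  destruct (winding_jump F p rho L h g (pt (r / 2) v1) c1 c1' 0 s c2 c2' 0 1 (r / 2) (r / 4))
    as [eta0 [He0 Hj]]; auto; try lra; try apply path1; try apply path2.
  - apply pt_in; auto.
  - intros t Ht; split; [|reflexivity].
    destruct (flow_sec v1 t Hv1) as [_ E]; [apply Rabs_def1; lra|].
    unfold c1; rewrite E; f_equal; unfold pt; rewrite RtoC_minus; ring.
  - intros t Ht Hne' E; apply c1_box in E; auto; lra.
  - intros t Ht E; apply c2_box in E; auto; lra.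
  - set (eta := Rmin (eta0 / 2) (Rmin (y - v1) (v1 - y'))).
    assert (Heta : 0 < eta) by (repeat apply Rmin_pos; lra).
    assert (h1 : eta <= eta0 / 2) by apply Rmin_l.
    assert (h2 : eta <= Rmin (y - v1) (v1 - y')) by apply Rmin_r.
    assert (h3 : eta <= y - v1) by (pose proof (Rmin_l (y - v1) (v1 - y')); lra).
    assert (h4 : eta <= v1 - y') by (pose proof (Rmin_r (y - v1) (v1 - y')); lra).
    intros E; apply (Hj eta); [lra|].
    fold N.
    replace (pt (r / 2) v1 + Ci * RtoC eta)%C with (pt (r / 2) (v1 + eta))
      by (unfold pt; rewrite RtoC_plus; ring).
    replace (pt (r / 2) v1 - Ci * RtoC eta)%C with (pt (r / 2) (v1 - eta))
      by (unfold pt; rewrite RtoC_minus; ring).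
    apply Rabs_def2 in Hy; apply Rabs_def2 in Hy'.
    transitivity (N (h (pt (r / 2) y))); [|rewrite E; symmetry].
    + apply N_move; auto; try (apply Rabs_def1; lra).
      intros l Hl x0 y0; unfold x0, y0; clear x0 y0.
      assert (0 <= l * (y - (v1 + eta))) by (apply Rmult_le_pos; lra).
      repeat split; intros [k1 k2]; lra.
    + apply N_move; auto; try (apply Rabs_def1; lra).
      intros l Hl x0 y0; unfold x0, y0; clear x0 y0.
      assert (0 <= l * ((v1 - eta) - y')) by (apply Rmult_le_pos; lra).
      repeat split; intros [k1 k2]; lra.
Qed.

(* The section is crossed monotonically (Poincare-Bendixson). *)
Lemma trapped t v3 : Rabs v3 < r -> s < t -> returns v1 t v3 -> 0 < (v2 - v1) * (v3 - v2).
Proof.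
  pose proof loop_v2 as H2; pose proof loop_s as Hs; pose proof r_pos as Hr.
  intros H3 Hst; assert (Ht0 : 0 < t) by lra; revert t Ht0 v3 H3 Hst.
  apply (gap_induction (fun t => forall v3, Rabs v3 < r -> s < t -> returns v1 t v3 ->
     0 < (v2 - v1) * (v3 - v2)) r Hr).
  intros t _ IH v3 H3 Ht Hret.
  pose proof Hfr as (F0 & _ & F1 & F2).
  assert (Hearly : forall t' v', Rabs v' < r -> s < t' < t -> returns v1 t' v' ->
     0 < (v2 - v1) * (v' - v2)).
  { intros t' v' Hv' Ht' Hr'; apply (IH t'); auto; [|lra].
    pose proof (returns_gap v1 t' v' t v3 Hv1 Hv' H3 Hr' Hret ltac:(lra)); lra. }
  assert (Hsq : 0 < (v2 - v1) * (v2 - v1)).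
  { destruct (Rdichotomy _ _ Hne); nra. }
  (* This keeps the later part of the orbit off the arc [c1]: a common point would give a period
     shorter than t. *)
  assert (Hnoper : forall P, 0 < P < t -> ~ returns v1 P v1).
  { intros P HP Hp.
    destruct (Rtotal_order P s) as [k|[k|k]].
    - apply (F2 P v1); auto; lra.
    - subst P; destruct Hp as [_ G1]; destruct F1 as [_ G2]; rewrite G2 in G1.
      apply pt_inj in G1; auto; try apply abs_0_r; lra.
    - pose proof (Hearly P v1 Hv1 ltac:(lra) Hp); nra. }
  apply Rnot_le_lt; intros Hle.
  destruct (Req_dec v3 v2) as [->|Hv32].
  - apply (Hnoper (t - s)); [lra|]; apply (period_of_coincidence F (sec v1) s t); auto.
    + apply F1.
    + apply Hret.
    + destruct F1 as [_ ->]; destruct Hret as [_ ->]; auto.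
  - assert (Hneg : (v2 - v1) * (v3 - v2) < 0).
    { destruct (Rle_lt_or_eq_dec _ _ Hle) as [|e]; auto; exfalso.
      apply Rmult_integral in e; lra. }
    pose proof (returns_gap v1 s v2 t v3 Hv1 H2 H3 F1 Hret ltac:(lra)) as Hgap.
    assert (It : forall u, 0 <= u <= t -> max_interval F (sec v1) u).
    { intros u Hu; apply (max_interval_conv F _ 0 t); auto; [|apply Hret].
      eapply max_interval_has_0, Hret. }
    assert (Ea : flow F (s + r / 2) (sec v1) = h (pt (r / 2) v2)).
    { destruct (flow_sec v2 (r / 2) H2 half_in) as [I' E']; destruct F1 as [G1 G2].
      rewrite <- G2 in I', E'; destruct (flow_plus F (sec v1) s (r / 2) HF G1 I') as [_ E2]; congruence. }
    assert (Eb : flow F (t - r / 2) (sec v1) = h (pt (- (r / 2)) v3)).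
    { destruct (flow_sec v3 (- (r / 2)) H3 neg_half_in) as [I' E']; destruct Hret as [G1 G2].
      rewrite <- G2 in I', E'; destruct (flow_plus F (sec v1) t (- (r / 2)) HF G1 I') as [_ E2].
      unfold Rminus; congruence. }
    (* Between just after s and just before t the orbit meets neither the arc nor the section piece,
       the latter by [Hearly], so N is the same at both ends. *)
    assert (EN : N (h (pt (r / 2) v2)) = N (h (pt (- (r / 2)) v3))).
    { rewrite <- Ea, <- Eb.
      apply (N_const (fun t => flow F t (sec v1))
        (fun t => F (flow F t (sec v1)))); [lra| | |].
      - intros u Hu; apply flow_cder; auto; apply It; lra.
      - intros u Hu u' Hu' E; unfold c1 in E.
        apply (Hnoper (u - u')); [lra|].
        apply (period_of_coincidence F (sec v1) u' u); auto; try (apply It); lra.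
      - intros u Hu u' Hu' E; rewrite c2_sec in E.
        pose proof (between u' Hu') as Hb.
        pose proof (Hearly u _ (between_in _ Hb) ltac:(lra) (conj (It u ltac:(lra)) (eq_sym E))) as Hpos.
        replace (v1 + u' * (v2 - v1) - v2) with (- ((1 - u') * (v2 - v1))) in Hpos by ring.
        assert (0 <= (1 - u') * ((v2 - v1) * (v2 - v1))) by (apply Rmult_le_pos; lra).
        lra. }
    (* At x = -r/2 the loop passes only at height v2, and v3 lies on the same side of v2 as v1. One
       can go vertically from v3 past v1 and then cross x = 0 beyond the section piece, reaching the
       side of v1 opposite to v2. But N had started at (r/2, v2), which contradicts
       [sides_differ]. *)
    assert (HN : forall y', Rabs y' < r ->
       (v2 < v1 /\ v1 < y' \/ v1 < v2 /\ y' < v1) ->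
       N (h (pt (- (r / 2)) v3)) = N (h (pt (r / 2) y'))).
    { intros y' Hy' Hside; pose proof half_in as Hh; pose proof neg_half_in as Hh'.
      assert (Hcase : v2 < v1 /\ v1 < y' /\ v2 < v3 \/ v1 < v2 /\ y' < v1 /\ v3 < v2).
      { destruct Hside as [[k1 k2]|[k1 k2]]; [left|right]; repeat split; auto; nra. }
      assert (Hmm : forall y, Rmin v1 v2 <= y <= Rmax v1 v2 -> (v1 <= y <= v2 \/ v2 <= y <= v1)).
      { intros y; unfold Rmin, Rmax; destruct (Rle_dec v1 v2); lra. }
      transitivity (N (h (pt (- (r / 2)) y'))).
      - apply N_move; auto; intros l Hl x0 y0; unfold x0, y0; clear x0 y0.
        replace (- (r / 2) + l * (- (r / 2) - - (r / 2))) with (- (r / 2)) by ring.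
        repeat split; [intros [k1 k2]; lra| |intros [k1 k2]; lra].
        intros [_ k2].
        assert (Hk : (1 - l) * (v3 - v2) + l * (y' - v2) = 0) by lra.
        destruct Hcase as [(q1 & q2 & q3)|(q1 & q2 & q3)].
        + destruct (Req_dec l 0) as [->|]; [lra|].
          assert (0 < l * (y' - v2)) by (apply Rmult_lt_0_compat; lra).
          assert (0 <= (1 - l) * (v3 - v2)) by (apply Rmult_le_pos; lra); lra.
        + destruct (Req_dec l 0) as [->|]; [lra|].
          assert (0 < l * (v2 - y')) by (apply Rmult_lt_0_compat; lra).
          assert (0 <= (1 - l) * (v2 - v3)) by (apply Rmult_le_pos; lra); lra.
      - apply N_move; auto; intros l Hl x0 y0; unfold x0, y0; clear x0 y0.
        replace (y' + l * (y' - y')) with y' by ring.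
        repeat split; try (intros [k1 k2]; lra).
        intros [_ k2]; apply Hmm in k2; lra. }
    pose proof (Rabs_def2 _ _ Hv1) as Hv1'.
    destruct (Rdichotomy _ _ Hne) as [k|k].
    + assert (Hy : Rabs ((v1 - r) / 2) < r) by (apply Rabs_def1; lra).
      apply (sides_differ v2 ((v1 - r) / 2)); auto; [lra|].
      rewrite EN; apply HN; auto; right; lra.
    + assert (Hy : Rabs ((v1 + r) / 2) < r) by (apply Rabs_def1; lra).
      apply (sides_differ ((v1 + r) / 2) v2); auto; [lra|].
      rewrite EN; symmetry; apply HN; auto; left; lra.
Qed.

(** The orbit from the first bad height v1 + b cannot meet the loop before its end time T <= s, so N
    is constant along it, and by [escape] it reaches points where N is arbitrarily small. The bounds
    r/4 keep all shifted heights in the box. *)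
Lemma blow_up_winding b : b <> 0 -> Rabs v1 < r / 4 -> Rabs v2 < r / 4 -> Rabs b <= r / 4 ->
  (forall l, 0 <= l < 1 -> max_interval F (sec (v1 + l * b)) s) ->
  ~ max_interval F (sec (v1 + b)) s ->
  N (h (pt (r / 2) (v1 + b))) = 0.
Proof.
  intros Hb H1 H2 Hb4 HI Hn; pose proof r_pos as Hr; pose proof loop_s as Hs.
  pose proof Hfr as (F0 & _ & F1 & F2).
  assert (Habs : forall x y, Rabs x < r / 4 -> Rabs y <= r / 4 -> forall l, -1 <= l <= 1 -> Rabs (x + l * y) < r).
  { intros x y Hx Hy l Hl; eapply Rle_lt_trans; [apply Rabs_triang|].
    rewrite Rabs_mult; assert (Rabs l <= 1) by (apply Rabs_le; lra).
    pose proof (Rabs_pos l); pose proof (Rabs_pos y); nra. }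
  set (z := sec (v1 + b)) in *.
  assert (Hvb : Rabs (v1 + b) < r).
  { replace (v1 + b) with (v1 + 1 * b) by ring; apply Habs; auto; lra. }
  assert (Hz : F z <> 0).
  { apply (ch_nz Hc), pt_in; auto; apply abs_0_r. }
  assert (exists T, 0 < T <= s /\ (forall t, 0 <= t < T -> max_interval F z t) /\ ~ max_interval F z T)
    as (T & HT & IT & NT).
  { apply NNPP; intros Hno; apply Hn.
    apply (real_induction (max_interval F z) 0 s); try lra.
    - apply max_interval_0; auto.
    - intros t Ht Hall; destruct (max_interval_open F z t (Hall t ltac:(lra))) as [d [Hd Ho]].
      exists d; split; auto; intros u Hu1 Hu2; apply Ho, Rabs_def1; lra.
    - intros t Ht Hall; apply NNPP; intros Hbad; apply Hno; exists t; auto. }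
  assert (Hx0 : forall t, 0 <= t <= r / 2 -> max_interval F z t /\ flow F t z = h (pt t (v1 + b))).
  { intros t Ht; apply flow_sec; auto; apply Rabs_def1; lra. }
  assert (HTr : r / 2 < T).
  { apply Rnot_le_lt; intros Hle; apply NT, Hx0; lra. }
  (* Such a crossing could be carried back over the heights between v1 + b and v1, where the orbits
     live long enough, and would give [v1] a return before [s]. *)
  assert (Hlow : forall t, 0 < t < T -> forall y, Rabs y < r / 4 -> ~ returns (v1 + b) t y).
  { intros t Ht y Hy Hret.
    apply (F2 t (y + - b)); [lra| |].
    - replace (y + - b) with (y + (-1) * b) by ring; apply Habs; auto; lra.
    - replace v1 with (v1 + b + - b) by ring.
      apply returns_shift; auto; [lra|]; intros l Hl.
      replace (v1 + b + l * - b) with (v1 + (1 - l) * b) by ring.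
      replace (y + l * - b) with (y + (- l) * b) by ring.
      repeat split; [apply Habs; auto; lra|apply Habs; auto; lra|].
      destruct (Req_dec l 0) as [->|Hl0].
      + replace (v1 + (1 - 0) * b) with (v1 + b) by ring; apply IT; lra.
      + assert (I1 : max_interval F (sec (v1 + (1 - l) * b)) s) by (apply HI; lra).
        apply (max_interval_conv F _ 0 s); auto; [eapply max_interval_has_0; eauto|lra]. }
  assert (Hconst : forall t, r / 2 <= t < T -> N (h (pt (r / 2) (v1 + b))) = N (flow F t z)).
  { intros t Ht; rewrite <- (proj2 (Hx0 (r / 2) ltac:(lra))).
    apply (N_const (fun t => flow F t z)
      (fun t => F (flow F t z))); [lra| | |].
    - intros u Hu; apply flow_cder; auto; apply IT; lra.
    (* Running both orbits back by the smaller of the two times puts one of them at its start: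
       either [v1] returns to v1 + b before [s], or v1 + b returns to v1, or both start at the same
       point. *)
    - intros u Hu u' Hu' E; unfold c1 in E.
      assert (Iu : max_interval F z u) by (apply IT; lra).
      assert (Iu' : max_interval F (sec v1) u') by (apply loop_dom; lra).
      destruct (Rle_dec u u') as [k|k].
      + assert (J1 : max_interval F z (u + - u)) by (apply IT; lra).
        assert (J2 : max_interval F (sec v1) (u' + - u)) by (apply loop_dom; lra).
        destruct (flow_minus F z u (- u) HF Iu J1) as [_ E1].
        destruct (flow_minus F (sec v1) u' (- u) HF Iu' J2) as [_ E2].
        rewrite Rplus_opp_r, flow_0 in E1 by auto.
        rewrite E, E1 in E2.
        assert (Hret : returns v1 (u' + - u) (v1 + b)) by (split; auto).
        destruct (Req_dec u u') as [->|].
        * rewrite Rplus_opp_r in Hret; apply returns_small in Hret; auto; [lra|apply abs_0_r].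
        * apply (F2 (u' + - u) (v1 + b)); auto; lra.
      + assert (J1 : max_interval F z (u + - u')) by (apply IT; lra).
        assert (J2 : max_interval F (sec v1) (u' + - u')) by (apply loop_dom; lra).
        destruct (flow_minus F z u (- u') HF Iu J1) as [_ E1].
        destruct (flow_minus F (sec v1) u' (- u') HF Iu' J2) as [_ E2].
        rewrite Rplus_opp_r, flow_0 in E2 by auto.
        rewrite <- E, E2 in E1.
        apply (Hlow (u + - u') ltac:(lra) v1 H1); split; auto.
    - intros u Hu u' Hu' E; rewrite c2_sec in E.
      apply (Hlow u ltac:(lra) (v1 + u' * (v2 - v1))).
      + pose proof (between u' Hu') as Hbt.
        apply Rabs_def2 in H1; apply Rabs_def2 in H2.
        apply Rabs_def1; unfold Rmin, Rmax in Hbt; destruct (Rle_dec v1 v2); lra.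
      + split; [apply IT; lra|auto]. }
  apply Cmod_eq_0, Rle_antisym; [|apply Cmod_ge_0].
  apply le_of_forall_eps; intros k Hk.
  destruct (winding_decay c1 c1' 0 s c2 c2' 0 1 path1 path2 k Hk) as [B HB].
  destruct (escape F z T HF Hz ltac:(lra) IT NT B (r / 2) ltac:(lra)) as [t [Ht1 Ht2]].
  rewrite (Hconst t Ht1); apply Rlt_le, HB; auto.
Qed.

(* Otherwise orbits would blow up on both sides of the loop; but one side is bounded. *)
Lemma one_side_returns : Rabs v1 < r / 4 -> Rabs v2 < r / 4 ->
  (forall u, 0 <= u <= r / 4 -> max_interval F (sec (v1 + u)) s) \/
  (forall u, 0 <= u <= r / 4 -> max_interval F (sec (v1 - u)) s).
Proof.
  intros H1 H2; pose proof r_pos as Hr; pose proof loop_s as Hs.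
  assert (Hside : forall sg, sg = 1 \/ sg = -1 ->
    (exists u, 0 <= u <= r / 4 /\ ~ max_interval F (sec (v1 + sg * u)) s) ->
    exists b, 0 < b <= r / 4 /\ N (h (pt (r / 2) (v1 + sg * b))) = 0).
  { intros sg Hsg (u & Hu & Hbad).
    assert (Hsg1 : Rabs sg = 1) by (destruct Hsg as [->| ->]; [apply Rabs_R1|rewrite Rabs_left; lra]).
    assert (Habs : forall x, 0 <= x <= r / 4 -> Rabs (v1 + sg * x) < r).
    { intros x Hx; eapply Rle_lt_trans; [apply Rabs_triang|].
      rewrite Rabs_mult, Hsg1, (Rabs_pos_eq x); lra. }
    assert (exists b, 0 < b <= u /\ (forall x, 0 <= x < b -> max_interval F (sec (v1 + sg * x)) s) /\
      ~ max_interval F (sec (v1 + sg * b)) s) as (b & Hb & Ib & Nb).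
    { apply NNPP; intros Hno; apply Hbad.
      apply (real_induction (fun x => max_interval F (sec (v1 + sg * x)) s) 0 u); try lra.
      - replace (v1 + sg * 0) with v1 by ring; apply loop_dom; lra.
      (* By [flow_box], survival up to time s is an open condition on the height, so if it fails
         there is a first height at which it fails. *)
      - intros t Ht Hall.
        assert (Hin : Cmod (pt 0 (v1 + sg * t)) < rho) by (apply pt_in; [apply abs_0_r|apply Habs; lra]).
        pose proof (chart_recentre _ Hc Hin) as Rc.
        destruct (flow_box s HF Rc ltac:(lra) (Hall t ltac:(lra))) as [Bx _].
        destruct (Bx 1 Rlt_0_1) as [d [Hd Hd']].
        exists d; split; auto; intros x Hx1 Hx2.
        destruct (Hd' (Ci * RtoC (sg * (x - t)))%C) as [_ Hd''].
        { rewrite Cmod_imag, Rabs_mult, Hsg1, Rabs_pos_eq; lra. }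
        destruct (Hd'' s ltac:(lra)) as [I' _].
        replace (pt 0 (v1 + sg * t) + Ci * RtoC (sg * (x - t)))%C with (pt 0 (v1 + sg * x)) in I'; auto.
        unfold pt; rewrite !RtoC_plus, !RtoC_mult, !RtoC_minus; ring.
      - intros t Ht Hall; apply NNPP; intros Hbd; apply Hno; exists t; auto. }
    exists b; split; [lra|].
    apply blow_up_winding; auto.
    - destruct Hsg as [->| ->]; lra.
    - rewrite Rabs_mult, Hsg1, Rabs_pos_eq; lra.
    - intros l Hl; replace (v1 + l * (sg * b)) with (v1 + sg * (l * b)) by ring.
      apply Ib; split; [apply Rmult_le_pos; lra|nra]. }
  apply NNPP; intros Hno; apply not_or_and in Hno; destruct Hno as [N1 N2].
  apply not_all_ex_not in N1; apply not_all_ex_not in N2.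
  destruct N1 as [u1 N1]; destruct N2 as [u2 N2].
  apply imply_to_and in N1; apply imply_to_and in N2.
  destruct (Hside 1) as (b1 & Hb1 & Z1); [auto|exists u1; rewrite Rmult_1_l; auto|].
  destruct (Hside (-1)) as (b2 & Hb2 & Z2); [auto| |].
  { exists u2; replace (v1 + -1 * u2) with (v1 - u2) by ring; auto. }
  apply Rabs_def2 in H1.
  apply (sides_differ (v1 + 1 * b1) (v1 + -1 * b2)); try (apply Rabs_def1; lra); try lra.
  rewrite Z1, Z2; auto.
Qed.

End Loop.

(** By [trapped], later crossings lie beyond the first one on the same side, so the first shift is
    the smallest. *)
Lemma first_return_shift v t w : Rabs v < r -> Rabs w < r -> 0 < t -> returns v t w -> v <> w ->
  exists s u, first_return v s u /\ u <> v /\ Rabs (u - v) <= Rabs (w - v).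
Proof.
  intros Hv Hw Ht Hret Hne; pose proof r_pos as Hr.
  destruct (first_return_exists v t w Hv Hw Ht Hret) as (s & u & Hfr & Hst).
  exists s, u; split; auto.
  pose proof Hfr as (F0 & Fu & F1 & F2).
  destruct (Req_dec u v) as [->|Huv].
  - exfalso.
    (* If the first return is to [v] itself, subtracting [s] repeatedly reduces any return to one at
       time at most [s], which cannot have height w. *)
    revert Hret; apply (gap_induction (fun t => ~ returns v t w) r Hr); auto.
    clear t Hst Ht; intros t Ht IH H'.
    assert (Hrs : r <= s).
    { replace s with (s - 0) by ring.
      apply (returns_gap v 0 v s v); auto; apply returns_refl; auto. }
    destruct (Rtotal_order t s) as [k|[k|k]].
    + apply (F2 t w); auto; lra.
    + subst t; destruct F1 as [_ G1]; destruct H' as [_ G2]; rewrite G1 in G2.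
      apply pt_inj in G2; auto; try apply abs_0_r; lra.
    + apply (IH (t - s)); [lra|]; eapply returns_sub; eauto.
  - split; auto.
    destruct (Req_dec s t) as [<-|Hst'].
    + destruct F1 as [_ G1]; destruct Hret as [_ G2]; rewrite G1 in G2.
      apply pt_inj in G2; auto; try apply abs_0_r; destruct G2 as [_ ->]; lra.
    + pose proof (trapped v s u Hv Hfr (not_eq_sym Huv) t w Hw ltac:(lra) Hret) as Hpos.
      unfold Rabs; destruct (Rcase_abs (u - v)); destruct (Rcase_abs (w - v)); nra.
Qed.

(** [one_side_returns] does not tell on which side of v the return persists, so there are two test
    heights, r/16 and -r/16; a small shift near 0 is transported unchanged to one of them. *)
Lemma no_small_shift : exists e, 0 < e <= r /\
  forall v t w, Rabs v < e -> Rabs w < e -> 0 < t -> returns v t w -> v = w.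
Proof.
  pose proof r_pos as Hr.
  (* At a fixed height V the first return is unique, so its nonzero shift bounds all nonzero shifts
     at V from below. *)
  assert (Hlev : forall V, Rabs V < r / 2 -> exists d, 0 < d /\
     forall s w, 0 < s -> Rabs (w - V) < d -> Rabs (w - V) < r / 2 -> returns V s w -> w = V).
  { intros V HV.
    assert (HVr : Rabs V < r) by lra.
    assert (Hwr : forall w, Rabs (w - V) < r / 2 -> Rabs w < r).
    { intros w Hw; replace w with ((w - V) + V) by ring.
      eapply Rle_lt_trans; [apply Rabs_triang|]; lra. }
    destruct (classic (exists s u, first_return V s u /\ u <> V)) as [(s0 & u0 & Hfr & Hne)|Hno].
    - exists (Rabs (u0 - V)); split; [apply Rabs_pos_lt; lra|].
      intros s w Hs Hw Hw2 Hret; destruct (Req_dec w V) as [|Hwne]; auto; exfalso.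
      destruct (first_return_shift V s w HVr (Hwr w Hw2) Hs Hret (not_eq_sym Hwne)) as (s' & u' & Hfr' & _ & Hle).
      destruct (first_return_unique V s0 u0 s' u' HVr Hfr Hfr') as [_ <-]; lra.
    - exists 1; split; [lra|].
      intros s w Hs Hw Hw2 Hret; destruct (Req_dec w V) as [|Hwne]; auto; exfalso.
      destruct (first_return_shift V s w HVr (Hwr w Hw2) Hs Hret (not_eq_sym Hwne)) as (s' & u' & Hfr' & Hne' & _).
      apply Hno; exists s', u'; auto. }
  destruct (Hlev (r / 16)) as [d1 [Hd1 L1]]; [rewrite Rabs_pos_eq; lra|].
  destruct (Hlev (- (r / 16))) as [d2 [Hd2 L2]]; [rewrite Rabs_Ropp, Rabs_pos_eq; lra|].
  (* Heights below e differ by less than 2e, hence by less than d1 and d2, and r/64 keeps the move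
     from v to either test height within the range r/4 of [one_side_returns]. *)
  set (e := Rmin (r / 64) (Rmin (d1 / 4) (d2 / 4))).
  assert (He : 0 < e) by (repeat apply Rmin_pos; lra).
  assert (e1 : e <= r / 64) by apply Rmin_l.
  assert (e2 : e <= Rmin (d1 / 4) (d2 / 4)) by apply Rmin_r.
  assert (e3 : e <= d1 / 4) by (pose proof (Rmin_l (d1 / 4) (d2 / 4)); lra).
  assert (e4 : e <= d2 / 4) by (pose proof (Rmin_r (d1 / 4) (d2 / 4)); lra).
  exists e; split; [lra|]; intros v t w Hv Hw Ht Hret.
  destruct (Req_dec v w) as [|Hne]; auto; exfalso.
  destruct (first_return_shift v t w ltac:(lra) ltac:(lra) Ht Hret Hne) as (s & u & Hfr & Huv & Hle).
  pose proof Hfr as (F0 & Fu & F1 & F2).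
  apply Rabs_def2 in Hv; apply Rabs_def2 in Hw.
  assert (Hsh : Rabs (u - v) < 2 * e).
  { eapply Rle_lt_trans; [exact Hle|]; apply Rabs_def1; lra. }
  pose proof (Rabs_def2 _ _ Hsh) as Hsh'.
  destruct (one_side_returns v s u ltac:(apply Rabs_def1; lra) Hfr (not_eq_sym Huv)) as [Hup|Hdown];
    try (apply Rabs_def1; lra).
  - assert (Hr1 : returns (v + (r / 16 - v)) s (u + (r / 16 - v))).
    { apply returns_shift; auto; [lra|]; intros l Hl.
      assert (0 <= l * (r / 16 - v) <= 1 * (r / 16 - v)) by (split; nra).
      repeat split; [apply Rabs_def1; lra|apply Rabs_def1; lra|apply Hup; lra]. }
    replace (v + (r / 16 - v)) with (r / 16) in Hr1 by ring.
    apply Huv; apply (Rplus_eq_reg_r (r / 16 - v)).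
    rewrite (L1 s (u + (r / 16 - v))); auto; try (apply Rabs_def1; lra); ring.
  - assert (Hr1 : returns (v + (- (r / 16) - v)) s (u + (- (r / 16) - v))).
    { apply returns_shift; auto; [lra|]; intros l Hl.
      assert (0 <= l * (v + r / 16) <= 1 * (v + r / 16)) by (split; nra).
      replace (v + l * (- (r / 16) - v)) with (v - l * (v + r / 16)) by ring.
      repeat split; [apply Rabs_def1; lra|apply Rabs_def1; lra|apply Hdown; lra]. }
    replace (v + (- (r / 16) - v)) with (- (r / 16)) in Hr1 by ring.
    apply Huv; apply (Rplus_eq_reg_r (- (r / 16) - v)).
    rewrite (L2 s (u + (- (r / 16) - v))); auto; try (apply Rabs_def1; lra); ring.
Qed.

End Returns.

(** * Transit times *)

Lemma period_lower_bound F a : entire F -> F a <> 0 ->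
  exists d, 0 < d /\ forall T, is_period F a T -> d <= T.
Proof.
  intros HF Ha; destruct (chart_exists F a HF Ha) as (rho & L & h & g & Hc).
  assert (Hr : 0 < rho) by apply Hc.
  exists rho; split; auto; intros T (HT & HI & E); apply Rnot_lt_le; intros Hlt.
  assert (C0 : Cmod 0 < rho) by (rewrite Cmod_0; auto).
  assert (CT : Cmod (0 + RtoC T) < rho) by (rewrite Cplus_0_l, Cmod_R, Rabs_pos_eq; lra).
  destruct (chart_flow 0 T HF Hc C0 CT) as [_ E'].
  rewrite (ch_0 Hc), E in E'; rewrite <- (ch_0 Hc) in E'.
  apply (f_equal g) in E'; rewrite !(ch_gh Hc), Cplus_0_l in E' by auto.
  apply RtoC_inj in E'; lra.
Qed.

Lemma period_sub F a T t : entire F -> is_period F a T -> max_interval F a t ->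
  max_interval F a (t - T) /\ flow F (t - T) a = flow F t a.
Proof.
  intros HF (HT & HI & E) Ht; replace t with (T + (t - T)) in Ht by ring.
  destruct (flow_minus F a T (t - T) HF HI Ht) as [h1 h2]; rewrite E in h1, h2.
  split; auto; rewrite h2; f_equal; ring.
Qed.

Lemma period_add F a T t : entire F -> is_period F a T -> max_interval F a t ->
  max_interval F a (t + T) /\ flow F (t + T) a = flow F t a.
Proof.
  intros HF (HT & HI & E) Ht; rewrite Rplus_comm.
  pose proof Ht as Ht'; rewrite <- E in Ht'.
  destruct (flow_plus F a T t HF HI Ht') as [h1 h2]; rewrite E in h2; auto.
Qed.

(** For periods T1 < T the difference is again a period, hence at least the lower bound d; passing
    to a smaller period thus descends by at least d and must stop. *)
Lemma minimal_period_exists F a T : entire F -> F a <> 0 -> is_period F a T ->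
  exists T0, minimal_period F a T0.
Proof.
  intros HF Ha HT; destruct (period_lower_bound F a HF Ha) as [d [Hd Hlow]].
  apply (gap_induction (fun T => is_period F a T -> exists T0, minimal_period F a T0) d Hd) with T; auto.
  2: apply HT.
  clear T HT; intros T HT IH Hp.
  destruct (classic (exists T1, is_period F a T1 /\ T1 < T)) as [(T1 & Hp1 & Hlt)|Hno].
  - apply (IH T1); auto.
    assert (Hp' : is_period F a (T - T1)).
    { destruct (period_sub F a T1 T HF Hp1) as [h1 h2]; [apply Hp|].
      destruct Hp as (_ & _ & E); split; [lra|split; auto; congruence]. }
    specialize (Hlow _ Hp'); split; [apply Hp1|lra].
  - exists T; split; auto; intros T1 Hp1; apply Rnot_lt_le; intros Hlt; apply Hno; exists T1; auto.
Qed.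

Lemma is_arc_unique F a b s t : entire F -> F a <> 0 -> is_arc F a b s -> is_arc F a b t -> s = t.
Proof.
  intros HF Ha.
  assert (Hlt : forall s t, is_arc F a b s -> is_arc F a b t -> ~ s < t).
  { intros s' t' (A1 & A2 & A3) (B1 & B2 & B3) Hst.
    assert (Hp : is_period F a (t' - s')) by (apply period_of_coincidence; auto; congruence).
    destruct (minimal_period_exists F a _ HF Ha Hp) as [T HT].
    specialize (A3 T HT); specialize (B3 T HT).
    destruct HT as [_ HT]; specialize (HT _ Hp); lra. }
  intros H1 H2; destruct (Rtotal_order s t) as [k|[k|k]]; auto; exfalso;
    [apply (Hlt s t)|apply (Hlt t s)]; auto.
Qed.

Lemma is_arc_exists F a t : entire F -> max_interval F a t ->
  exists s, is_arc F a (flow F t a) s.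
Proof.
  intros HF Ht; destruct (classic (exists T, minimal_period F a T)) as [[T HT]|Hno].
  2: { exists t; split; [auto|split; auto]; intros T HT; exfalso; apply Hno; exists T; auto. }
  pose proof HT as [Hp _]; pose proof Hp as (HT0 & _).
  (* Times are reduced modulo T by repeated subtraction; negative times are first lifted to
     nonnegative ones and then reduced by [Hpos]. *)
  assert (Hred : forall u, 0 < u ->
    (max_interval F a u -> exists s, 0 <= s < T /\ max_interval F a s /\ flow F s a = flow F u a) /\
    (max_interval F a (- u) -> exists s, 0 <= s /\ max_interval F a s /\ flow F s a = flow F (- u) a)).
  { apply (gap_induction _ T HT0); intros u Hu IH; split; intros HI.
    - destruct (Rlt_dec u T); [exists u; split; [lra|auto]|].
      destruct (period_sub F a T u HF Hp HI) as [h1 h2].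
      destruct (Req_dec u T) as [->|Hu1]; [exists 0; rewrite Rminus_eq_0 in *; split; [lra|auto]|].
      destruct (IH (u - T)) as [H _]; [lra|]; rewrite <- h2; auto.
    - destruct (period_add F a T (- u) HF Hp HI) as [h1 h2]; rewrite <- h2.
      destruct (Rle_dec 0 (- u + T)); [exists (- u + T); auto|].
      replace (- u + T) with (- (u - T)) in * by ring.
      destruct (IH (u - T)) as [_ H]; [lra|]; auto. }
  assert (Hpos : forall u, 0 <= u -> max_interval F a u ->
    exists s, 0 <= s < T /\ max_interval F a s /\ flow F s a = flow F u a).
  { intros u Hu HI; destruct (Req_dec u 0) as [->|]; [exists 0; split; [lra|auto]|].
    apply Hred; auto; lra. }
  assert (exists s, 0 <= s < T /\ max_interval F a s /\ flow F s a = flow F t a) as (s & k1 & k2 & k3).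
  { destruct (Rle_dec 0 t); [apply Hpos; auto|].
    destruct (Hred (- t)) as [_ H]; [lra|]; rewrite Ropp_involutive in H.
    destruct (H Ht) as (s1 & l1 & l2 & l3); rewrite <- l3; auto. }
  exists s; split; [auto|split; auto].
  intros T' HT'.
  assert (T <= T') by (apply HT, HT'); lra.
Qed.

(** Arc times are unique, so the choice in [arc_end] is [s], and along the orbit the integrand is
    F/F = 1. *)
Lemma transit_time_arc F a b s : entire F -> F a <> 0 -> is_arc F a b s -> transit_time F a b = s.
Proof.
  intros HF Ha Harc.
  assert (E : arc_end F a b = s).
  { apply (is_arc_unique F a b); auto.
    unfold arc_end; apply (epsilon_spec (inhabits 0) (is_arc F a b)); exists s; auto. }
  unfold transit_time; rewrite E; unfold path_integral, Re at 1; cbn [fst].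
  destruct Harc as (HI & _).
  pose proof (max_interval_has_0 F a s HI) as I0.
  transitivity (RInt (fun _ => 1) 0 s).
  2: { rewrite RInt_const; unfold scal; simpl; unfold mult; simpl; ring. }
  apply RInt_ext; intros t Ht.
  assert (It : max_interval F a t).
  { unfold Rmin, Rmax in Ht; destruct (Rle_dec 0 s).
    - apply (max_interval_conv F a 0 s); auto; lra.
    - apply (max_interval_conv F a s 0); auto; lra. }
  destruct (cder_Re_Im _ _ _ (flow_cder F a t HF It)) as [D1 D2].
  assert (U1 : Derive (fun r : R => Re (flow F r a)) t = Re (F (flow F t a))) by exact (is_derive_unique _ _ _ D1).
  assert (U2 : Derive (fun r : R => Im (flow F r a)) t = Im (F (flow F t a))) by exact (is_derive_unique _ _ _ D2).
  unfold path_derive; rewrite U1, U2.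
  replace (Re (F (flow F t a)), Im (F (flow F t a))) with (F (flow F t a))
    by (unfold Re, Im; rewrite <- surjective_pairing; auto).
  rewrite Cinv_l; [reflexivity|]; apply flow_nonzero; auto.
Qed.

Lemma orbit_points F G a b : entire F -> is_orbit F G -> G a -> G b ->
  exists t, max_interval F a t /\ b = flow F t a.
Proof.
  intros HF [z0 HG] Ha Hb; apply HG in Ha; apply HG in Hb.
  destruct Ha as (t1 & I1 & E1); destruct Hb as (t2 & I2 & E2).
  replace t2 with (t1 + (t2 - t1)) in I2, E2 by ring.
  destruct (flow_minus F z0 t1 (t2 - t1) HF I1 I2) as [h1 h2].
  exists (t2 - t1); subst a b; auto.
Qed.

(** Let z and w be the coordinates of x' in the chart at x and of y' in the chart at y, and let T0 =
    tau(x, y). At time T0 the orbit of x' has coordinate z in the chart at y, so it crosses the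
    section there at height Im z and time T0 - Re z; y' belongs to a crossing at height Im w. Equal
    heights give the transit time T0 - Re z + Re w. *)
Theorem proposition3p4 :
  forall (F : C -> C) (M : C -> Prop) (Gamma : C -> Prop) (x y : C) (eps : R),
    entire F ->
    (exists z : C, F z <> RtoC 0) ->
    is_domain M ->
    flow_invariant F M ->
    is_orbit F Gamma ->
    (forall z : C, Gamma z -> boundary M z /\ F z <> RtoC 0) ->
    Gamma x ->
    Gamma y ->
    0 < transit_time F x y ->
    0 < eps ->
    exists delta : R,
      0 < delta <= eps /\
      (forall z : C, ~ (Cdisc x delta z /\ Cdisc y delta z)) /\
      (forall Lambda : C -> Prop,
        is_orbit F Lambda ->
        (forall z : C, Lambda z -> M z) ->
        (exists z : C, Cdisc x delta z /\ Lambda z) ->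
        (exists z : C, Cdisc y delta z /\ Lambda z) ->
        forall x' y' : C,
          Cdisc x delta x' -> Lambda x' ->
          Cdisc y delta y' -> Lambda y' ->
          Rabs (transit_time F x' y' - transit_time F x y) < eps /\
          (forall t : R, 0 <= t <= transit_time F x y ->
            max_interval F x t /\ max_interval F x' t /\
            Cmod (flow F t x - flow F t x')%C < eps)).
Proof.
  intros F M Gamma x y eps HF _ _ _ HGam HGb Hx Hy Htau Heps.
  assert (Fx : F x <> 0) by (apply HGb; auto).
  assert (Fy : F y <> 0) by (apply HGb; auto).
  destruct (orbit_points F Gamma x y HF HGam Hx Hy) as (t0 & It0 & Ey).
  destruct (is_arc_exists F x t0 HF It0) as [T0 Harc]; rewrite <- Ey in Harc.
  rewrite (transit_time_arc F x y T0) in * by auto.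
  pose proof Harc as (IT0 & ET0 & Hper).
  assert (I0 : max_interval F x 0) by (apply max_interval_0; auto).
  assert (Hxy : x <> y).
  { intros E; assert (H0 : is_arc F x y 0).
    { split; [auto|split; [rewrite flow_0; auto|]]; intros T HT; destruct HT as [[HT _] _]; lra. }
    pose proof (is_arc_unique F x y T0 0 HF Fx Harc H0); lra. }
  destruct (chart_exists F x HF Fx) as (r1 & L1 & h1 & g1 & C1).
  destruct (chart_exists F y HF Fy) as (r2 & L2 & h2 & g2 & C2).
  assert (R1 : 0 < r1) by apply C1; assert (R2 : 0 < r2) by apply C2.
  destruct (no_small_shift F y r2 L2 h2 g2 HF C2) as (e1 & [He1 He1r] & Hshift).
  (* The corrected time may exceed T0 a little and must still be below every period; [eta] is the
     room for this. *)
  assert (exists eta, 0 < eta /\ max_interval F x (T0 + eta) /\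
     forall P, is_period F x P -> T0 + eta < P) as (eta & Heta & Ieta & Hpx).
  { destruct (max_interval_open F x T0 IT0) as [d [Hd Ho]].
    destruct (classic (exists P, is_period F x P)) as [[P HP]|Hno].
    - destruct (minimal_period_exists F x P HF Fx HP) as [T HT].
      pose proof (Hper T HT).
      exists (Rmin (d / 2) ((T - T0) / 2)).
      pose proof (Rmin_l (d / 2) ((T - T0) / 2)); pose proof (Rmin_r (d / 2) ((T - T0) / 2)).
      assert (Hp : 0 < Rmin (d / 2) ((T - T0) / 2)) by (apply Rmin_pos; lra).
      split; auto; split; [apply Ho, Rabs_def1; lra|].
      intros P' HP'; destruct HT as [_ HT]; specialize (HT P' HP'); lra.
    - exists (d / 2); split; [lra|split; [apply Ho, Rabs_def1; lra|]].
      intros P HP; exfalso; apply Hno; exists P; auto. }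
  pose proof (flow_box T0 HF C1 ltac:(lra) IT0) as [FB1 FB2].
  rewrite ET0 in FB2.
  destruct (FB1 eps Heps) as [d1 [Hd1 B1]].
  destruct (FB2 _ _ _ _ C2) as [d2 [Hd2 B2]].
  pose proof (flow_box (T0 + eta) HF C1 ltac:(lra) Ieta) as [FB3 _].
  destruct (FB3 1 Rlt_0_1) as [d3 [Hd3 B3]].
  (* Both real parts are below e: eta/2 keeps the new transit time under T0 + eta, T0/2 keeps it
     positive, and eps/2 keeps it within eps of T0. *)
  set (e := Rmin (Rmin (Rmin e1 d1) (Rmin d2 d3)) (Rmin (Rmin (eta / 2) (T0 / 2)) (eps / 2))).
  assert (He : 0 < e) by (repeat apply Rmin_pos; lra).
  assert (Hmin : e <= e1 /\ e <= d1 /\ e <= d2 /\ e <= d3 /\ e <= eta / 2 /\ e <= T0 / 2 /\ e <= eps / 2).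
  { destruct (le_Rmin _ _ _ (Rle_refl e)) as [m1 m2].
    destruct (le_Rmin _ _ _ m1) as [m3 m4]; destruct (le_Rmin _ _ _ m2) as [m5 m6].
    destruct (le_Rmin _ _ _ m3); destruct (le_Rmin _ _ _ m4); destruct (le_Rmin _ _ _ m5); tauto. }
  destruct Hmin as (m1 & m2 & m3 & m4 & m5 & m6 & m7).
  destruct (chart_near 0 e C1) as [dx [Hdx Nx]]; [rewrite Cmod_0; auto|auto|].
  destruct (chart_near 0 e C2) as [dy [Hdy Ny]]; [rewrite Cmod_0; auto|auto|].
  rewrite (ch_0 C1) in Nx; rewrite (ch_0 C2) in Ny.
  pose proof (Cmod_minus_pos x y Hxy) as Hdist.
  set (delta := Rmin (Rmin eps (Cmod (x - y) / 2)) (Rmin dx dy)).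
  assert (Hdl : delta <= eps /\ delta <= Cmod (x - y) / 2 /\ delta <= dx /\ delta <= dy).
  { destruct (le_Rmin _ _ _ (Rle_refl delta)) as [n1 n2].
    destruct (le_Rmin _ _ _ n1); destruct (le_Rmin _ _ _ n2); tauto. }
  destruct Hdl as (n1 & n2 & n3 & n4).
  exists delta; split; [split; auto; repeat apply Rmin_pos; lra|].
  unfold Cdisc; split.
  { intros z [Hz1 Hz2]; pose proof (Cmod_triangle_minus x z y) as T.
    rewrite (Cmod_minus_sym x z) in T; lra. }
  intros Lam HLam _ _ _ x' y' Hx' Lx' Hy' Ly'.
  destruct (Nx x' ltac:(lra)) as (a1 & a2 & a3); destruct (Ny y' ltac:(lra)) as (b1 & b2 & b3).
  set (z := g1 x') in *; set (w := g2 y') in *.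
  replace (z - 0)%C with z in a1 by ring; replace (w - 0)%C with w in b1 by ring.
  assert (Fx' : F x' <> 0) by (rewrite <- a3; apply (ch_nz C1); auto).
  destruct (B1 z ltac:(lra)) as [_ B1z]; rewrite a3 in B1z.
  pose proof (B2 z ltac:(lra)) as B2z; rewrite a3 in B2z.
  destruct (B3 z ltac:(lra)) as [_ B3z]; rewrite a3 in B3z.
  (* [S] is just some time from x' to y', perhaps negative or many turns later; it serves to compare
     heights and need not be the transit time. *)
  destruct (orbit_points F Lam x' y' HF HLam Lx' Ly') as (S & IS & ES).
  (* A shorter period of x' would pass to x: continuation from z to 0 carries the identity Phi(P, .)
     = id to the centre of the chart. *)
  assert (Hpx' : forall P, is_period F x' P -> T0 + eta < P).
  { intros P (HP & IP & EP); apply Rnot_le_lt; intros Hle.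
    assert (HPx : is_period F x P).
    { split; auto; split; [apply (max_interval_conv F x 0 (T0 + eta)); auto; lra|].
      assert (Hcont : flow F P (h1 (z + - z)%C) = h1 (z + - z)%C).
      { apply (flow_continuation F x r1 L1 h1 g1 x r1 L1 h1 g1); auto; [lra| |rewrite a3; auto].
        intros l Hl.
        assert (Hzl : Cmod (z + RtoC l * - z) <= Cmod z).
        { replace (z + RtoC l * - z)%C with (RtoC (1 - l) * z)%C by (rewrite RtoC_minus; ring).
          rewrite Cmod_mult, Cmod_R, Rabs_pos_eq by lra; pose proof (Cmod_ge_0 z); nra. }
        split; [lra|split; [lra|]]; apply (B3 (z + RtoC l * - z)%C); lra. }
      rewrite Cplus_opp_r, (ch_0 C1) in Hcont; auto. }
    specialize (Hpx P HPx); lra. }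
  assert (Ix' : max_interval F x' T0) by (apply B1z; lra).
  assert (Hpart : forall u : C, Cmod u < e -> Rabs (Re u) < r2 / 4 /\ Rabs (Im u) < r2 / 4 /\
     Rabs (Re u) < e /\ Rabs (Im u) < e).
  { intros u Hu; pose proof (Rabs_Re_le u); pose proof (Rabs_Im_le u); repeat split; lra. }
  destruct (Hpart z a1) as (z1 & z2 & z3 & z4); destruct (Hpart w b1) as (w1 & w2 & w3 & w4).
  assert (Z0 : Rabs 0 < r2 / 4) by (rewrite Rabs_R0; lra).
  destruct (flow_pt F y r2 L2 h2 g2 HF C2 (Re z) (Im z) (- Re z)) as [A1 A2]; auto.
  { rewrite Rplus_opp_r; auto. }
  destruct (flow_pt F y r2 L2 h2 g2 HF C2 (Re w) (Im w) (- Re w)) as [A3 A4]; auto.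
  { rewrite Rplus_opp_r; auto. }
  rewrite <- C_Re_Im, Rplus_opp_r in *.
  rewrite <- B2z in A1, A2; rewrite b3, ES in A3, A4.
  destruct (flow_plus F x' T0 (- Re z) HF Ix' A1) as [A5 A6]; rewrite A2 in A6.
  destruct (flow_plus F x' S (- Re w) HF IS A3) as [A7 A8]; rewrite A4 in A8.
  set (sa := T0 + - Re z) in *; set (sb := S + - Re w) in *.
  assert (Hret : forall s t v u, max_interval F x' s -> max_interval F x' t ->
     flow F s x' = h2 (RtoC 0 + Ci * RtoC v)%C -> flow F t x' = h2 (RtoC 0 + Ci * RtoC u)%C ->
     returns F h2 v (t - s) u).
  { intros s t v u Is It Es Et; replace t with (s + (t - s)) in It, Et by ring.
    destruct (flow_minus F x' s (t - s) HF Is It) as [k1 k2].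
    rewrite Es in k1, k2; split; auto; rewrite k2; auto. }
  (* [sa] and [sb] are two crossing times of the orbit of x'; [no_small_shift] wants a positive
     time, so the later crossing counts as a return of the earlier one. *)
  assert (Hheight : Im z = Im w).
  { destruct (Rtotal_order sa sb) as [k|[k|k]].
    - apply (Hshift (Im z) (sb - sa) (Im w)); [lra|lra|lra|apply Hret; auto].
    - destruct (returns_small F y r2 L2 h2 g2 HF C2 (Im z) (sb - sa) (Im w)); auto.
      rewrite k, Rminus_eq_0; auto.
    - symmetry; apply (Hshift (Im w) (sa - sb) (Im z)); [lra|lra|lra|apply Hret; auto]. }
  destruct (flow_pt F y r2 L2 h2 g2 HF C2 0 (Im w) (Re w)) as [A9 A10]; auto.
  { rewrite Rplus_0_l; auto. }
  rewrite Rplus_0_l, <- C_Re_Im, b3 in A10.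
  rewrite Hheight in A6; rewrite <- A6 in A9, A10.
  destruct (flow_plus F x' sa (Re w) HF A5 A9) as [A11 A12]; rewrite A10 in A12.
  apply Rabs_def2 in z3; apply Rabs_def2 in w3.
  assert (Harc' : is_arc F x' y' (sa + Re w)).
  { split; [auto|split; auto]; intros T [HT _]; specialize (Hpx' T HT); unfold sa; lra. }
  rewrite (transit_time_arc F x' y' _ HF Fx' Harc'); split.
  - unfold sa; apply Rabs_def1; lra.
  - intros t Ht; destruct (B1z t Ht) as [k1 k2]; split; [|split; auto].
    + apply (max_interval_conv F x 0 T0); auto; lra.
    + rewrite Cmod_minus_sym; auto.
Qed.
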